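(* Let $K$ be a non-compact hypergroup with a left Haar measure $\mu$, and let $\Omega$ be a Banach ideal space on $K$ satisfying (I)–(VI) of the context. Assume that for every compact subset $U\subset K$ and any $\varepsilon\in(0,\infty)$ there exists some compact subset $V\subset K$ such that $$0<\mu(V)<\infty,\qquad \mu(U\ast V)<(1+\varepsilon)\mu(V)$$ and, for any $x\in V$, $$\delta_{x}\ast\delta_{x^-}=\delta_e=\delta_{x^-}\ast\delta_{x},$$ where $e$ is the identity element of $K$. Let $\varphi,\phi$ be two Young functions such that $\varphi(b_{\varphi})>0$, $\phi(b_{\phi})=\infty$ and $$\lim_{x\to0^+}\frac{\varphi^{-1}(x)}{x}=\infty.$$ Then the set $$\left\{(f,g)\in\Omega_{\varphi}(K)\times\Omega_{\phi}(K):\ |f|\ast|g|\in\Omega_{\phi}(K)\right\}$$ is of first category (in the sense of Baire) in $\Omega_{\varphi}(K)\times\Omega_{\phi}(K)$.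
   Context: **Hypergroups.** Let $K$ be a locally compact Hausdorff space, $\mathcal{M}(K)$ the space of complex-valued Radon measures on $K$, $\mathcal{M}^+(K)$ its non-negative elements, and $\delta_x$ the Dirac measure at $x$. $K$ is a (locally compact) hypergroup if there are a convolution $\ast:\mathcal{M}(K)\times\mathcal{M}(K)\to\mathcal{M}(K)$, an involution $x\mapsto x^-$ on $K$ and an element $e\in K$ (the identity) such that: (i) $(\mathcal{M}(K),+,\ast)$ is a complex Banach algebra; (ii) $\mu\ast\nu\in\mathcal{M}^+(K)$ for $\mu,\nu\in\mathcal{M}^+(K)$, and $(\mu,\nu)\mapsto\mu\ast\nu$ from $\mathcal{M}^+(K)\times\mathcal{M}^+(K)$ to $\mathcal{M}^+(K)$ is continuous for the cone topology, i.e. the weakest topology for which $\mu\mapsto\int_K f\,d\mu$ (each non-negative continuous compactly supported $f$) and $\mu\mapsto\mu(K)$ are continuous; (iii) $\delta_x\ast\delta_y$ is a probability measure with compact support for all $x,y\in K$; (iv) $\delta_e\ast\delta_x=\delta_x=\delta_x\ast\delta_e$; (v) $x\mapsto x^-$ is a homeomorphism, $(x^-)^-=x$, $(\delta_x\ast\delta_y)^-=\delta_{y^-}\ast\delta_{x^-}$, where $\mu^-(A):=\mu(\{x^-:x\in A\})$, and $e\in\operatorname{supp}(\delta_x\ast\delta_y)$ if and only if $x=y^-$; (vi) $(x,y)\mapsto\operatorname{supp}(\delta_x\ast\delta_y)$ is continuous from $K\times K$ into the space $\mathfrak{C}(K)$ of non-empty compact subsets of $K$ with the Michael topology, whose subbasis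 consists of the sets $\{H\in\mathfrak{C}(K): H\cap U\ne\emptyset,\ H\subset V\}$, $U,V\subset K$ open. A left Haar measure on $K$ is a nonzero non-negative Radon measure $\mu$ with $\delta_x\ast\mu=\mu$ for all $x\in K$. For $x,y\in K$, $U,V\subset K$: $\{x\}\ast\{y\}:=\operatorname{supp}(\delta_x\ast\delta_y)$ and $U\ast V:=\bigcup_{x\in U,\,y\in V}\{x\}\ast\{y\}$. $L^0(K)$ is the space of $\mu$-measurable complex-valued functions on $K$. For $f,g\in L^0(K)$, $$(f\ast g)(x):=\int_K f(y)\,g(y^-\ast x)\,d\mu(y),\qquad g(y^-\ast x):=\int_K g(t)\,d(\delta_{y^-}\ast\delta_x)(t).$$ **Young functions.** A Young function is a function $\varphi:\mathbb{R}\to[0,\infty]$ that is convex, even, left continuous on $(0,\infty)$, with $\varphi(0)=0$, and neither identically $0$ nor identically $\infty$ on $(0,\infty)$. Put $b_\varphi:=\sup\{x\in\mathbb{R}:\varphi(x)<\infty\}$ (if $b_\varphi=\infty$, $\varphi(b_\varphi)$ means $\lim_{x\to\infty}\varphi(x)=\infty$) and $\varphi^{-1}(y):=\sup\{x\in[0,\infty):\varphi(x)\le y\}$ for $y\in[0,\infty)$. **Banach ideal spaces.** A Banach space $(\Omega,\|\cdot\|_\Omega)$ is a Banach ideal space on $K$ if $\Omega$ is a linear subspace of $L^0(K)$ and whenever $f\in\Omega$, $g\in L^0(K)$, $|g|\le|f|$ a.e., then $g\in\Omega$ and $\|g\|_\Omega\le\|f\|_\Omega$. The conditions on $\Omega$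 are: (I) if $0\le f_n\in\Omega$, $f\in L^0(K)$ and $f_n\uparrow f$ a.e., then $\|f_n\|_\Omega\uparrow\|f\|_\Omega$ if $f\in\Omega$, and $\|f_n\|_\Omega\to\infty$ if $f\notin\Omega$; (II) $\mathbf{1}_E\in\Omega$ for every measurable $E\subset K$ with $\mu(E)<\infty$; (III) for every measurable $E$ with $\mu(E)<\infty$ there is a positive constant $C_E$ with $\int_E|f|\,d\mu\le C_E\|f\|_\Omega$ for all $f\in\Omega$; (IV) if non-negative $f,g\in\Omega$ are equimeasurable ($\mu(\{f>s\})=\mu(\{g>s\})$ for all $s\ge0$), then $\|f\|_\Omega=\|g\|_\Omega$; (V) $\lim_{s\to0}\Phi_\Omega(s)=0$; (VI) $\lim_{s\to\infty}\Phi_\Omega(s)=\infty$; where $\Phi_\Omega$ is the fundamental function, $\Phi_\Omega(\mu(E)):=\|\mathbf{1}_E\|_\Omega$ for measurable $E$ with $\mu(E)<\infty$ (well defined by (IV); limits are taken along attained values $s=\mu(E)$). **Calderón–Lozanovskiĭ spaces.** For a Young function $\varphi$ and $f\in L^0(K)$ let $I_\varphi(f):=\|\varphi(|f|)\|_\Omega$ if $\varphi(|f|)\in\Omega$ and $I_\varphi(f):=\infty$ otherwise. $\Omega_\varphi(K)$ is the set of $f\in L^0(K)$ with $I_\varphi(f/\lambda)<\infty$ for some $\lambda\in(0,\infty)$, with norm $\|f\|_{\Omega_\varphi(K)}:=\inf\{\lambda>0: I_\varphi(f/\lambda)\le1\}$. The product $\Omega_{\varphi}(K)\times\Omega_{\phi}(K)$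 carries the norm $\max\{\|f\|_{\Omega_{\varphi}(K)},\|g\|_{\Omega_{\phi}(K)}\}$. *)

(* Defs.v *)
From HB Require Import structures.
From mathcomp Require Import all_boot all_order all_algebra.
From mathcomp Require Import complex.
From mathcomp Require Import all_classical all_reals all_analysis.

Set Implicit Arguments.
Unset Strict Implicit.
Unset Printing Implicit Defensive.

Import Order.TTheory GRing.Theory Num.Theory.
Import numFieldNormedType.Exports.

Local Open Scope classical_set_scope.
Local Open Scope ring_scope.
Local Open Scope complex_scope.

(* The library asks measurable types to be pointed, hence the pointed
   topological spaces K below. The base point plays no role. *)
Notation borel K := (g_sigma_algebraType (@open K)).
Notation cabs := ComplexField.Normc.normc.

Section RadonMeasures.
Context {R : realType} {K : ptopologicalType}.

Definition radon (m : set K -> \bar R) : Prop :=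
  [/\ forall C : set K, compact C -> (m C < +oo)%E,
      forall A : set (borel K), measurable A ->
        m A = ereal_inf [set m U | U in [set U : set K | open U /\ A `<=` U]]
    & forall U : set K, open U ->
        m U = ereal_sup [set m C | C in [set C : set K | compact C /\ C `<=` U]]].

Definition measure_variation (nu : set K -> R[i]) (A : set K) : \bar R :=
  ereal_sup [set r | exists F : nat -> set (borel K),
    [/\ forall n, measurable (F n), trivIset setT F, \bigcup_n F n = A
      & r = (\sum_(0 <= n <oo) (cabs (nu (F n)))%:E)%E]].

(* The space M(K). Set functions are total, and those of M(K) vanish by
   convention on the sets which are not Borel, so that equality of functions is
   equality of measures. *)
Definition radonC (nu : set K -> R[i]) : Prop :=
  [/\ forall F : nat -> set (borel K), (forall n, measurable (F n)) ->
        trivIset setT F ->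
        (\sum_(0 <= k < n) nu (F k)) @[n --> \oo]
          --> (nu (\bigcup_n F n) : R[i]^o),
      forall A : set (borel K), ~ measurable A -> nu A = 0
    & radon (measure_variation nu)].

Definition radonC_ge0 (nu : set K -> R[i]) : Prop :=
  radonC nu /\ forall A, 0 <= nu A.

Definition diracC (x : K) : set K -> R[i] :=
  fun A => (`[< measurable (A : set (borel K)) /\ A x >])%:R.

(* The extended real valued measure of nu in M^+(K), to integrate against it *)
Definition emeasure (nu : set K -> R[i]) : set (borel K) -> \bar R :=
  fun A => (complex.Re (nu A))%:E.

(* For nu in M^+(K); a signed nu would require its variation. *)
Definition supp (nu : set K -> R[i]) : set K :=
  [set x | forall U, open U -> U x -> nu U != 0].

Definition Cc_ge0 (f : K -> R) : Prop :=
  [/\ continuous f, compact (closure [set x | f x != 0])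
    & forall x, 0 <= f x].

(* The cone topology on M^+(K) is the restriction to M^+(K) of the initial
   topology for this map: the index None carries nu |-> nu(K), and the index
   Some f carries nu |-> \int f dnu. *)
Definition cone_eval (nu : set K -> R[i])
    : {ptws option {f : K -> R | Cc_ge0 f} -> R} :=
  fun i => if i is Some f
           then fine (\int[emeasure nu]_x (sval f x)%:E)
           else complex.Re (nu setT).

Definition cone_space : Type := initial_topology cone_eval.

HB.instance Definition _ := Topological.on cone_space.

End RadonMeasures.
Arguments cone_space : clear implicits.

(* The topology on all subsets of K with the Michael subbasis; the Michael
   topology is its restriction to the non-empty compact subsets. *)
Definition michael_space (K : topologicalType) : Type := set K.

Section Michael.
Variable K : topologicalType.

HB.instance Definition _ := Choice.on (michael_space K).
HB.instance Definition _ := @isSubBaseTopological.Build (michael_space K)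
  (set K * set K)%type [set UV | open UV.1 /\ open UV.2]
  (fun UV => [set H : set K | H `&` UV.1 !=set0 /\ H `<=` UV.2]).

End Michael.

Section Hypergroups.
Variables (R : realType) (K : ptopologicalType).

Record banach_algebra_law
    (conv : (set K -> R[i]) -> (set K -> R[i]) -> (set K -> R[i])) : Prop := {
  conv_radonC : forall mu nu, radonC mu -> radonC nu -> radonC (conv mu nu);
  convM_assoc : forall mu nu la, radonC mu -> radonC nu -> radonC la ->
    conv mu (conv nu la) = conv (conv mu nu) la;
  convDl : forall mu nu la, radonC mu -> radonC nu -> radonC la ->
    conv (mu \+ nu) la = conv mu la \+ conv nu la;
  convDr : forall mu nu la, radonC mu -> radonC nu -> radonC la ->
    conv mu (nu \+ la) = conv mu nu \+ conv mu la;
  convZl : forall (c : R[i]) mu nu, radonC mu -> radonC nu ->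
    conv (fun A => c * mu A) nu = (fun A => c * conv mu nu A);
  convZr : forall (c : R[i]) mu nu, radonC mu -> radonC nu ->
    conv mu (fun A => c * nu A) = (fun A => c * conv mu nu A);
  conv_norm : forall mu nu, radonC mu -> radonC nu ->
    (measure_variation (conv mu nu) setT
      <= measure_variation mu setT * measure_variation nu setT)%E;
  radonC_complete : forall u : nat -> set K -> R[i],
    (forall n, radonC (u n)) ->
    (forall eps : R, 0 < eps -> exists N, forall m n, (N <= m)%N -> (N <= n)%N ->
      (measure_variation (u m \- u n)%R setT < eps%:E)%E) ->
    exists2 nu, radonC nu &
      measure_variation (u n \- nu) setT @[n --> \oo] --> 0%E }.

Record hypergroup := {
  hg_conv : (set K -> R[i]) -> (set K -> R[i]) -> (set K -> R[i]);
  hg_inv : K -> K;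
  hg_id : K;
  hg_hausdorff : hausdorff_space K;
  hg_locally_compact : locally_compact [set: K];
  hg_banach : banach_algebra_law hg_conv;
  hg_conv_ge0 : forall mu nu,
    radonC_ge0 mu -> radonC_ge0 nu -> radonC_ge0 (hg_conv mu nu);
  hg_conv_continuous :
    {within [set p : cone_space R K * cone_space R K |
              radonC_ge0 p.1 /\ radonC_ge0 p.2],
      continuous (fun p => hg_conv p.1 p.2 : cone_space R K)};
  hg_proba : forall x y, hg_conv (diracC x) (diracC y) setT = 1;
  hg_compact_supp : forall x y,
    compact (supp (hg_conv (diracC x) (diracC y)));
  hg_idl : forall x, hg_conv (diracC hg_id) (diracC x) = diracC x;
  hg_idr : forall x, hg_conv (diracC x) (diracC hg_id) = diracC x;
  hg_inv_continuous : continuous hg_inv;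
  hg_invK : involutive hg_inv;
  hg_conv_inv : forall x y,
    (fun A => hg_conv (diracC x) (diracC y) (hg_inv @` A))
      = hg_conv (diracC (hg_inv y)) (diracC (hg_inv x));
  hg_supp_id : forall x y,
    supp (hg_conv (diracC x) (diracC y)) hg_id <-> x = hg_inv y;
  hg_supp_continuous :
    continuous (fun p : K * K =>
      supp (hg_conv (diracC p.1) (diracC p.2)) : michael_space K) }.

Variable H : hypergroup.

Definition hconv_dirac (x y : K) : set K -> R[i] :=
  hg_conv H (diracC x) (diracC y).

Definition hmul (U V : set K) : set K :=
  \bigcup_(x in U) \bigcup_(y in V) supp (hconv_dirac x y).

(* F(x * y) *)
Definition htrans (F : K -> \bar R) (x y : K) : \bar R :=
  (\int[emeasure (hconv_dirac x y)]_t F t)%E.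

(* As mu need not be finite, delta_x * mu is the Radon measure representing the
   functional f |-> \int f(x * y) dmu(y) on C_c(K). *)
Definition left_haar (mu : {measure set (borel K) -> \bar R}) : Prop :=
  [/\ radon mu, mu setT != 0%E
    & forall (x : K) (f : K -> R), Cc_ge0 f ->
        (\int[mu]_y htrans (EFin \o f) x y = \int[mu]_y (f y)%:E)%E].

(* (F * G)(x) for [0, +oo]-valued F and G *)
Definition hconv_fun (mu : {measure set (borel K) -> \bar R})
    (F G : K -> \bar R) (x : K) : \bar R :=
  (\int[mu]_y (F y * htrans G (hg_inv H y) x))%E.

End Hypergroups.

Section Young.
Context {R : realType}.
Implicit Type phi : R -> \bar R.

Definition young phi : Prop :=
  [/\ forall x, (0 <= phi x)%E,
      forall x y t : R, 0 <= t <= 1 ->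
        (phi (t * x + (1 - t) * y)%R <= t%:E * phi x + (1 - t)%:E * phi y)%E,
      forall x, phi (- x) = phi x
    & forall x, 0 < x -> phi z @[z --> x^'-] --> phi x] /\
  [/\ phi 0 = 0%E,
      exists2 x, 0 < x & phi x <> 0%E
    & exists2 x, 0 < x & phi x <> +oo%E].

Definition young_b phi : \bar R :=
  ereal_sup [set x%:E | x in [set x | (phi x < +oo)%E]].

(* phi(b_phi) *)
Definition young_at_b phi : \bar R :=
  if young_b phi is b%:E then phi b else +oo%E.

(* The set below is bounded when phi is a Young function. *)
Definition young_inv phi (y : R) : R :=
  sup [set x | 0 <= x /\ (phi x <= y%:E)%E].

End Young.

Section Spaces.
Context {R : realType} {K : ptopologicalType}.
Variable mu : {measure set (borel K) -> \bar R}.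

(* Functions are not quotiented by equality a.e.; as each measurable function
   for the completion of mu is a.e. equal to a Borel one, it is enough to
   consider the latter. *)
Definition L0 (f : K -> R[i]) : Prop :=
  measurable_fun [set: borel K] (fun x : borel K => complex.Re (f x)) /\
  measurable_fun [set: borel K] (fun x : borel K => complex.Im (f x)).

Variables (Omega : set (K -> R[i])) (nrm : (K -> R[i]) -> R).

Record banach_ideal_space : Prop := {
  bis_L0 : Omega `<=` L0;
  bis_0 : Omega (fun=> 0);
  bis_D : forall f g, Omega f -> Omega g -> Omega (f \+ g);
  bis_Z : forall (c : R[i]) f, Omega f -> Omega (fun x => c * f x);
  bis_norm_ge0 : forall f, Omega f -> 0 <= nrm f;
  bis_norm_eq0 : forall f, Omega f ->
    (nrm f = 0 <-> {ae mu, forall x, f x = 0});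
  bis_normD : forall f g, Omega f -> Omega g -> nrm (f \+ g) <= nrm f + nrm g;
  bis_normZ : forall (c : R[i]) f, Omega f ->
    nrm (fun x => c * f x) = cabs c * nrm f;
  bis_complete : forall u : nat -> K -> R[i], (forall n, Omega (u n)) ->
    (forall eps : R, 0 < eps -> exists N, forall m n, (N <= m)%N -> (N <= n)%N ->
      nrm (u m \- u n) < eps) ->
    exists2 f, Omega f & nrm (u n \- f) @[n --> \oo] --> (0 : R);
  bis_ideal : forall f g, Omega f -> L0 g ->
    {ae mu, forall x, cabs (g x) <= cabs (f x)} ->
    Omega g /\ nrm g <= nrm f }.

Definition condI : Prop :=
  forall (u : nat -> K -> R[i]) (f : K -> R[i]),
    (forall n, Omega (u n)) -> L0 f ->
    {ae mu, forall x, [/\ forall n, 0 <= u n x, forall n, u n x <= u n.+1 x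
                        & u n x @[n --> \oo] --> (f x : R[i]^o)]} ->
    (Omega f -> {homo (fun n => nrm (u n)) : m n / (m <= n)%N >-> m <= n} /\
                nrm (u n) @[n --> \oo] --> nrm f) /\
    (~ Omega f -> nrm (u n) @[n --> \oo] --> +oo).

Definition condII : Prop :=
  forall E : set (borel K), measurable E -> (mu E < +oo)%E -> Omega \1_E.

Definition condIII : Prop :=
  forall E : set (borel K), measurable E -> (mu E < +oo)%E ->
    exists2 C : R, 0 < C & forall f, Omega f ->
      (\int[mu]_(x in E) (cabs (f x))%:E <= (C * nrm f)%:E)%E.

Definition condIV : Prop :=
  forall f g, Omega f -> Omega g ->
    (forall x, 0 <= f x) -> (forall x, 0 <= g x) ->
    (forall s : R, 0 <= s ->
      mu [set x | s%:C < f x] = mu [set x | s%:C < g x]) ->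
    nrm f = nrm g.

Definition attained : set R :=
  [set s | exists2 E : set (borel K), measurable E & mu E = s%:E].

(* The value is unique under condition IV. *)
Definition fundamental (s : R) : R :=
  xget 0 [set r | exists E : set (borel K),
    [/\ measurable E, mu E = s%:E & r = nrm \1_E]].

Definition condV : Prop :=
  fundamental s @[s --> within attained 0^'+] --> (0 : R).

Definition condVI : Prop :=
  fundamental s @[s --> within attained +oo] --> +oo.

(* h is, up to equality a.e., the extended real valued function F *)
Definition ae_represents (h : K -> R[i]) (F : K -> \bar R) : Prop :=
  {ae mu, forall x, F x \is a fin_num /\ h x = (fine (F x))%:C}.

Definition fineC (F : K -> \bar R) : K -> R[i] := fun x => (fine (F x))%:C.

Definition modular (phi : R -> \bar R) (f : K -> R[i]) : \bar R :=
  let F := fun x => phi (cabs (f x)) in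
  if `[< Omega (fineC F) /\ ae_represents (fineC F) F >]
  then (nrm (fineC F))%:E else +oo%E.

Definition CL_space (phi : R -> \bar R) : set (K -> R[i]) :=
  [set f | L0 f /\ exists2 la : R, 0 < la &
    (modular phi (fun x => f x / la%:C)%R < +oo)%E].

Definition CL_norm (phi : R -> \bar R) (f : K -> R[i]) : R :=
  inf [set la : R | 0 < la /\ (modular phi (fun x => f x / la%:C)%R <= 1)%E].

End Spaces.

(* X with the topology induced by a (pseudo)distance d *)
Definition dist_space (R : realType) (T : Type) (X : set T) (d : T -> T -> R)
  : Type := X.

Section DistSpace.
Variables (R : realType) (T : choiceType) (X : set T) (d : T -> T -> R).

Definition dist_open (A : set (dist_space X d)) : Prop :=
  forall p, A p -> exists2 r : R, 0 < r &
    [set q : X | d (set_val p) (set_val q) < r] `<=` A.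

Lemma dist_openT : dist_open setT.
Proof. by move=> p _; exists 1. Qed.

Lemma dist_openI : setI_closed dist_open.
Proof.
move=> A B oA oB p [/oA[r r0 rA] /oB[s s0 sB]].
exists (Num.min r s); first by rewrite lt_min r0.
by move=> q /=; rewrite lt_min => /andP[/rA ? /sB].
Qed.

Lemma dist_open_bigU (I : Type) (F : I -> set (dist_space X d)) :
  (forall i, dist_open (F i)) -> dist_open (\bigcup_i F i).
Proof.
move=> oF p [i _ /oF[r r0 rF]]; exists r => // q /rF Fq.
by exists i.
Qed.

HB.instance Definition _ := Choice.on (dist_space X d).
HB.instance Definition _ := isOpenTopological.Build (dist_space X d)
  dist_openT dist_openI dist_open_bigU.

End DistSpace.

Definition nowhere_dense (T : topologicalType) (A : set T) : Prop :=
  (closure A)° = set0.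

Definition first_category (T : topologicalType) (A : set T) : Prop :=
  exists2 F : nat -> set T, forall n, nowhere_dense (F n) & A = \bigcup_n F n.

(* Omega_phi(K) x Omega_psi(K) with the maximum norm; not identifying functions
   equal a.e. makes it a seminormed space, with the same first category sets up
   to the quotient map. *)
Definition CL_prod (R : realType) (K : ptopologicalType)
    (mu : {measure set (borel K) -> \bar R})
    (Omega : set (K -> R[i])) (nrm : (K -> R[i]) -> R)
    (phi psi : R -> \bar R) :=
  dist_space (CL_space mu Omega nrm phi `*` CL_space mu Omega nrm psi)
    (fun p q => Num.max (CL_norm mu Omega nrm phi (p.1 \- q.1))
                        (CL_norm mu Omega nrm psi (p.2 \- q.2))).

(* Main.v *)
Require Import Defs.
From HB Require Import structures.
From mathcomp Require Import all_boot all_order all_algebra.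
From mathcomp Require Import finmap complex ring lra.
From mathcomp Require Import all_classical all_reals all_analysis measurable_realfun.

Set Implicit Arguments.
Unset Strict Implicit.
Unset Printing Implicit Defensive.

Import Order.TTheory GRing.Theory Num.Theory.
Import numFieldNormedType.Exports.

Local Open Scope classical_set_scope.
Local Open Scope ring_scope.
Local Open Scope complex_scope.

(** The hypotheses leave no room for a genuine hypergroup. Call x group-like
    when the Dirac measures at x and x^- are inverse to each other.
    Convolution by such a Dirac measure is invertible and positive, hence it
    permutes the extreme points: the convolution of a Dirac measure with a
    group-like one is again a Dirac measure ([grouplike_conv],
    [conv_grouplike]). All points of the sets V of the Folner condition are
    group-like. If x were not, then V and {x} * V would be disjoint, whereas
    left invariance gives mu ({x} * V) >= mu V ([haar_le]), so that the choice
    U = {e, x}, eps = 1 would contradict mu (U * V) < 2 mu V. So every point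
    is group-like and K is a locally compact group ([folner_grouplike],
    [folner_group]).

    On the group, the set of the statement is the union of the sets F_n of the
    pairs (f, g) for which |f| * |g|, divided by n + 1, has modular at most 1.
    Each F_n is nowhere dense, because every ball contains a smaller ball
    which avoids F_n ([escape]). Given (f0, g0) and r, take a compact set U, a
    Folner set V for the union T of {e} and U^-1, and W = T V. Add to f0 a
    function of modulus a on U, and to g0 a function of modulus b on W, with
    signs making |f1| >= a on U and |g1| >= b on W. For x in V and y in U the
    point y^-1 x lies in W, so (|f1| * |g1|)(x) >= a b mu U on V. Within the
    budget r, a and b can be of the order of phi^-1 (1 / ||1_U||) and psi^-1
    (1 / ||1_W||). As V and W have comparable measures, a modular at most 1
    for |f1| * |g1| / (n + 1) would bound phi^-1 (1 / ||1_U||) mu U by a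
    constant. This is false for a suitable U ([big_compact]): let U be the
    union of N disjoint translates of a fixed compact set. Then mu U / ||1_U||
    is bounded below by subadditivity, ||1_U|| tends to infinity with N by the
    condition [condVI], and phi^-1 (t) / t tends to infinity when t tends to
    0.

    Two points make this argument robust. First, a pair (f, g) close to (f1,
    g1) is still large outside sets of small measure ([CL_small_measure]), and
    the exceptional set in W has to be transported by (x, y) |-> y^-1 x. When
    K is not second countable, this map may fail to be measurable for the
    product of the Borel sigma-algebras, so Fubini's theorem does not apply;
    the needed inequality is proved with finite unions of rectangles
    ([fubini_open]). Second, the norms of indicators are related by the
    condition [condIV] only for sets of equal measures; comparing sets of
    comparable measures uses that a set of smaller measure has an
    equimeasurable copy inside a set of larger measure
    ([exists_subset_measure]), which holds since mu either has atoms of one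
    single mass or is diffuse. *)

(** * Complex numbers *)

Section Complex.
Variable R : realType.
Implicit Types (z w : R[i]) (x : R).

Lemma normCE z : `|z| = (cabs z)%:C.
Proof. by case: z. Qed.

Lemma Re_sum (I : Type) (r : seq I) (P : pred I) (F : I -> R[i]) :
  complex.Re (\sum_(i <- r | P i) F i) = \sum_(i <- r | P i) complex.Re (F i).
Proof. by elim/big_rec2: _ => [//|i y1 y2 _ <-]; case: (F i) y2 => [a b] []. Qed.

Lemma cabs_real x : cabs x%:C = `|x|.
Proof. by rewrite /= expr0n addr0 sqrtr_sqr. Qed.

Lemma ge0_complexE z : 0 <= z -> z = (complex.Re z)%:C.
Proof. by case: z => a b; rewrite lecE /= => /andP[/eqP-> _]. Qed.

Lemma Re_ge0 z : 0 <= z -> 0 <= complex.Re z.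
Proof. by case: z => a b; rewrite lecE /= => /andP[]. Qed.

Lemma cvg_real_complex (u : nat -> R) (l : R) :
  (u n)%:C @[n --> \oo] --> (l%:C : R[i]^o) <-> u n @[n --> \oo] --> l.
Proof.
split=> h.
  apply/(@cvgrPdist_lt _ R) => e e0; have e0' : 0 < e%:C by rewrite ltcR.
  have := (@cvgrPdist_lt _ R[i]^o _ _ _ _ _).1 h _ e0'.
  case=> N N0 hN; exists N => // n /= Nn; have /= := hN n Nn.
  by rewrite -rmorphB normCE cabs_real ltcR.
apply/(@cvgrPdist_lt _ R[i]^o) => e e0.
have eE : e = (complex.Re e)%:C by apply: ge0_complexE; exact: ltW.
have e0' : 0 < complex.Re e by rewrite -ltcR -eE.
have := (@cvgrPdist_lt _ R _ _ _ _ _).1 h _ e0'.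
case=> N N0 hN; exists N => // n /= Nn; have /= := hN n Nn.
by rewrite -rmorphB normCE cabs_real eE ltcR.
Qed.

Lemma cabs_ge0 z : 0 <= cabs z.
Proof. by case: z => a b; exact: sqrtr_ge0. Qed.

Lemma cabsM z w : cabs (z * w) = cabs z * cabs w.
Proof. exact: ComplexField.Normc.normcM. Qed.

Lemma cabsD z w : cabs (z + w) <= cabs z + cabs w.
Proof. by rewrite -lecR -!normCE rmorphD/= -!normCE; exact: ler_normD. Qed.

Lemma cabsN z : cabs (- z) = cabs z.
Proof. by apply: (@complexI R); rewrite -!normCE normrN. Qed.

Lemma cabs0 : cabs (0 : R[i]) = 0. Proof. exact: ComplexField.Normc.normc0. Qed.

Lemma cabs_div z (l : R) : 0 < l -> cabs (z / l%:C) = cabs z / l.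
Proof.
move=> l0; rewrite -fmorphV cabsM cabs_real ger0_norm// invr_ge0; exact: ltW.
Qed.

Lemma ge_Re_cabs z : `|complex.Re z| <= cabs z.
Proof.
by case: z => a b /=; rewrite -sqrtr_sqr ler_wsqrtr// lerDl sqr_ge0.
Qed.

End Complex.

(** * Compact sets and cut-off functions *)

(** The list form of compactness suits inductions over the covering sets. *)
Lemma compact_seq_cover (T : ptopologicalType) (C : set T) (f : T -> set T) :
  compact C -> (forall x, C x -> open (f x) /\ f x x) ->
  exists s : seq T, (forall i, i \in s -> C i) /\
    C `<=` \big[setU/set0]_(i <- s) f i.
Proof.
rewrite compact_cover => cC h.
have [|x Cx|D DC CD] := cC T C f; first by move=> i /h[].
  by exists x => //; have [] := h _ Cx.
exists (enum_fset D); split=> [i /DC|]; first by rewrite inE.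
by rewrite -bigcup_fset.
Qed.

Section Urysohn.
Variables (R : realType) (K : ptopologicalType).
Hypotheses (hK : hausdorff_space K) (lK : locally_compact [set: K]).

(** A finite sum of functions, each larger than 1 near a point of C and
    supported in a compact neighbourhood inside U, is cut off at 1. *)
Lemma Urysohn_Cc (C U : set K) : compact C -> open U -> C `<=` U ->
  exists k : K -> R, [/\ Cc_ge0 k, forall x, k x <= 1,
    forall x, C x -> k x = 1 & forall x, ~ U x -> k x = 0].
Proof.
move=> cC oU CU.
have /choice[g hg] : forall x : K, exists g : K -> R, C x ->
    [/\ continuous g, forall y, 0 <= g y, 1 < g x, forall y, ~ U y -> g y = 0 &
      exists2 B : set K, compact B /\ closed B & forall y, ~ B y -> g y = 0].
  move=> x; have [Cx|nCx] := pselect (C x); last by exists (fun=> 0).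
  have [B nB [cB clB]] := lK (x := x) I.
  rewrite withinET in nB.
  have oUB : open (U `&` B°) by apply: openI => //; exact: open_interior.
  have clN : closed (~` (U `&` B°)) by exact: open_closedC.
  have nNx : ~ (~` (U `&` B°)) x by apply; split; [exact: CU|exact: nB].
  have f0 := @locally_compact_completely_regular K R lK hK _ _ clN nNx.
  have [f [cf f01 fx fU]] := (@uniform_separatorP _ R _ _).1 f0.
  have fxE : f x = 0 by apply: fx; exists x.
  have f1 y : 0 <= f y <= 1.
    by have := f01 (f y); rewrite /= in_itv/=; apply; exists y.
  have fUE y : ~ (U `&` B°) y -> f y = 1 by move=> h; apply: fU; exists y.
  exists (fun y => 2 * (1 - f y)) => _; split.
  - move=> y; apply: cvgM; first exact: cvg_cst.
    by apply: cvgB; [exact: cvg_cst|exact: cf].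
  - by move=> y; rewrite mulr_ge0// subr_ge0; have /andP[] := f1 y.
  - by rewrite fxE subr0 mulr1 ltr1n.
  - by move=> y nUy; rewrite fUE ?subrr ?mulr0// => -[].
  - exists B => // y nBy; rewrite fUE ?subrr ?mulr0// => -[_ /interior_subset].
    exact: nBy.
have [x Cx|s [sC Cs]] := compact_seq_cover (f := fun x => [set y | 1 < g x y]) cC.
  have [cg _ gx _ _] := hg _ Cx; split => //.
  by apply: (@open_comp _ _ (g x) [set t | 1 < t]) => //; exact: open_gt.
have sumge0 y : 0 <= \sum_(i <- s) g i y.
  by rewrite big_seq; apply: sumr_ge0 => i /sC/hg[].
pose k y := Num.min 1 (\sum_(i <- s) g i y).
have ck : continuous k.
  move=> y; apply: (@continuous_min _ _ (fun=> 1) (fun y => \sum_(i <- s) g i y)).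
    exact: cst_continuous.
  elim: s {Cs sumge0 k} sC => [|i s IH] sC.
    rewrite (_ : (fun _ => _) = fun=> 0); first exact: cst_continuous.
    by apply/funext => z; rewrite big_nil.
  rewrite (_ : (fun _ => _) = fun y => g i y + \sum_(j <- s) g j y); last first.
    by apply/funext => z; rewrite big_cons.
  have [cgi _ _ _ _] := hg i (sC i (mem_head _ _)).
  apply: (@cvgD _ R); first exact: cgi.
  by apply: IH => j js; apply: sC; rewrite inE js orbT.
have kE y : (forall i, i \in s -> g i y = 0) -> k y = 0.
  move=> h; rewrite /k big_seq big1 ?minEle ?ler10//; exact: h.
have /choice[B hB] : forall x, exists B : set K, C x -> (compact B /\ closed B) /\
    (forall y, ~ B y -> g x y = 0).
  move=> x; have [Cx|nCx] := pselect (C x); last by exists set0.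
  by have [_ _ _ _ [B ? ?]] := hg _ Cx; exists B.
exists k; split.
- split => //; last by move=> y; rewrite /k le_min ler01 sumge0.
  pose D := \big[setU/set0]_(i <- s) (if i \in s then B i else set0).
  have cD : compact D.
    apply: bigsetU_compact => i _; case: ifPn => [/sC/hB[[]]//|_].
    exact: compact0.
  apply: (subclosed_compact _ cD); first exact: closed_closure.
  have /closure_id -> := compact_closed hK cD; apply: closureS => y /= /eqP ky.
  apply: contrapT => nDy; apply: ky; apply: kE => i si.
  have [_] := hB _ (sC _ si); apply => Biy; apply: nDy.
  by rewrite /D -bigcup_seq; exists i => //=; rewrite si.
- by move=> y; rewrite /k ge_min lexx.
- move=> y /Cs; rewrite -bigcup_seq => -[i /= si giy].
  rewrite /k minEle; case: leP => // /ltW h; apply/eqP; rewrite eq_le h/=.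
  move: (h); rewrite (big_rem i)//= => h'.
  have : 0 <= \sum_(j <- rem i s) g j y.
    by rewrite big_seq; apply: sumr_ge0 => j /mem_rem/sC/hg[_ + _ _ _]; exact.
  by move: h' giy; rewrite /mkset; lra.
- by move=> y nUy; apply: kE => i /sC/hg[_ _ _ + _]; exact.
Qed.

End Urysohn.

(** * Finite Radon measures as elements of M(K) *)

Section FiniteRadon.
Variables (R : realType) (K : ptopologicalType).
Hypothesis hK : hausdorff_space K.
Implicit Types (nu : set K -> R[i]) (m : {measure set (borel K) -> \bar R}).

Lemma measurable_open (U : set K) : open U -> measurable (U : set (borel K)).
Proof. by move=> oU; exact: sub_sigma_algebra. Qed.

Lemma measurable_closed (C : set K) :
  closed C -> measurable (C : set (borel K)).
Proof.
move=> cC; rewrite -[C]setCK; apply: measurableC.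
by apply: measurable_open; rewrite openC.
Qed.

Lemma measurable_compact (C : set K) :
  compact C -> measurable (C : set (borel K)).
Proof. by move=> cC; apply: measurable_closed; exact: compact_closed. Qed.

Lemma measurable_point (x : K) : measurable ([set x] : set (borel K)).
Proof. by apply: measurable_compact; exact: compact_set1. Qed.

Lemma eq_radon (m1 m2 : set (borel K) -> \bar R) :
  (forall A : set (borel K), measurable A -> m1 A = m2 A) ->
  radon (m1 : set K -> \bar R) -> radon (m2 : set K -> \bar R).
Proof.
move=> e [r1 r2 r3]; split.
- by move=> C cC; rewrite -e; [exact: r1|exact: measurable_compact].
- move=> A mA; rewrite -e// r2//; congr ereal_inf.
  by apply: eq_imagel => U [oU _]; rewrite e//; exact: measurable_open.
- move=> U oU; rewrite -e ?r3//; last exact: measurable_open.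
  congr ereal_sup; apply: eq_imagel => C [cC _].
  by rewrite e//; exact: measurable_compact.
Qed.

(** The inverse of [emeasure]: a finite measure seen in M(K), extended by 0
    outside the Borel sets as the elements of M(K) are. *)
Definition toC (m : set (borel K) -> \bar R) : set K -> R[i] :=
  fun A => if `[< measurable (A : set (borel K)) >] then (fine (m A))%:C else 0.

Lemma toC_mE (m : set (borel K) -> \bar R) (A : set (borel K)) :
  measurable A -> toC m A = (fine (m A))%:C.
Proof. by move=> mA; rewrite /toC; case: asboolP. Qed.

Lemma toC_notm (m : set (borel K) -> \bar R) (A : set (borel K)) :
  ~ measurable A -> toC m A = 0.
Proof. by move=> mA; rewrite /toC; case: asboolP. Qed.

Lemma fin_le_setT m (A : set (borel K)) : (m setT < +oo)%E -> measurable A ->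
  m A \is a fin_num.
Proof.
move=> mT mA; rewrite ge0_fin_numE//; apply: le_lt_trans mT.
by apply: le_measure; rewrite ?inE.
Qed.

(** All the sums over countable partitions of A are equal to m A by countable
    additivity. *)
Lemma variation_ge0 nu m : (forall A, 0 <= nu A) ->
  (forall A : set (borel K), measurable A -> (complex.Re (nu A))%:E = m A) ->
  forall A : set (borel K), measurable A -> measure_variation nu A = m A.
Proof.
move=> nu0 e A mA.
have val F : (forall n, measurable (F n : set (borel K))) ->
    trivIset setT F -> \bigcup_n F n = A ->
    (\sum_(0 <= n <oo) (cabs (nu (F n)))%:E)%E = m A.
  move=> mF tF <-; rewrite measure_bigcup//.
  transitivity (\sum_(0 <= n <oo) m (F n))%E.
    apply: eq_eseriesr => n _; rewrite -e//; congr EFin.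
    by rewrite [in LHS](ge0_complexE (nu0 _)) cabs_real ger0_norm// Re_ge0.
  by apply: eq_eseriesl => n; rewrite in_setT.
apply/eqP; rewrite eq_le; apply/andP; split.
  by apply: ge_ereal_sup => _ [F [mF tF FA ->]]; rewrite val.
apply: ereal_sup_ubound => /=.
exists (fun n => if n is 0 then A else set0); split.
- by case.
- by apply/trivIsetP => -[|i] [|j] _ _ // _; rewrite ?set0I ?setI0.
- by apply/seteqP; split=> [x [[|n] _]//|x Ax]; exists 0%N.
- apply/esym/val; first by case.
    by apply/trivIsetP => -[|i] [|j] _ _ // _; rewrite ?set0I ?setI0.
  by apply/seteqP; split=> [x [[|n] _]//|x Ax]; exists 0%N.
Qed.

Lemma radonC_toC m : (m setT < +oo)%E -> radon (m : set K -> \bar R) ->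
  radonC_ge0 (toC m).
Proof.
move=> mT rm; have nn A : 0 <= toC m A.
  by rewrite /toC; case: asboolP => // ?; rewrite lecR fine_ge0.
split=> //; split.
- move=> F mF tF; rewrite toC_mE; last exact: bigcupT_measurable.
  have -> : (fun n => \sum_(0 <= k < n) toC m (F k)) =
      (fun n => (fine (\sum_(0 <= k < n) m (F k))%E)%:C).
    apply/funext => n; rewrite -sum_fine.
      by rewrite rmorph_sum; apply: eq_bigr => k _; rewrite toC_mE.
    by move=> i _; exact: fin_le_setT.
  apply/cvg_real_complex; apply: fine_cvg; rewrite fineK.
    by apply: measure_semi_sigma_additive => //; exact: bigcupT_measurable.
  by apply: fin_le_setT => //; exact: bigcupT_measurable.
- by move=> A; exact: toC_notm.
- apply: eq_radon rm => A mA; apply/esym/variation_ge0 => // B mB.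
  by rewrite toC_mE//= fineK// fin_le_setT.
Qed.

(** The constant series of general term nu set0 converges, which is only
    possible for a zero term. *)
Lemma radonC_ge0_set0 nu : radonC nu -> nu set0 = 0.
Proof.
move=> [sa _ _].
have t0 : trivIset [set: nat] (fun=> set0 : set (borel K)).
  by apply/trivIsetP => i j _ _ _; rewrite setI0.
have := sa (fun=> set0) (fun _ => @measurable0 _ _) t0.
rewrite bigcup0//; set a := nu set0 => h.
apply/eqP/negP => /negP a0.
have /(_ _ (`|a| / 2)) := (@cvgrPdist_lt _ R[i]^o _ _ _ _ _).1 h.
rewrite divr_gt0 ?normr_gt0// => /(_ erefl)[N _ hN].
have := hN (N + 2)%N; rewrite /= leq_addr => /(_ erefl).
have := hN (N + 3)%N; rewrite /= leq_addr => /(_ erefl).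
rewrite !sumr_const_nat !subn0 => h1 h2.
rewrite distrC in h1.
have := le_lt_trans (ler_normD _ _) (ltrD h1 h2).
by rewrite addrA subrK addnS mulrS addrK -splitr ltxx.
Qed.

(** With [radonC_toC], this identifies M^+(K) with the finite Radon measures.
    It gives access to the theory of measures for the elements of M^+(K). *)
Lemma emeasure_measure nu : radonC_ge0 nu ->
  exists m, [/\ (m : set (borel K) -> \bar R) = emeasure nu,
    (m setT < +oo)%E, radon (m : set K -> \bar R) & nu = toC m].
Proof.
move=> [rnu nu0]; have [sa nm rv] := rnu.
have e0 : emeasure nu set0 = 0%E by rewrite /emeasure radonC_ge0_set0.
have ege A : (0 <= emeasure nu A)%E by rewrite lee_fin Re_ge0.
have esa : semi_sigma_additive (emeasure nu).
  move=> F mF tF _.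
  have := sa _ mF tF; rewrite [X in _ --> X](ge0_complexE (nu0 _)).
  have -> : (fun n => \sum_(0 <= k < n) nu (F k)) =
      (fun n => (\sum_(0 <= k < n) complex.Re (nu (F k)))%:C).
    apply/funext => n; rewrite -Re_sum; apply: ge0_complexE.
    by apply: sumr_ge0.
  move=> /cvg_real_complex h.
  have -> : (fun n => (\sum_(0 <= k < n) emeasure nu (F k))%E) =
      EFin \o (fun n => \sum_(0 <= k < n) complex.Re (nu (F k))).
    by apply/funext => n; rewrite /emeasure sumEFin.
  by apply: cvg_EFin => //; exact: nearW.
pose M := isMeasure.Build _ (borel K) R (emeasure nu) e0 ege esa.
pose m : {measure set (borel K) -> \bar R} := HB.pack (emeasure nu) M.
exists m; split=> //.
- exact: ltry.
- by apply: eq_radon rv => A mA; apply: (@variation_ge0 nu m).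
- apply/funext => A; have [mA|mA] := pselect (measurable (A : set (borel K))).
    by rewrite toC_mE// -ge0_complexE.
  by rewrite toC_notm// nm.
Qed.
Lemma radon_outer m (A : set (borel K)) (e : R) : radon (m : set K -> \bar R) ->
  measurable A -> m A \is a fin_num -> 0 < e ->
  exists U : set K, [/\ open U, A `<=` U & (m U < m A + e%:E)%E].
Proof.
move=> [_ r2 _] mA fA e0.
have : (ereal_inf [set m U | U in [set U : set K | open U /\ A `<=` U]] <
    m A + e%:E)%E by rewrite -r2// lteDl// lte_fin.
by move=> /ereal_inf_lt[_ [U [oU AU] <-] h]; exists U.
Qed.

Lemma radon_inner m (U : set K) (e : R) : radon (m : set K -> \bar R) ->
  open U -> m U \is a fin_num -> 0 < e ->
  exists C : set K, [/\ compact C, C `<=` U & (m U < m C + e%:E)%E].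
Proof.
move=> [_ _ r3] oU fU e0.
have : (m U - e%:E < ereal_sup
    [set m C | C in [set C : set K | compact C /\ C `<=` U]])%E.
  by rewrite -r3// lteBlDr// lteDl// lte_fin.
move=> /ereal_sup_gt[_ [C [cC CU] <-] h]; exists C; split => //.
by rewrite -lteBlDr.
Qed.

(** The approximations of A by an open set and of U by a compact set remain
    valid after intersection with D, since the errors only decrease. *)
Lemma radon_mrestr m (D : set (borel K)) (mD : measurable D) :
  (m setT < +oo)%E -> radon (m : set K -> \bar R) ->
  radon (mrestr m mD : set K -> \bar R).
Proof.
move=> mT rm; have fin := fun A => @fin_le_setT m A mT.
have le A B : measurable (A : set (borel K)) -> measurable (B : set (borel K)) ->
  A `<=` B -> (m A <= m B)%E by move=> ? ? ?; apply: le_measure; rewrite ?inE.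
have mI A : measurable (A : set (borel K)) -> measurable (A `&` D).
  by move=> mA; exact: measurableI.
split.
- move=> C /measurable_compact mC; apply: le_lt_trans mT; apply: le => //.
  exact: mI.
- move=> A mA; apply/eqP; rewrite eq_le; apply/andP; split.
    apply: le_ereal_inf_tmp => _ [U [oU AU] <-]; apply: le; try exact: mI.
      by apply: mI; exact: measurable_open.
    exact: setSI.
  apply/lee_addgt0Pr => e e0.
  have [U [oU AU mU]] := radon_outer rm mA (fin _ mA) e0.
  have mU' := measurable_open oU.
  apply: (@le_trans _ _ (m (U `&` D))).
    by apply: ereal_inf_lbound; exists U.
  rewrite /mrestr; have mUA : measurable (U `\` A : set (borel K)) by exact: measurableD.
  apply: (@le_trans _ _ (m ((A `&` D) `|` (U `\` A)))).
    apply: le; [exact: mI|by apply: measurableU => //; exact: mI|].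
    by move=> x [Ux Dx]; have [Ax|nAx] := pselect (A x); [left|right].
  apply: le_trans (measureU2 _ _ _) _ => //; first exact: mI.
  rewrite leeD2l//; have := mU; rewrite -{1}(setDUK AU) measureU//.
    by rewrite lteD2lE ?fin//; exact: ltW.
  by rewrite setDE setIC -setIA setICl setI0.
- move=> U oU; have mU := measurable_open oU.
  apply/eqP; rewrite eq_le; apply/andP; split; last first.
    apply: ge_ereal_sup => _ [C [cC CU] <-]; apply: le.
    + by apply: mI; exact: measurable_compact.
    + exact: mI.
    + exact: setSI.
  apply/lee_addgt0Pr => e e0.
  have [C [cC CU mC]] := radon_inner rm oU (fin _ mU) e0.
  have mC' := measurable_compact cC.
  apply: (@le_trans _ _ (m (C `&` D) + e%:E)%E); last first.
    by rewrite leeD2r//; apply: ereal_sup_ubound; exists C.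
  rewrite /mrestr; have mUC : measurable (U `\` C : set (borel K)) by exact: measurableD.
  apply: (@le_trans _ _ (m ((C `&` D) `|` (U `\` C)))).
    apply: le; [exact: mI|by apply: measurableU => //; exact: mI|].
    by move=> x [Ux Dx]; have [Ax|nAx] := pselect (C x); [left|right].
  apply: le_trans (measureU2 _ _ _) _ => //; first exact: mI.
  rewrite leeD2l//; have := mC; rewrite -{1}(setDUK CU) measureU//.
    by rewrite lteD2lE ?fin//; exact: ltW.
  by rewrite setDE setIC -setIA setICl setI0.
Qed.

Lemma measurable_seq (s : seq K) : measurable ([set` s] : set (borel K)).
Proof.
by apply: measurable_compact => //; apply: finite_compact; exact: finite_seq.
Qed.

Lemma measure_conull m (A B : set (borel K)) : measurable A -> measurable B ->
  m (~` B) = 0%E -> m A = m (A `&` B).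
Proof.
move=> mA mB nB; rewrite -{1}(setUIDK A B) measureU//; last 3 first.
- exact: measurableI.
- exact: measurableD.
- by rewrite setDE setIACA setICr setI0.
rewrite [X in (_ + X)%E](_ : _ = 0%E) ?adde0//; apply/eqP.
rewrite -measure_le0 -nB; apply: le_measure; rewrite ?inE.
- exact: measurableD.
- exact: measurableC.
- by move=> x [].
Qed.

(** The trace of a set on the finite support is compact and has the same
    measure, so the infimum and the supremum are attained. *)
Lemma radon_finsupp m (s : seq K) : (m setT < +oo)%E ->
  m (~` [set` s]) = 0%E -> radon (m : set K -> \bar R).
Proof.
move=> nT ns; have ms := measurable_seq s.
have sub (A : set K) : compact (A `&` [set` s]).
  apply: finite_compact; apply: sub_finite_set (finite_seq s); exact: subIsetr.
split.
- move=> C /measurable_compact mC; apply: le_lt_trans nT.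
  by apply: le_measure; rewrite ?inE.
- move=> A mA; apply/eqP; rewrite eq_le; apply/andP; split.
    apply: le_ereal_inf_tmp => _ [U [oU AU] <-].
    by apply: le_measure; rewrite ?inE//; exact: measurable_open.
  apply: ereal_inf_lbound; exists (~` (~` A `&` [set` s])).
    split; last by move=> x Ax [].
    by apply: closed_openC; apply: compact_closed.
  have mU : measurable (~` (~` A `&` [set` s]) : set (borel K)).
    by apply: measurableC; apply: measurableI => //; exact: measurableC.
  rewrite (measure_conull mU ms ns) (measure_conull mA ms ns).
  congr (m _); apply/seteqP; split=> x [h sx]; split => //.
    by apply: contrapT => nAx; apply: h.
  by move=> [].
- move=> U oU; have mU := measurable_open oU.
  apply/eqP; rewrite eq_le; apply/andP; split; last first.
    apply: ge_ereal_sup => _ [C [cC CU] <-]; apply: le_measure; rewrite ?inE//.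
    exact: measurable_compact.
  rewrite (measure_conull mU ms ns); apply: ereal_sup_ubound.
  by exists (U `&` [set` s]) => //; split => //; exact: subIsetl.
Qed.

Lemma toC_dirac (x : K) : toC (\d_(x : borel K) : set (borel K) -> \bar R) = diracC x.
Proof.
apply/funext => A; rewrite /diracC.
have [mA|mA] := pselect (measurable (A : set (borel K))).
  rewrite toC_mE// (diracE R (x : borel K) A); case: asboolP => [[_ Ax]|nAx].
    by rewrite mem_set.
  by rewrite memNset//= => Ax; exact: nAx.
by rewrite toC_notm//; case: asboolP => // -[].
Qed.

Lemma radon_dirac (x : K) :
  radon (\d_(x : borel K) : set K -> \bar R).
Proof.
apply: (@radon_finsupp (@dirac _ (borel K) x R) [:: x]).
  have d1 : @dirac _ (borel K) x R setT = 1%E by rewrite diracE mem_set.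
  by change (@dirac _ (borel K) x R setT < +oo)%E; rewrite d1 ltry.
have : @dirac _ (borel K) x R (~` [set` [:: x]]) = 0%E; last by [].
by rewrite diracE memNset//=; apply; rewrite inE.
Qed.

Lemma radonC_dirac (x : K) : radonC_ge0 (diracC x : set K -> R[i]).
Proof.
rewrite -toC_dirac; apply: radonC_toC; last exact: radon_dirac.
have d1 : @dirac _ (borel K) x R setT = 1%E by rewrite diracE mem_set.
by change (@dirac _ (borel K) x R setT < +oo)%E; rewrite d1 ltry.
Qed.

Lemma radonC_mrestr m (D : set (borel K)) (mD : measurable D) :
  (m setT < +oo)%E -> radon (m : set K -> \bar R) ->
  radonC_ge0 (toC (mrestr m mD)).
Proof.
move=> mT rm; apply: radonC_toC; last exact: radon_mrestr.
apply: le_lt_trans mT; change (m (setT `&` D) <= m setT)%E.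
by apply: le_measure; rewrite ?inE//; exact: measurableI.
Qed.

Lemma diracC_inj (x y : K) : (diracC x : set K -> R[i]) = diracC y -> x = y.
Proof.
move=> /(congr1 (fun f => f [set y])); rewrite /diracC.
case: asboolP => [[_ ->]//|_]; case: asboolP => [_ /eqP|[]].
  by rewrite eq_sym oner_eq0.
by split => //; exact: measurable_point.
Qed.

(** As both terms are nonnegative, nu1 vanishes on the Borel sets avoiding x.
    *)
Lemma le_dirac_scale (x : K) nu1 nu2 : radonC_ge0 nu1 -> radonC_ge0 nu2 ->
  nu1 \+ nu2 = diracC x -> nu1 = (fun A => nu1 setT * diracC x A).
Proof.
move=> r1 r2 e.
have [m [_ mT _ m1E]] := emeasure_measure r1.
have z (A : set (borel K)) : measurable A -> ~ A x -> nu1 A = 0.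
  move=> mA nAx; have := congr1 (fun f => f A) e.
  rewrite /= /diracC; case: asboolP => [[]//|_] /eqP.
  by rewrite paddr_eq0 ?r1.2 ?r2.2// => /andP[/eqP].
apply/funext => A; rewrite /diracC; case: asboolP => [[mA Ax]|h].
  rewrite mulr1 m1E !toC_mE//; congr (_%:C).
  have : nu1 (~` A) = 0 by apply: z => //; exact: measurableC.
  rewrite m1E toC_mE; last exact: measurableC.
  move=> -[] h; have mC : measurable (~` A : set (borel K)) by exact: measurableC.
  rewrite -(setUv A) measureU ?setICr// fineD; try exact: fin_le_setT.
  by rewrite h addr0.
rewrite mulr0; have [mA|mA] := pselect (measurable (A : set (borel K))).
  by apply: z => // Ax; apply: h.
by rewrite m1E toC_notm.
Qed.

(** Some point has only neighbourhoods of full measure: otherwise a compact set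
    of positive measure is covered by finitely many null sets. By inner
    regularity the complement of this point is null. *)
Lemma zero_one_dirac nu : radonC_ge0 nu -> nu setT = 1 ->
  (forall A : set (borel K), measurable A -> nu A != 0 -> nu (~` A) = 0) ->
  exists x : K, nu = diracC x.
Proof.
move=> rnu nuT h; have [m [_ mT rm mE]] := emeasure_measure rnu.
have mTE : m setT = 1%E.
  rewrite -(@fineK _ (m setT)); last exact: fin_le_setT.
  by move: nuT; rewrite mE toC_mE// => -[->].
have h' (A : set (borel K)) : measurable A -> m A != 0%E -> m (~` A) = 0%E.
  move=> mA mA0; have mCA : measurable (~` A : set (borel K)) by exact: measurableC.
  rewrite -(@fineK _ (m (~` A))); last exact: fin_le_setT.
  have : nu (~` A) = 0.
    apply: h => //; rewrite mE toC_mE//; apply: contra mA0 => /eqP[/eqP].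
    by rewrite fine_eq0// fin_le_setT.
  by rewrite mE toC_mE// => -[->].
have [x hx] : exists x, forall U : set K, open U -> U x -> m (~` U) = 0%E.
  apply: contrapT => /forallNP hN.
  have [C [cC _ mC]] : exists C : set K,
      [/\ compact C, C `<=` setT & (m setT < m C + 1%:E)%E].
    by apply: radon_inner => //; [exact: openT|rewrite mTE].
  have : (0 < m C)%E by move: mC; rewrite mTE -[ltLHS]add0e lteD2rE.
  apply/negP; rewrite -leNgt.
  have /choice[f hf] : forall x : K, exists U : set K, [/\ open U, U x & m U = 0%E].
    move=> x; have /existsNP[U /not_implyP[oU /not_implyP[Ux mU]]] := hN x.
    exists U; split => //; have mU' := measurable_open oU.
    rewrite -[U]setCK; apply: h'; [exact: measurableC|exact/eqP].
  have [s [_ Cs]] : exists s : seq K, (forall i, i \in s -> C i) /\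
      C `<=` \big[setU/set0]_(i <- s) f i.
    by apply: compact_seq_cover => // x _; have [] := hf x.
  have mf i : measurable (f i : set (borel K)).
    by have [/measurable_open] := hf i.
  apply: (@le_trans _ _ (m (\big[setU/set0]_(i <- s) f i))).
    apply: le_measure; rewrite ?inE//; first exact: measurable_compact.
    exact: bigsetU_measurable.
  elim: s {Cs} => [|i s IH]; first by rewrite big_nil measure0.
  rewrite big_cons; apply: le_trans (measureU2 _ _ _) _ => //.
    exact: bigsetU_measurable.
  by rewrite [X in (X + _)%E](_ : _ = 0%E) ?add0e//; have [] := hf i.
exists x.
have mx0 : m (~` [set x]) = 0%E.
  have oX : open (~` [set x] : set K).
    by apply: closed_openC; apply: compact_closed => //; exact: compact_set1.
  have [_ _ r3] := rm; rewrite r3//; apply/eqP; rewrite eq_le; apply/andP; split.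
    apply: ge_ereal_sup => _ [C [cC CU] <-].
    rewrite -[C]setCK hx//; last by move=> /CU; exact.
    by apply: closed_openC; exact: compact_closed.
  by apply: ereal_sup_ubound; exists set0; [split => //; exact: compact0|exact: measure0].
have z (A : set (borel K)) : measurable A -> ~ A x -> m A = 0%E.
  move=> mA nAx; apply/eqP; rewrite -measure_le0 -mx0.
  apply: le_measure; rewrite ?inE//.
    by apply: measurableC; exact: measurable_point.
  by move=> y Ay /= yx; apply: nAx; rewrite -yx.
rewrite -toC_dirac mE; apply/funext => A.
have [mA|mA] := pselect (measurable (A : set (borel K))); last by rewrite !toC_notm.
rewrite !toC_mE// (diracE R (x : borel K) A); have [Ax|nAx] := pselect (A x).
  have mC : measurable (~` A : set (borel K)) by exact: measurableC.
  have zC : m (~` A) = 0%E by apply: z => //; exact.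
  have e1 : m (A `|` ~` A) = m setT by congr (m _); exact: setUv.
  have e2 : m (A `|` ~` A) = (m A + m (~` A))%E.
    by apply: measureU => //; exact: setICr.
  by rewrite mem_set//; move: e2; rewrite e1 zC adde0 mTE => <-.
by rewrite memNset//= z.
Qed.

End FiniteRadon.

(** * Lower integrals and the uniqueness of Radon measures *)

Section Integral.
Variables (R : realType) (K : ptopologicalType).

Lemma measurable_continuous (k : K -> R) : continuous k ->
  measurable_fun [set: borel K] (k : borel K -> R).
Proof.
move=> /continuousP ck; apply: (measurability _ (RGenOInfty.measurableE R)).
move=> _ [_ [a ->] <-]; rewrite setTI.
by apply: measurable_open; apply: ck; exact: interval_open.
Qed.

Variable m : {measure set (borel K) -> \bar R}.

(** The integral of a nonnegative function is a supremum over the simple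
    functions below it, hence it is monotone even on functions which are not
    measurable. This matters for y |-> F(x * y), whose measurability is not
    known in advance. *)
Lemma le_lower_integral (f g : borel K -> \bar R) : (forall x, 0 <= f x)%E ->
  (forall x, f x <= g x)%E -> (\int[m]_x f x <= \int[m]_x g x)%E.
Proof.
move=> f0 fg; rewrite !ge0_integralTE//; last by move=> x; exact: le_trans (fg x).
apply: ereal_sup_le => _ [h hf <-]; exists h => // x.
exact: le_trans (hf x) (fg x).
Qed.

Lemma lower_integral_indic (A : set (borel K)) (c : \bar R) (f : borel K -> \bar R) :
  measurable A -> (0 <= c)%E -> (forall x, 0 <= f x)%E ->
  (forall x, A x -> c <= f x)%E -> (c * m A <= \int[m]_x f x)%E.
Proof.
move=> mA c0 f0 cf; rewrite -integral_cst//= integral_mkcond.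
apply: le_lower_integral => x; rewrite patchE; case: ifPn => //.
by rewrite inE => /cf.
Qed.

Lemma le_integral_indic (A : set (borel K)) (f : borel K -> \bar R) :
  measurable A -> measurable_fun setT f -> (forall x, 0 <= f x)%E ->
  (forall x, f x <= 1)%E -> (forall x, ~ A x -> f x = 0)%E ->
  (\int[m]_x f x <= m A)%E.
Proof.
move=> mA mf f0 f1 fA.
rewrite -[leRHS]mul1e -integral_cst//= [leRHS]integral_mkcond.
apply: le_lower_integral => x //; rewrite patchE; case: ifPn => //.
by rewrite notin_setE => /fA ->.
Qed.

End Integral.

(** Regularity and cut-off functions squeeze the measure of an open set between
    integrals of functions of C_c. *)
Lemma radon_eq_of_integral (R : realType) (K : ptopologicalType)
    (hK : hausdorff_space K) (lK : locally_compact [set: K])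
    (m1 m2 : {measure set (borel K) -> \bar R}) :
  (m1 setT < +oo)%E -> (m2 setT < +oo)%E ->
  radon (m1 : set K -> \bar R) -> radon (m2 : set K -> \bar R) ->
  (forall k : K -> R, Cc_ge0 k -> (forall x, (k x <= 1)%R) ->
    \int[m1]_x (k x)%:E = \int[m2]_x (k x)%:E)%E ->
  forall A : set (borel K), measurable A -> m1 A = m2 A.
Proof.
move=> T1 T2 r1 r2 e.
have eU : forall U : set K, open U -> m1 U = m2 U.
  have w (n1 n2 : {measure set (borel K) -> \bar R}) : 
      (n1 setT < +oo)%E -> radon (n1 : set K -> \bar R) ->
      (forall k : K -> R, Cc_ge0 k -> (forall x, (k x <= 1)%R) ->
        \int[n1]_x (k x)%:E = \int[n2]_x (k x)%:E)%E ->
      forall U : set K, open U -> (n1 U <= n2 U)%E.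
    move=> nT rn en U oU; have mU := measurable_open oU.
    apply/lee_addgt0Pr => ep ep0.
    have [C [cC CU /ltW nC]] := radon_inner rn oU (fin_le_setT nT mU) ep0.
    apply: le_trans nC _; rewrite leeD2r//.
    have [k [kc k1 kC kU]] := Urysohn_Cc R hK lK cC oU CU; have [ck _ k0] := kc.
    apply: (@le_trans _ _ (\int[n1]_x (k x)%:E)%E).
      rewrite -[leLHS]mul1e; apply: lower_integral_indic => //.
      - exact: measurable_compact.
      - by move=> x Cx; rewrite lee_fin kC.
    rewrite en//; apply: le_integral_indic => //.
    - by apply/measurable_EFinP; exact: measurable_continuous.
    - by move=> x nUx; rewrite kU.
  by move=> U oU; apply/eqP; rewrite eq_le !w// => k ? ?; rewrite e.
move=> A mA; have [_ -> // _] := r1; have [_ -> // _] := r2.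
by congr ereal_inf; apply: eq_imagel => U [oU _]; rewrite eU.
Qed.

(** * Measures of finite support and the cone topology *)

Section FiniteSupport.
Variables (R : realType) (K : ptopologicalType).
Hypothesis hK : hausdorff_space K.
Implicit Types (nu : set K -> R[i]) (m n : {measure set (borel K) -> \bar R}).

(** A measure of finite support is a combination of Dirac measures; the points
    are split off one at a time so that only Radon measures occur. *)
Lemma fixed_finsupp (Phi : (set K -> R[i]) -> set K -> R[i]) :
  (forall nu1 nu2, radonC_ge0 nu1 -> radonC_ge0 nu2 ->
    Phi (nu1 \+ nu2) = Phi nu1 \+ Phi nu2) ->
  (forall (c : R[i]) x, Phi (fun A => c * diracC x A) = (fun A => c * diracC x A)) ->
  forall (s : seq K) n, (n setT < +oo)%E -> n (~` [set` s]) = 0%E ->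
  Phi (toC n) = toC n.
Proof.
move=> PhiD PhiZ; elim=> [|x s IH] n nT ns.
  have z : toC n = (fun A => 0 * (diracC point A : R[i]))%R.
    apply/funext => A; rewrite mul0r.
    have [mA|mA] := pselect (measurable (A : set (borel K))).
      rewrite toC_mE// (_ : n A = 0%E)//; apply/eqP; rewrite -measure_le0 -ns.
      by apply: le_measure; rewrite ?inE//; rewrite set_nil setC0.
    by rewrite toC_notm.
  by rewrite z PhiZ.
have mx : measurable ([set x] : set (borel K)) by exact: measurable_point.
have mCx : measurable (~` [set x] : set (borel K)) by exact: measurableC.
have fin (A B : set (borel K)) : measurable A -> measurable B ->
    (n (A `&` B) < +oo)%E.
  move=> mA mB; apply: le_lt_trans nT; apply: le_measure; rewrite ?inE//.
  exact: measurableI.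
pose n' := mrestr n mCx.
have n'T : (n' setT < +oo)%E by exact: fin.
have n's : n' (~` [set` s]) = 0%E.
  rewrite -ns; congr (n _); apply/seteqP; split => y /=.
    by move=> [h1 h2]; rewrite inE => /orP[/eqP|].
  by rewrite inE => /negP; rewrite negb_or => /andP[/eqP h1 /negP h2].
have n1 : toC (mrestr n mx) = (fun A => (fine (n [set x]))%:C * diracC x A).
  apply/funext => A; rewrite /diracC.
  have [mA|mA] := pselect (measurable (A : set (borel K))).
    rewrite toC_mE//; case: asboolP => [[_ Ax]|nAx].
      rewrite mulr1; congr ((fine (n _))%:C); apply/seteqP.
      by split=> [y []//|y ->].
    rewrite mulr0 (_ : mrestr n mx A = 0%E)// -(measure0 n); congr (n _).
    by apply/seteqP; split=> // y [Ay yx]; apply: nAx; split=> //; rewrite -yx.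
  by rewrite toC_notm//; case: asboolP => [[]//|]; rewrite mulr0.
have r1 : radonC_ge0 (toC (mrestr n mx)).
  apply: radonC_toC => //; first exact: fin.
  apply: (@radon_finsupp _ _ hK _ [:: x]); first exact: fin.
  rewrite /= -(measure0 n); congr (n _).
  by apply/seteqP; split=> // y [/= + yx]; rewrite yx inE eqxx.
have r2 : radonC_ge0 (toC n').
  by apply: radonC_toC => //; exact: (@radon_finsupp _ _ hK _ s).
have nE : toC n = toC (mrestr n mx) \+ toC n'.
  apply/funext => A; have [mA|mA] := pselect (measurable (A : set (borel K))).
    rewrite /= !toC_mE// -rmorphD; congr (_%:C).
    have fin' (B : set (borel K)) : measurable B -> n (A `&` B) \is a fin_num.
      by move=> mB; rewrite ge0_fin_numE//; exact: fin.
    rewrite -fineD; [|exact: fin'|exact: fin'].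
    congr fine; rewrite /n' /mrestr -measureU//; try exact: measurableI.
      by rewrite -setIUr setUv setIT.
    by rewrite setIACA setICr setI0.
  by rewrite /= !toC_notm// addr0.
rewrite [in LHS]nE PhiD// (IH n')// [in LHS]n1 PhiZ [in RHS]nE.
by rewrite [in RHS]n1.
Qed.

Lemma Cc_ge0_bounded (f : K -> R) : Cc_ge0 f -> exists M : nat, forall x, f x < M%:R.
Proof.
move=> [cf cs f0].
have [M [_ hM]] : bounded_set (f @` closure [set x | f x != 0]).
  apply: compact_bounded; apply: continuous_compact => //.
  exact: continuous_subspaceT.
have h := hM (`|M| + 1); exists (Num.truncn (`|M| + 1)).+1 => x.
apply: le_lt_trans (truncnS_gt _); have [->|fx] := eqVneq (f x) 0.
  by rewrite addr_ge0.
apply: le_trans (ler_norm _) _; apply: h.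
  by rewrite (le_lt_trans (ler_norm _))// ltrDl.
by exists x => //; exact: subset_closure.
Qed.

(** The labels g record, for each f in the list, the integer part of f / e;
    there are finitely many of them as the functions are bounded. *)
Lemma finite_oscillation (l : seq (K -> R)) (e : R) : 0 < e ->
  (forall f, f \in l -> Cc_ge0 f) ->
  exists (T : finType) (g : K -> T),
    (forall j, measurable ([set x | g x = j] : set (borel K))) /\
    forall f, f \in l -> forall x y, g x = g y -> f x <= f y + e.
Proof.
move=> e0; elim: l => [|f l IH] hl.
  exists unit, (fun=> tt); split => // -[].
  by rewrite (_ : [set x | _] = setT)//; apply/seteqP; split.
have [|T [g [mg hg]]] := IH; first by move=> f' f'l; apply: hl; rewrite inE f'l orbT.
have fc := hl f (mem_head _ _); have [cf _ f0] := fc.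
have [M hM] := Cc_ge0_bounded fc.
pose q x := Num.truncn (f x / e).
have q0 x : 0 <= f x / e by rewrite divr_ge0// ltW.
have qM x : (q x < (Num.truncn (M%:R / e)).+1)%N.
  by rewrite ltnS; apply: le_truncn; rewrite ler_pM2r ?invr_gt0// ltW.
exists (T * 'I_(Num.truncn (M%:R / e)).+1)%type, (fun x => (g x, inord (q x))).
split=> [[j1 j2]|].
  rewrite (_ : [set x | _] = [set x | g x = j1] `&`
      (~` [set x | f x < j2%:R * e] `&` [set x | f x < j2.+1%:R * e])); last first.
    apply/seteqP; split=> x /=.
      move=> [<- <-]; split => //; rewrite inordK//.
      have /andP[] := truncn_itv (q0 x).
      rewrite ler_pdivlMr// ltr_pdivrMr// => h1 h2; split => //.
      by rewrite ltNge h1.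
    move=> [-> [/negP h1 h2]]; congr (_, _); apply/val_inj; rewrite /= inordK//.
    apply: truncn_def; rewrite ler_pdivlMr// ltr_pdivrMr// h2 andbT.
    by rewrite leNgt.
  have ol (c : R) : open [set x | f x < c].
    have := (continuousP f).1 cf [set t | t < c]; apply; exact: open_lt.
  apply: measurableI; first exact: mg.
  by apply: measurableI; [apply: measurableC|]; apply: measurable_open.
move=> f'; rewrite inE => /orP[/eqP->|f'l] x y [gxy]; last by move=> _; exact: hg.
move=> /(congr1 val); rewrite /= !inordK// => qxy.
have /andP[_ h1] := truncn_itv (q0 x); have /andP[h2 _] := truncn_itv (q0 y).
rewrite ltr_pdivrMr// -/(q x) qxy in h1; rewrite ler_pdivlMr// -/(q y) in h2.
by rewrite -natr1 mulrDl mul1r in h1; apply: le_trans (ltW h1) _; rewrite lerD2r.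
Qed.

End FiniteSupport.

(** Stated for an index type without topology, as that of the cone topology. *)
Lemma ptws_cvg (I : Type) (V : topologicalType) (F : set_system {ptws I -> V})
    (f : {ptws I -> V}) : Filter F ->
  (forall t, (fun g : I -> V => g t) @ F --> f t) -> F --> f.
Proof.
move=> FF h; apply/cvg_sup => t S.
move=> [B [[W oW <-] Wf WS]].
have : F ((fun g => g t) @^-1` W) by apply: h; exact: open_nbhs_nbhs.
exact: filterS.
Qed.

Lemma ptws_eval_continuous (I : Type) (V : topologicalType) (f : {ptws I -> V})
    (t : I) (S : set V) : nbhs (f t) S -> nbhs f ((fun g => g t) @^-1` S).
Proof.
move=> fS.
have cf : (nbhs f : set_system {ptws I -> V}) --> f by [].
have FF : Filter (nbhs f) by exact: nbhs_filter.
apply: ((@cvg_sup _ _ _ _ _ FF).1 cf t).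
exact: (@initial_continuous {ptws I -> V} V (fun g => g t) f).
Qed.

Section Density.
Variables (R : realType) (K : ptopologicalType).
Hypotheses (hK : hausdorff_space K) (lK : locally_compact [set: K]).
Implicit Types (nu : set K -> R[i]) (m n : {measure set (borel K) -> \bar R}).

Lemma integral_Cc_fin m (f : K -> R) : (m setT < +oo)%E -> Cc_ge0 f ->
  (\int[m]_x (f x)%:E \is a fin_num)%E.
Proof.
move=> mT fc; have [M hM] := Cc_ge0_bounded fc; have [cf _ f0] := fc.
have fT : m setT \is a fin_num by rewrite ge0_fin_numE.
rewrite ge0_fin_numE; last by apply: integral_ge0 => x _; rewrite lee_fin.
apply: (@le_lt_trans _ _ (\int[m]_x (cst (M%:R)%:E x))%E).
  apply: le_lower_integral => x; rewrite lee_fin//; exact: ltW.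
rewrite integral_cst//= -(fineK fT) -EFinM; exact: ltry.
Qed.

(** The approximation is the image of m under a map tau which sends each cell
    of a partition of small oscillation to one of its points: integrals against
    the image are integrals of f \o tau, which is close to f. *)
Lemma finsupp_approx m (l : seq (K -> R)) (e : R) :
  (m setT < +oo)%E -> (forall f, f \in l -> Cc_ge0 f) -> 0 < e ->
  exists n (s : seq K), [/\ n (~` [set` s]) = 0%E, n setT = m setT &
    forall f, f \in l -> `|fine (\int[n]_x (f x)%:E) - fine (\int[m]_x (f x)%:E)| < e].
Proof.
move=> mT hl e0; have fT : m setT \is a fin_num by rewrite ge0_fin_numE.
pose M := fine (m setT); have M0 : 0 <= M by rewrite fine_ge0.
pose d := e / (M + 1); have d0 : 0 < d by rewrite divr_gt0// ltr_wpDl.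
have [T [g [mg hg]]] := finite_oscillation d0 hl.
pose r (j : T) : K := xget point [set x | g x = j].
pose tau x := r (g x).
have gtau x : g (tau x) = g x.
  by rewrite /tau /r; apply: (@xgetPex _ _ [set y | g y = g x]); exists x.
have mtau : measurable_fun [set: borel K] (tau : borel K -> borel K).
  move=> _ B mB; rewrite setTI.
  rewrite (_ : _ @^-1` _ = \big[setU/set0]_(j <- enum T | `[< B (r j) >]) [set x | g x = j]).
    by apply: bigsetU_measurable => j _; exact: mg.
  apply/seteqP; split=> x /=.
    by move=> Bx; rewrite -bigcup_seq_cond; exists (g x) => //=; rewrite mem_enum; apply/asboolP.
  by rewrite -bigcup_seq_cond => -[j /= /andP[_ /asboolP Bj] gx]; rewrite /tau gx.
pose tauM := isMeasurableFun.Build _ _ (borel K) (borel K) tau mtau.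
pose tau' : {mfun (borel K) >-> (borel K)} := HB.pack (tau : borel K -> borel K) tauM.
pose n0 : {measure set (borel K) -> \bar R} := pushforward m tau'.
pose n' := n0 mtau.
exists n', [seq r j | j <- enum T]; split.
- rewrite /n' /= /pushforward (_ : _ @^-1` _ = set0) ?measure0//.
  apply/seteqP; split=> // x /=; apply; apply/mapP; exists (g x) => //.
  by rewrite mem_enum.
- by rewrite /n' /= /pushforward preimage_setT.
move=> f fl; have fc := hl _ fl; have [cf _ f0] := fc.
have mf : measurable_fun [set: borel K] (fun x : borel K => (f x)%:E).
  by apply/measurable_EFinP; exact: measurable_continuous.
have nE : (\int[n']_x (f x)%:E = \int[m]_x (f (tau x))%:E)%E.
  rewrite ge0_integral_pushforward//.
  by move=> x _; rewrite lee_fin.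
have n'T : (n' setT < +oo)%E by rewrite /n' /= /pushforward preimage_setT.
have mft : measurable_fun [set: borel K] (fun x : borel K => (f (tau x))%:E).
  exact: (measurableT_comp mf mtau).
have key (a b : borel K -> R) : (forall x, 0 <= a x) -> (forall x, 0 <= b x) ->
    measurable_fun setT (fun x => (b x)%:E) ->
    (forall x, a x <= b x + d) ->
    (\int[m]_x (a x)%:E <= \int[m]_x (b x)%:E + (d * M)%:E)%E.
  move=> a0 b0 mb ab.
  apply: (@le_trans _ _ (\int[m]_x ((b x)%:E + cst d%:E x))%E).
    by apply: le_lower_integral => x; rewrite ?lee_fin//=; rewrite -EFinD lee_fin.
  rewrite ge0_integralD//; last 2 first.
    by move=> x _; rewrite lee_fin.
    by move=> x _; rewrite lee_fin ltW.
  by rewrite integral_cst// [(d * M)%:E]EFinM (fineK fT).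
have k1 := key _ _ (fun x => f0 (tau x)) f0 mf (fun x => hg _ fl _ _ (gtau x)).
have k2 := key _ _ f0 (fun x => f0 (tau x)) mft (fun x => hg _ fl _ _ (esym (gtau x))).
have F1 := integral_Cc_fin mT fc.
have F2 := integral_Cc_fin n'T fc.
rewrite -nE in k1 k2.
move: k1 k2; rewrite -(fineK F1) -(fineK F2) -!EFinD !lee_fin => k1 k2.
have dM : d * M < e.
  rewrite /d mulrAC ltr_pdivrMr ?ltr_wpDl// ltr_pM2l//.
  by rewrite ltrDl.
rewrite /= ltr_norml; apply/andP; split; lra.
Qed.

Lemma emeasure_toC m (A : set (borel K)) : (m setT < +oo)%E -> measurable A ->
  emeasure (toC m) A = m A.
Proof. by move=> mT mA; rewrite /emeasure toC_mE//= fineK// fin_le_setT. Qed.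

Lemma integral_emeasure_toC m (f : borel K -> \bar R) :
  (m setT < +oo)%E -> radon (m : set K -> \bar R) ->
  (\int[emeasure (toC m)]_x f x = \int[m]_x f x)%E.
Proof.
move=> mT rm; have [m' [e _ _ _]] := emeasure_measure hK (radonC_toC hK mT rm).
rewrite -e; apply: eq_measure_integral => A mA _.
by rewrite [LHS](congr1 (fun h => h A) e) emeasure_toC.
Qed.

Lemma radon_finsupp_toC n (s : seq K) : (n setT < +oo)%E ->
  n (~` [set` s]) = 0%E -> radonC_ge0 (toC n).
Proof. by move=> nT ns; apply: radonC_toC => //; exact: (@radon_finsupp _ _ hK n s). Qed.

(** Measures of finite support are dense in M^+(K) for the cone topology, so a
    continuous operator which fixes them is the identity. The filter F below
    consists of the sets containing all measures of finite support with the
    mass of nu and with integrals close to those of nu for finitely many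
    functions; it converges to nu. *)
Lemma cone_fixed (Phi : (set K -> R[i]) -> set K -> R[i]) nu :
  (forall nu, radonC_ge0 nu -> radonC_ge0 (Phi nu)) ->
  (forall nu1 nu2, radonC_ge0 nu1 -> radonC_ge0 nu2 ->
    Phi (nu1 \+ nu2) = Phi nu1 \+ Phi nu2) ->
  (forall (c : R[i]) x, Phi (fun A => c * diracC x A) = (fun A => c * diracC x A)) ->
  radonC_ge0 nu ->
  (Phi x : cone_space R K) @[x --> within radonC_ge0 (nbhs (nu : cone_space R K))]
    --> (Phi nu : cone_space R K) ->
  Phi nu = nu.
Proof.
move=> Phi0 PhiD PhiZ rnu cPhi.
have [m [_ mT rm nuE]] := emeasure_measure hK rnu.
pose close (l : seq (K -> R)) (e : R) n := forall f : K -> R, f \in l ->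
  `|fine (\int[n]_x (f x)%:E) - fine (\int[m]_x (f x)%:E)| < e.
pose F : set_system (cone_space R K) := [set S | exists (l : seq (K -> R)) (e : R),
  [/\ 0 < e, forall f, f \in l -> Cc_ge0 f & forall n (s : seq K),
     n (~` [set` s]) = 0%E -> n setT = m setT -> close l e n -> S (toC n)]].
have FF : ProperFilter F.
  split.
    move=> [l [e [e0 hl h]]].
    by have [n [s [ns nT nc]]] := finsupp_approx mT hl e0; exact: (h n s).
  split.
  - by exists [::], 1; split.
  - move=> P Q [l1 [e1 [e10 hl1 h1]]] [l2 [e2 [e20 hl2 h2]]].
    exists (l1 ++ l2), (Num.min e1 e2); split.
    + by rewrite lt_min e10.
    + by move=> f; rewrite mem_cat => /orP[/hl1|/hl2].
    + move=> n s ns nT h; split.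
        apply: (h1 n s) => // f fl.
        by apply: lt_le_trans (h f _) _; rewrite ?mem_cat ?fl// ge_min lexx.
      apply: (h2 n s) => // f fl.
      by apply: lt_le_trans (h f _) _; rewrite ?mem_cat ?fl ?orbT// ge_min lexx orbT.
  - move=> P Q PQ [l [e [e0 hl h]]]; exists l, e; split => // n s ns nT nc.
    exact/PQ/(h n s).
have Fint (f : K -> R) : Cc_ge0 f ->
    fine (\int[emeasure x]_y (f y)%:E)%E @[x --> F] --> fine (\int[m]_y (f y)%:E)%E.
  move=> fc; apply/(@cvgrPdist_lt _ R) => e e0.
  exists [:: f], e; split=> // [g|n s ns nT nc /=]; first by rewrite inE => /eqP->.
  have nT' : (n setT < +oo)%E by rewrite nT.
  rewrite integral_emeasure_toC//; last exact: (@radon_finsupp _ _ hK n s).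
  by rewrite distrC; apply: nc; rewrite inE.
have Fcone : F --> (nu : cone_space R K).
  have Fev : cone_eval x @[x --> F] --> cone_eval nu.
    apply: ptws_cvg => -[[f fc]|].
      have := Fint f fc; rewrite /cone_eval /= nuE integral_emeasure_toC//.
    apply/(@cvgrPdist_lt _ R) => e e0.
    exists [::], 1; split => // n s ns nT _ /=.
    by rewrite nuE !toC_mE//= nT subrr normr0.
  move=> S; rewrite nbhsE => -[_ [[W oW <-] /= Wnu] WS].
  have FW : F (cone_eval @^-1` W) by exact: (Fev W (open_nbhs_nbhs (conj oW Wnu))).
  exact: (@filterS _ F _ _ _ WS FW).
have Fcc : F --> within radonC_ge0 (nbhs (nu : cone_space R K)).
  move=> S /Fcone h; have : F [set x | radonC_ge0 x -> S x] by [].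
  move=> hS; have hr : F radonC_ge0.
    exists [::], 1; split => // n s ns nT _; apply: (@radon_finsupp_toC n s) => //.
    by rewrite nT.
  by apply: filterS2 hr hS => x rx /(_ rx).
have FPhi : F --> (Phi nu : cone_space R K).
  move=> S /cPhi/Fcc [l [e [e0 hl h]]]; exists l, e; split=> // n s ns nT nc.
  have := h n s ns nT nc; rewrite /= (@fixed_finsupp _ _ hK _ PhiD PhiZ s)//.
  by rewrite nT.
have rP := Phi0 _ rnu; have [m' [_ mT' rm' PhiE]] := emeasure_measure hK rP.
rewrite PhiE nuE; apply/funext => A.
have [mA|mA] := pselect (measurable (A : set (borel K))); last by rewrite !toC_notm.
rewrite !toC_mE//; congr ((fine _)%:C).
apply: (radon_eq_of_integral hK lK mT' mT rm' rm) => // k kc _.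
rewrite -(fineK (integral_Cc_fin mT kc)) -(fineK (integral_Cc_fin mT' kc)).
congr EFin.
have h1 := Fint k kc.
have h2 : fine (\int[emeasure x]_y (k y)%:E)%E @[x --> F] --> fine (\int[m']_y (k y)%:E)%E.
  have cev : (cone_eval x) @[x --> F] --> (cone_eval (Phi nu)).
    move=> S hS.
    exact: (FPhi _ (@initial_continuous _ _ (@cone_eval R K) (Phi nu) S hS)).
  have : (cone_eval x) (Some (exist _ k kc)) @[x --> F] -->
      (cone_eval (Phi nu)) (Some (exist _ k kc)).
    move=> S hS; apply: (cev ((fun g => g (Some (exist _ k kc))) @^-1` S)).
    exact: (@ptws_eval_continuous _ R (cone_eval (Phi nu))).
  by rewrite /cone_eval /= PhiE integral_emeasure_toC.
exact: (cvg_unique _ h2 h1).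
Qed.

End Density.

(** * Group-like points, and why K is a group *)

Lemma michael_open (K : topologicalType) (U V : set K) : open U -> open V ->
  open ([set S | S `&` U !=set0 /\ S `<=` V] : set (michael_space K)).
Proof.
move=> oU oV; exists [set [set S | S `&` U !=set0 /\ S `<=` V]].
  by move=> _ ->; exact: (@finI_from1 _ _ _
    (fun W : set K * set K => [set S | S `&` W.1 !=set0 /\ S `<=` W.2]) (U, V)).
by rewrite bigcup_set1.
Qed.

(** Split nu = n1 + n2 along a Borel set A. Then L' n1 + L' n2 is a Dirac
    measure, so L' n1 is a multiple of it, and applying the inverse L of L'
    shows that n1 is a multiple of nu. Hence nu takes the values 0 and 1 only.
    *)
Lemma dirac_of_invertible (R : realType) (K : ptopologicalType)
    (hK : hausdorff_space K) (nu : set K -> R[i]) (y : K)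
    (L L' : (set K -> R[i]) -> set K -> R[i]) :
  radonC_ge0 nu -> nu setT = 1 ->
  (forall rho, radonC_ge0 rho -> radonC_ge0 (L' rho)) ->
  (forall rho1 rho2, radonC_ge0 rho1 -> radonC_ge0 rho2 ->
     L' (rho1 \+ rho2) = L' rho1 \+ L' rho2) ->
  L' nu = diracC y ->
  (forall rho, radonC_ge0 rho -> L (L' rho) = rho) ->
  (forall c : R[i], L (fun A => c * diracC y A) = (fun A => c * nu A)) ->
  exists p, nu = diracC p.
Proof.
move=> rnu nuT L'0 L'D L'nu LK LZ.
apply: zero_one_dirac => // A mA nuA0.
have [m [_ mT rm nuE]] := emeasure_measure hK rnu.
have mCA : measurable (~` A : set (borel K)) by exact: measurableC.
pose n1 := toC (mrestr m mA); pose n2 := toC (mrestr m mCA).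
have r1 : radonC_ge0 n1 by exact: radonC_mrestr.
have r2 : radonC_ge0 n2 by exact: radonC_mrestr.
have nuD : n1 \+ n2 = nu.
  rewrite nuE; apply/funext => B.
  have [mB|mB] := pselect (measurable (B : set (borel K))); last first.
    by rewrite /= /n1 /n2 !toC_notm// addr0.
  have mI C : measurable (C : set (borel K)) -> measurable (B `&` C : set (borel K)).
    by move=> mC; exact: measurableI.
  rewrite /= /n1 /n2 !toC_mE// -rmorphD; congr (_%:C).
  rewrite -fineD; [|exact: fin_le_setT mT (mI _ mA)|exact: fin_le_setT mT (mI _ mCA)].
  congr fine; rewrite /mrestr -measureU//; try exact: mI.
    by rewrite -setIUr setUv setIT.
  by rewrite setIACA setICr setI0.
have e1 : L' n1 = (fun B => L' n1 setT * diracC y B).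
  by apply: (le_dirac_scale hK (L'0 _ r1) (L'0 _ r2)); rewrite -L'D// nuD.
have n1E : n1 = (fun B => L' n1 setT * nu B) by rewrite -LZ -e1 LK.
set c := L' n1 setT in n1E.
have n1A : n1 A = nu A.
  by rewrite nuE /n1 !toC_mE// /mrestr setIid.
have n1C : n1 (~` A) = 0.
  by rewrite /n1 toC_mE//= /mrestr setICl measure0.
have c0 : c != 0.
  by apply: contra nuA0 => /eqP c0; rewrite -n1A n1E c0 mul0r.
have := congr1 (fun f => f (~` A)) n1E; rewrite n1C => e2.
by apply: (mulfI c0); rewrite mulr0 e2.
Qed.

Section Grouplike.
Variables (R : realType) (K : ptopologicalType) (H : hypergroup R K).
Local Notation hK := (hg_hausdorff H).
Local Notation lK := (hg_locally_compact H).
Local Notation conv := (hg_conv H).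
Local Notation e := (hg_id H).
Local Notation inv := (hg_inv H).
Implicit Types (nu rho : set K -> R[i]) (x y a : K).

Let rd x : radonC_ge0 (diracC x : set K -> R[i]) := radonC_dirac R hK x.

(** The axioms only make the Dirac measure at e a unit for the convolution with
    Dirac measures; continuity in the cone topology extends this to M^+(K). *)
Lemma conv_idl nu : radonC_ge0 nu -> conv (diracC e) nu = nu.
Proof.
move=> rnu; apply: (cone_fixed hK lK) => //.
- by move=> rho rr; exact: hg_conv_ge0.
- move=> n1 n2 r1 r2; apply: (convDr (hg_banach H)); [exact: (rd e).1|exact: r1.1|exact: r2.1].
- move=> c x; rewrite (convZr (hg_banach H)) ?hg_idl//; [exact: (rd e).1|exact: (rd x).1].
have /subspace_continuousP/(_ (diracC e, nu)) := @hg_conv_continuous _ _ H.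
move=> /(_ (conj (rd e) rnu)) h S /h [[P Q] /= [hP hQ] PQ].
apply: (filterS _ hQ) => rho Qr rr.
apply: (PQ (diracC e, rho)); last by split; [exact: rd|].
by split => //; exact: (nbhs_singleton hP).
Qed.

Lemma conv_idr nu : radonC_ge0 nu -> conv nu (diracC e) = nu.
Proof.
move=> rnu; apply: (cone_fixed (Phi := fun n => conv n (diracC e)) hK lK) => //.
- by move=> rho rr; exact: hg_conv_ge0.
- move=> n1 n2 r1 r2; apply: (convDl (hg_banach H)); [exact: r1.1|exact: r2.1|exact: (rd e).1].
- move=> c x; rewrite (convZl (hg_banach H)) ?hg_idr//; [exact: (rd x).1|exact: (rd e).1].
have /subspace_continuousP/(_ (nu, diracC e)) := @hg_conv_continuous _ _ H.
move=> /(_ (conj rnu (rd e))) h S /h [[P Q] /= [hP hQ] PQ].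
apply: (filterS _ hP) => rho Pr rr.
apply: (PQ (rho, diracC e)); last by split; [|exact: rd].
by split => //; exact: (nbhs_singleton hQ).
Qed.

Definition grouplike a :=
  hconv_dirac H a (inv a) = diracC e /\ hconv_dirac H (inv a) a = diracC e.

Lemma convA n1 n2 n3 : radonC_ge0 n1 -> radonC_ge0 n2 -> radonC_ge0 n3 ->
  conv n1 (conv n2 n3) = conv (conv n1 n2) n3.
Proof. by move=> [? _] [? _] [? _]; exact: (convM_assoc (hg_banach H)). Qed.

(** Convolution by the Dirac measure at a has the inverse given by a^-, so
    [dirac_of_invertible] applies. *)
Lemma grouplike_conv a y : grouplike a -> exists p, hconv_dirac H a y = diracC p.
Proof.
move=> [aV Va]; apply: (@dirac_of_invertible _ _ hK _ y
  (conv (diracC a)) (conv (diracC (inv a)))).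
- exact: hg_conv_ge0.
- exact: hg_proba.
- by move=> rho rr; exact: hg_conv_ge0.
- by move=> n1 n2 [r1 _] [r2 _]; apply: (convDr (hg_banach H)) => //; exact: (rd _).1.
- by rewrite convA// -/(hconv_dirac H (inv a) a) Va conv_idl.
- by move=> rho rr; rewrite convA// -/(hconv_dirac H a (inv a)) aV conv_idl.
- by move=> c; rewrite (convZr (hg_banach H))//; exact: (rd _).1.
Qed.

Lemma conv_grouplike a y : grouplike a -> exists p, hconv_dirac H y a = diracC p.
Proof.
move=> [aV Va]; apply: (@dirac_of_invertible _ _ hK _ y
  (fun n => conv n (diracC a)) (fun n => conv n (diracC (inv a)))).
- exact: hg_conv_ge0.
- exact: hg_proba.
- by move=> rho rr; exact: hg_conv_ge0.
- by move=> n1 n2 [r1 _] [r2 _]; apply: (convDl (hg_banach H)) => //; exact: (rd _).1.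
- by rewrite -convA// -/(hconv_dirac H a (inv a)) aV conv_idr.
- by move=> rho rr; rewrite -convA// -/(hconv_dirac H (inv a) a) Va conv_idr.
- by move=> c; rewrite (convZl (hg_banach H))//; exact: (rd _).1.
Qed.

Lemma inv_id : inv e = e.
Proof.
apply/esym/(@hg_supp_id _ _ H); rewrite hg_idl => U oU Ue; rewrite /diracC.
by case: asboolP => [_|[]]; [rewrite oner_neq0|split => //; exact: measurable_open].
Qed.

Lemma grouplike_inv a : grouplike a -> grouplike (inv a).
Proof. by move=> [aV Va]; split; rewrite hg_invK. Qed.

Lemma grouplike_mul a b p : grouplike a -> grouplike b ->
  hconv_dirac H a b = diracC p -> grouplike p.
Proof.
move=> [aV Va] [bV Vb] abp.
have pV : hconv_dirac H (inv b) (inv a) = diracC (inv p).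
  rewrite /hconv_dirac -hg_conv_inv; apply/funext => A; rewrite -/(hconv_dirac H a b) abp /diracC.
  have mimg (B : set K) : measurable (B : set (borel K)) -> measurable (inv @` B : set (borel K)).
    move=> mB; have -> : inv @` B = inv @^-1` B.
      apply/seteqP; split=> [x [y By <-]|x Bx]; first by rewrite /preimage/= hg_invK.
      by exists (inv x) => //; rewrite hg_invK.
    have : measurable_fun [set: borel K] (inv : borel K -> borel K).
      apply: (measurability _ (erefl (@measurable _ (borel K)))).
      move=> _ [U oU <-]; rewrite setTI; apply: measurable_open.
      exact: ((continuousP _).1 (@hg_inv_continuous _ _ H)).
    by move=> /(_ measurableT _ mB); rewrite setTI.
  congr (_%:R); congr (nat_of_bool _); apply/asbool_equiv_eq; split.
    move=> [mA [y Ay yp]]; split; last by rewrite -yp hg_invK.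
    suff -> : A = inv @` (inv @` A) by exact: mimg.
    apply/seteqP; split=> [x Ax|_ [_ [x Ax <-] <-]]; last by rewrite hg_invK.
    by exists (inv x); [exists x|rewrite hg_invK].
  move=> [mA Ap]; split; first exact: mimg.
  by exists (inv p) => //; rewrite hg_invK.
split.
  rewrite /hconv_dirac -abp -pV /hconv_dirac -convA//; last exact: hg_conv_ge0.
  rewrite [X in conv _ X]convA// -/(hconv_dirac H b (inv b)) bV conv_idl//.
rewrite /hconv_dirac -abp -pV /hconv_dirac -convA//; last exact: hg_conv_ge0.
by rewrite [X in conv _ X]convA// -/(hconv_dirac H (inv a) a) Va conv_idl.
Qed.

Lemma supp_dirac (p : K) : supp (diracC p : set K -> R[i]) = [set p].
Proof.
apply/seteqP; split=> [z h|_ ->] /=.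
  apply: contrapT => zp.
  have oU : open (~` [set p]).
    by apply: closed_openC; apply: (compact_closed hK); exact: compact_set1.
  have := h _ oU zp; rewrite /diracC; case: asboolP => [[_]|]; last by rewrite eqxx.
  by move=> /(_ erefl).
move=> U oU Ux; rewrite /diracC.
by case: asboolP => [_|[]]; [rewrite oner_neq0|split => //; exact: measurable_open].
Qed.

(** Near (x, y), the supports of the convolutions stay inside a given
    neighbourhood of the point p which carries the convolution at (x, y). *)
Lemma hmul_continuous x y p (S : set K) : hconv_dirac H x y = diracC p ->
  open S -> S p ->
  nbhs (x, y) [set q : K * K | supp (hconv_dirac H q.1 q.2) `<=` S].
Proof.
move=> xyp oS Sp; have oM := michael_open oS oS.
have := @hg_supp_continuous _ _ H (x, y).
move=> /(_ [set T | T `&` S !=set0 /\ T `<=` S]) h.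
have hS : nbhs (supp (hconv_dirac H x y) : michael_space K)
    [set T | T `&` S !=set0 /\ T `<=` S]; last first.
  apply: (@filterS _ (nbhs (x, y)) _ _ _ _ (h hS)).
  by move=> q [].
apply: open_nbhs_nbhs; split => //.
rewrite /= -/(hconv_dirac H x y) xyp supp_dirac.
by split; [exists p|move=> _ ->].
Qed.

Lemma htrans_ge0 (F : K -> \bar R) x y : (forall t, 0 <= F t)%E ->
  (0 <= htrans H F x y)%E.
Proof.
move=> F0; rewrite /htrans.
have [m [<- _ _ _]] := emeasure_measure hK (@hg_conv_ge0 _ _ H _ _ (rd x) (rd y)).
by apply: integral_ge0 => t _.
Qed.

Lemma htrans_dirac (F : K -> \bar R) x y p : hconv_dirac H x y = diracC p ->
  measurable_fun [set: borel K] (F : borel K -> \bar R) -> htrans H F x y = F p.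
Proof.
move=> xyp mF; rewrite /htrans xyp -toC_dirac integral_emeasure_toC//.
- by rewrite integral_dirac// diracE mem_set// mul1e.
- exact: hK.
- have d1 : @dirac _ (borel K) p R setT = 1%E by rewrite diracE mem_set.
  by change (@dirac _ (borel K) p R setT < +oo)%E; rewrite d1 ltry.
- exact: (radon_dirac _ hK).
Qed.

Variable mu : {measure set (borel K) -> \bar R}.
Hypothesis haar : left_haar H mu.

(** The set A is pushed by the translation into C. For a cut-off function k
    equal to 1 on C and supported near C, the translate of k is at least 1 on
    A, and its integral is that of k. *)
Lemma haar_le x (A : set (borel K)) (C : set K) : measurable A -> compact C ->
  (forall y, A y -> exists2 p, C p & hconv_dirac H x y = diracC p) ->
  (mu A <= mu C)%E.
Proof.
move=> mA cC h; have [rm _ inv] := haar.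
have mC := measurable_compact hK cC.
have fC : mu C \is a fin_num.
  by rewrite ge0_fin_numE//; have [+ _ _] := rm; exact.
apply/lee_addgt0Pr => d d0.
have [U [oU CU /ltW mU]] := radon_outer rm mC fC d0.
apply: le_trans mU.
have [k [kc k1 kC kU]] := Urysohn_Cc R hK lK cC oU CU; have [ck _ k0] := kc.
have mk : measurable_fun [set: borel K] (EFin \o k : borel K -> \bar R).
  by apply/measurable_EFinP; exact: measurable_continuous.
apply: (@le_trans _ _ (\int[mu]_y htrans H (EFin \o k) x y)%E).
  rewrite -[leLHS]mul1e; apply: lower_integral_indic => //.
  - by move=> y; apply: htrans_ge0 => t; rewrite lee_fin.
  - by move=> y Ay; have [p Cp xyp] := h _ Ay; rewrite (htrans_dirac xyp)//= kC.
rewrite inv//; apply: le_integral_indic => //.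
- exact: measurable_open.
- by move=> t nUt; rewrite kU.
Qed.

Hypothesis folner : forall U : set K, compact U -> forall eps : R, 0 < eps ->
    exists V : set K,
      [/\ compact V, (0 < mu V)%E, (mu V < +oo)%E,
          (mu (hmul H U V) < (1 + eps)%:E * mu V)%E
        & forall x, V x -> grouplike x].

(** For x not group-like the sets V and {x} * V are disjoint, since x v = z
    with v, z group-like would give x = z v^-. *)
Lemma folner_grouplike x : grouplike x.
Proof.
apply: contrapT => ngx.
have cU : compact [set e; x] by apply: compactU; exact: compact_set1.
have [V [cV V0 Voo hV gV]] := folner cU ltr01.
have ge : grouplike e by split; rewrite /hconv_dirac inv_id hg_idl.
have /choice[p hp] : forall v, exists p, V v -> hconv_dirac H x v = diracC p.
  move=> v; have [Vv|nVv] := pselect (V v); last by exists v.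
  by have [p pE] := conv_grouplike x (gV _ Vv); exists p.
have cpV : compact (p @` V).
  apply: continuous_compact => //; apply/subspace_continuousP => v Vv S.
  rewrite nbhsE => -[W [oW Wp] WS].
  have [[P Q] /= [hP hQ] PQ] := hmul_continuous (hp v Vv) oW Wp.
  apply: (filterS _ hQ) => w Qw Vw; apply: WS.
  have /= := PQ (x, w) (conj (nbhs_singleton hP) Qw).
  by rewrite (hp w Vw) supp_dirac; apply.
have mV := measurable_compact hK cV; have mpV := measurable_compact hK cpV.
have hE : hmul H [set e; x] V = V `|` p @` V.
  apply/seteqP; split=> z.
    move=> [u /= [->|->]] [v Vv].
      by rewrite /hconv_dirac hg_idl supp_dirac => ->; left.
    by rewrite hp// supp_dirac => ->; right; exists v.
  move=> [Vz|[v Vv <-]].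
    by exists e; [left|exists z => //; rewrite /hconv_dirac hg_idl supp_dirac].
  by exists x; [right|exists v => //; rewrite hp// supp_dirac].
have dis : V `&` p @` V = set0.
  apply/seteqP; split=> // z [Vz [v Vv pv]]; apply: ngx.
  apply: (grouplike_mul (gV _ Vz) (grouplike_inv (gV _ Vv))).
  have [_ _] := haar; have [vV _] := gV _ Vv.
  rewrite /hconv_dirac -pv -(hp _ Vv) /hconv_dirac -convA//.
  by rewrite -/(hconv_dirac H v (inv v)) vV conv_idr.
have le : (mu V <= mu (p @` V))%E.
  apply: (@haar_le x) => // v Vv; exists (p v); [by exists v|exact: hp].
move: hV; rewrite hE measureU// => hV.
have : (mu V + mu V < (1 + 1)%:E * mu V)%E by apply: le_lt_trans hV; rewrite leeD2l.
have fV : mu V \is a fin_num by rewrite ge0_fin_numE.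
by rewrite -(fineK fV) -EFinD -EFinM lte_fin mulrDl mul1r ltxx.
Qed.

(** The product of x and y is the point carrying the convolution of their Dirac
    measures. It is continuous by the continuity of supports in the Michael
    topology. *)
Lemma folner_group : exists op : K -> K -> K,
  [/\ forall x y, hconv_dirac H x y = diracC (op x y),
      associative op, (left_id e op /\ right_id e op),
      (left_inverse e inv op /\ right_inverse e inv op) &
      continuous (fun q : K * K => op q.1 q.2)].
Proof.
have /choice[f hf] : forall q : K * K, exists p, hconv_dirac H q.1 q.2 = diracC p.
  by move=> q; exact: grouplike_conv (folner_grouplike _).
pose op x y := f (x, y).
have opE x y : hconv_dirac H x y = diracC (op x y) by exact: (hf (x, y)).
exists op; split => //.
- move=> x y z; apply: (diracC_inj (R := R) hK).
  rewrite -!opE /hconv_dirac -!opE /hconv_dirac; exact: convA.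
- split=> x; apply: (diracC_inj (R := R) hK); rewrite -opE /hconv_dirac.
    exact: hg_idl.
  exact: hg_idr.
- split=> x; apply: (diracC_inj (R := R) hK); rewrite -opE.
    exact: (folner_grouplike x).2.
  exact: (folner_grouplike x).1.
- move=> [x y] S; rewrite nbhsE => -[W [oW Wp] WS].
  apply: (filterS _ (hmul_continuous (opE x y) oW Wp)) => -[x' y'] /=.
  by rewrite opE supp_dirac => h; apply: WS; exact: h.
Qed.

End Grouplike.

(** * Young functions *)

Section YoungFacts.
Variables (R : realType) (phi : R -> \bar R).
Hypothesis yphi : young phi.
Implicit Types (x y t : R).

Lemma young_ge0 x : (0 <= phi x)%E. Proof. by have [[]] := yphi. Qed.
Lemma young0 : phi 0 = 0%E. Proof. by have [_ []] := yphi. Qed.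

Lemma young_convex x y t : 0 <= t <= 1 ->
  (phi (t * x + (1 - t) * y)%R <= t%:E * phi x + (1 - t)%:E * phi y)%E.
Proof. by have [[_ + _ _] _] := yphi; exact. Qed.

Lemma young_scale x t : 0 <= t <= 1 -> (phi (t * x)%R <= t%:E * phi x)%E.
Proof.
move=> t01; have := young_convex x 0 t01.
by rewrite mulr0 addr0 young0 mule0 adde0.
Qed.

Lemma young_le x y : 0 <= x <= y -> (phi x <= phi y)%E.
Proof.
move=> /andP[x0 xy]; have [y0|y0] := ltP 0 y; last first.
  have -> : x = y by apply/eqP; rewrite eq_le xy (le_trans y0).
  by [].
have t01 : 0 <= x / y <= 1 by rewrite divr_ge0 ?(ltW y0)//= ler_pdivrMr ?mul1r.
have := young_scale y t01; rewrite mulfVK ?gt_eqF// => h; apply: le_trans h _.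
by have /andP[t0 t1] := t01; rewrite -[leRHS]mul1e lee_wpmul2r ?young_ge0// lee_fin.
Qed.

Lemma young_expand c x : 1 <= c -> (c%:E * phi x <= phi (c * x)%R)%E.
Proof.
move=> c1; have c0 : 0 < c by rewrite (lt_le_trans ltr01).
have t01 : 0 <= c^-1 <= 1 by rewrite invr_ge0 (ltW c0)/= invf_le1.
have := young_scale (c * x) t01; rewrite mulKf ?gt_eqF// => h.
apply: (@le_trans _ _ (c%:E * (c^-1%:E * phi (c * x)))%E).
  by apply: lee_wpmul2l => //; rewrite lee_fin ltW.
by rewrite muleA -EFinM mulfV ?gt_eqF// mul1e.
Qed.

Lemma young_pos_arg : exists2 x, 0 < x & (0 < phi x)%E.
Proof.
have [_ [_ [x x0 px] _]] := yphi; exists x => //.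
by rewrite lt0e young_ge0 andbT; apply/eqP.
Qed.

Lemma young_lim (T : R) : exists2 x, 0 < x & (T%:E <= phi x)%E.
Proof.
have [x x0 px] := young_pos_arg.
have [d [d0 dpx]] : exists d, 0 < d /\ (d%:E <= phi x)%E.
  case: (phi x) px => [r| |]// r0; first by exists r; split => //; rewrite -lte_fin.
  by exists 1; rewrite ltr01 leey.
pose c := Num.max 1 (T / d).
have c1 : 1 <= c by rewrite /c le_max lexx.
exists (c * x); first by rewrite mulr_gt0// (lt_le_trans ltr01).
apply: le_trans (young_expand _ c1); apply: (@le_trans _ _ (c%:E * d%:E)%E).
  by rewrite -EFinM lee_fin -ler_pdivrMr// /c le_max lexx orbT.
by apply: lee_wpmul2l => //; rewrite lee_fin (le_trans ler01).
Qed.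

Lemma young_small (t : R) : 0 < t -> exists2 x, 0 < x & (phi x <= t%:E)%E.
Proof.
move=> t0; have [_ [_ _ [x x0 px]]] := yphi.
have fx : phi x \is a fin_num.
  by rewrite ge0_fin_numE ?young_ge0// ltey; apply/eqP.
pose M := fine (phi x); have M0 : 0 <= M by rewrite fine_ge0// young_ge0.
pose c := Num.min 1 (t / (M + 1)).
have M1 : 0 < M + 1 by rewrite ltr_wpDl.
have c0 : 0 < c by rewrite /c lt_min ltr01 divr_gt0.
exists (c * x); first by rewrite mulr_gt0.
apply: le_trans (young_scale _ _) _; first by rewrite (ltW c0) /c ge_min lexx.
rewrite -(fineK fx) -EFinM lee_fin -/M.
apply: (@le_trans _ _ (c * (M + 1))); first by rewrite ler_pM2l// lerDl.
by rewrite -ler_pdivlMr// /c ge_min lexx orbT.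
Qed.

(** A point just below the supremum defining phi^-1 (t); the factor 2 absorbs
    the fact that phi may jump to infinity without taking the value t. *)
Lemma young_level (t : R) : 0 < t ->
  exists u, [/\ 0 < u, (phi u <= t%:E)%E & (t%:E < phi (2 * u)%R)%E].
Proof.
move=> t0; pose S := [set x | 0 <= x /\ (phi x <= t%:E)%E].
have [x1 x10 px1] := young_small t0.
have [x2 x20 px2] := young_lim (t + 1).
have ubS : has_ubound S.
  exists x2 => x [x0 px]; rewrite leNgt; apply/negP => x2x.
  have := young_le (x := x2) (y := x); rewrite (ltW x20) (ltW x2x) => /(_ erefl) h.
  have := le_trans px2 (le_trans h px); rewrite lee_fin; lra.
have S1 : S x1 by split => //; exact: ltW.
have s0 : 0 < sup S by apply: lt_le_trans x10 _; exact: ub_le_sup.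
have hs : sup S / 2 < sup S by rewrite ltr_pdivrMr// ltr_pMr// ltr1n.
have [u [u0 pu] su] := sup_gt (ex_intro _ x1 S1) hs.
have u0' : 0 < u by apply: le_lt_trans su; rewrite divr_ge0// ltW.
exists u; split => //; rewrite ltNge; apply/negP => p2u.
have : S (2 * u) by split => //; rewrite mulr_ge0.
move=> /(ub_le_sup ubS); rewrite leNgt => /negP; apply.
by rewrite ltr_pdivrMr// mulrC in su.
Qed.

(** Sublevel sets of a convex function are intervals. *)
Lemma measurable_young : measurable_fun setT phi.
Proof.
apply: (measurability _ (ErealGenOInfty.measurableE R)).
move=> /= _ [_ [a ->]] <-; apply: measurableI => //.
rewrite -[X in measurable X]setCK; apply: measurableC.
apply: is_interval_measurable => x y /= hx hy z /andP[xz zy].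
have ple w : ~ (phi @^-1` `]a%:E, +oo[%classic) w -> (phi w <= a%:E)%E.
  move=> /= h; rewrite leNgt; apply/negP => aw; apply: h.
  have := aw; rewrite in_itv/= andbT.
  done.
move: hx hy => /ple hx /ple hy.
rewrite in_itv/= andbT; apply/negP; rewrite -leNgt.
have [xy|yx] := ltP x y; last first.
  by have -> : z = x by apply/eqP; rewrite eq_le xz andbT (le_trans zy).
pose t := (y - z) / (y - x).
have xy0 : 0 < y - x by rewrite subr_gt0.
have t01 : 0 <= t <= 1.
  by rewrite /t divr_ge0 ?subr_ge0 ?(ltW xy)//= ler_pdivrMr// mul1r; lra.
have -> : z = t * x + (1 - t) * y.
  by rewrite /t; field; rewrite gt_eqF.
apply: le_trans (young_convex _ _ t01) _.
have /andP[t0 t1] := t01.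
apply: (@le_trans _ _ (t%:E * a%:E + (1 - t)%:E * a%:E)%E).
  by apply: leeD; apply: lee_wpmul2l => //; rewrite lee_fin// subr_ge0.
by rewrite -!EFinM -EFinD lee_fin; lra.
Qed.

End YoungFacts.

(** * Modulars and Calderon-Lozanovskii spaces *)

Section MeasurableFunctions.
Variables (R : realType) (K : ptopologicalType).
Implicit Types f g : K -> R[i].

Lemma L0_D f g : L0 f -> L0 g -> L0 (f \+ g).
Proof.
move=> [f1 f2] [g1 g2]; split.
  rewrite (_ : (fun x => _) = (fun x => complex.Re (f x) + complex.Re (g x))).
    exact: measurable_funD.
  by apply/funext => x /=; case: (f x) (g x) => [a b] [].
rewrite (_ : (fun x => _) = (fun x => complex.Im (f x) + complex.Im (g x))).
  exact: measurable_funD.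
by apply/funext => x /=; case: (f x) (g x) => [a b] [].
Qed.

Lemma L0_Z (r : R) f : L0 f -> L0 (fun x => r%:C * f x).
Proof.
move=> [f1 f2]; split.
  rewrite (_ : (fun x => _) = (fun x => r * complex.Re (f x))).
    exact: measurable_funM.
  by apply/funext => x /=; case: (f x) => [a b] /=; rewrite mul0r subr0.
rewrite (_ : (fun x => _) = (fun x => r * complex.Im (f x))).
  exact: measurable_funM.
by apply/funext => x /=; case: (f x) => [a b] /=; rewrite mul0r addr0.
Qed.

Lemma L0_divr (r : R) f : L0 f -> L0 (fun x => f x / r%:C).
Proof.
move=> /(@L0_Z r^-1); congr L0; apply/funext => x.
by rewrite mulrC fmorphV.
Qed.

Lemma L0_real (h : borel K -> R) : measurable_fun setT h -> L0 (fun x => (h x)%:C).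
Proof. by move=> mh; split => //; exact: measurable_cst. Qed.

Lemma L0_indic (A : set (borel K)) : measurable A -> L0 (\1_A : K -> R[i]).
Proof.
move=> mA; rewrite (_ : \1_A = (fun x => (\1_A x : R)%:C)).
  by apply: L0_real; exact: measurable_indic.
by apply/funext => x; rewrite !indicE; case: (x \in A).
Qed.

Lemma measurable_cabs f : L0 f ->
  measurable_fun [set: borel K] (fun x : borel K => cabs (f x)).
Proof.
move=> [f1 f2].
rewrite (_ : (fun x => _) = (fun x => Num.sqrt (complex.Re (f x) ^+ 2 + complex.Im (f x) ^+ 2))).
  apply: (@measurableT_comp _ _ _ _ _ _ (@Num.sqrt R)).
    by apply: continuous_measurable_fun; exact: sqrt_continuous.
  by apply: measurable_funD; exact: measurable_funX.
by apply/funext => x; case: (f x).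
Qed.

End MeasurableFunctions.

Section AlmostEverywhere.
Variables (R : realType) (K : ptopologicalType).
Variable mu : {measure set (borel K) -> \bar R}.
Implicit Types P Q S : K -> Prop.

Lemma ae_imp P Q : (forall x, P x -> Q x) ->
  {ae mu, forall x, P x} -> {ae mu, forall x, Q x}.
Proof. by move=> PQ; apply: (@filterS (borel K)). Qed.

Lemma ae_imp2 P Q S : (forall x, P x -> Q x -> S x) ->
  {ae mu, forall x, P x} -> {ae mu, forall x, Q x} -> {ae mu, forall x, S x}.
Proof. by move=> PQ; apply: (@filterS2 (borel K)). Qed.

Lemma ae_imp3 P Q S S' : (forall x, P x -> Q x -> S x -> S' x) ->
  {ae mu, forall x, P x} -> {ae mu, forall x, Q x} -> {ae mu, forall x, S x} ->
  {ae mu, forall x, S' x}.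
Proof. by move=> PQ; apply: (@filterS3 (borel K)). Qed.

End AlmostEverywhere.

Section Modular.
Variables (R : realType) (K : ptopologicalType).
Variable mu : {measure set (borel K) -> \bar R}.
Variables (Omega : set (K -> R[i])) (nrm : (K -> R[i]) -> R).
Hypothesis bis : banach_ideal_space mu Omega nrm.
Hypothesis II : condII mu Omega.
Hypothesis III : condIII mu Omega nrm.
Hypothesis IV : condIV mu Omega nrm.

Local Notation ind A := (\1_A : K -> R[i]).

Section OnePhi.
Variable phi : R -> \bar R.
Hypothesis yphi : young phi.
Implicit Types f g : K -> R[i].
Local Notation modular := (modular mu Omega nrm).

(** The argument of [modular], before it is made finite and complex valued. *)
Definition phif f : K -> \bar R := fun x => phi (cabs (f x)).

Lemma modular_lty f : (modular phi f < +oo)%E ->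
  [/\ Omega (fineC (phif f)), {ae mu, forall x, phif f x \is a fin_num} &
      modular phi f = (nrm (fineC (phif f)))%:E].
Proof.
rewrite /modular; case: asboolP => // -[Of h] _; split => //.
by apply: ae_imp h => x [].
Qed.

Lemma modularE f : Omega (fineC (phif f)) ->
  {ae mu, forall x, phif f x \is a fin_num} ->
  modular phi f = (nrm (fineC (phif f)))%:E.
Proof.
move=> Of h; rewrite /modular; case: asboolP => // -[]; split => //.
by apply: ae_imp h => x fx; split.
Qed.

Lemma L0_phif f : L0 f -> L0 (fineC (phif f)).
Proof.
move=> Lf; apply: L0_real; apply: (@measurableT_comp _ _ _ _ _ _ fine).
  exact: fine_measurable.
by apply: measurableT_comp (measurable_young yphi) _; exact: measurable_cabs.
Qed.

Lemma phif_ge0 f x : (0 <= phif f x)%E. Proof. exact: young_ge0. Qed.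

Lemma cabs_fineC f x : cabs (fineC (phif f) x) = fine (phif f x).
Proof. by rewrite /fineC cabs_real ger0_norm// fine_ge0// phif_ge0. Qed.

(** Both sides are compared pointwise by the convexity of phi, then in norm by
    the ideal property. *)
Lemma modular_convex f g (t : R) : 0 <= t <= 1 -> L0 f -> L0 g ->
  (modular phi f < +oo)%E -> (modular phi g < +oo)%E ->
  (modular phi (fun x => (t%:C * f x + (1 - t)%:C * g x)%R)
    <= t%:E * modular phi f + (1 - t)%:E * modular phi g)%E.
Proof.
move=> t01 Lf Lg /modular_lty[Of ff ->] /modular_lty[Og fg ->].
have /andP[t0 t1] := t01; have t1' : 0 <= 1 - t by rewrite subr_ge0.
set h := (fun x => _).
have Lh : L0 h by apply: L0_D; exact: L0_Z.
pose b := (fun x => t%:C * fineC (phif f) x) \+ (fun x => (1 - t)%:C * fineC (phif g) x).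
have Ob : Omega b by apply: (bis_D bis); exact: (bis_Z bis).
have hle x : phif f x \is a fin_num -> phif g x \is a fin_num ->
    (phif h x <= (t * fine (phif f x) + (1 - t) * fine (phif g x))%:E)%E.
  move=> fx gx; rewrite EFinD !EFinM (fineK fx) (fineK gx).
  apply: le_trans (young_convex yphi _ _ t01).
  apply: (young_le yphi); rewrite cabs_ge0/=.
  apply: le_trans (cabsD _ _) _.
  by rewrite !cabsM !cabs_real !ger0_norm.
have fh : {ae mu, forall x, phif h x \is a fin_num}.
  apply: ae_imp2 ff fg => x fx gx; rewrite ge0_fin_numE ?phif_ge0//.
  by apply: le_lt_trans (hle x fx gx) _; rewrite ltry.
have [Oh nh] : Omega (fineC (phif h)) /\ nrm (fineC (phif h)) <= nrm b.
  apply: (bis_ideal bis) => //; first exact: L0_phif.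
  apply: ae_imp3 ff fg fh => x fx gx hx; rewrite cabs_fineC.
  have bE : b x = (t * fine (phif f x) + (1 - t) * fine (phif g x))%:C.
    by rewrite /b /= /fineC -!rmorphM -rmorphD.
  have b0 : 0 <= t * fine (phif f x) + (1 - t) * fine (phif g x).
    by rewrite addr_ge0// mulr_ge0// fine_ge0// phif_ge0.
  rewrite bE cabs_real ger0_norm// -lee_fin fineK//; exact: hle.
rewrite modularE// -!EFinM -EFinD lee_fin; apply: le_trans nh _.
apply: le_trans (bis_normD bis _ _) _; [exact: (bis_Z bis)|exact: (bis_Z bis)|].
by rewrite !(bis_normZ bis)// !cabs_real !ger0_norm.
Qed.

Lemma modular0 : modular phi (fun=> 0) = 0%E.
Proof.
have e : fineC (phif (fun=> 0 : R[i])) = (fun=> 0).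
  by apply/funext => x; rewrite /fineC /phif cabs0 (young0 yphi).
rewrite modularE ?e; last 2 first.
- exact: (bis_0 bis).
- by apply: aeW => x; rewrite /phif cabs0 (young0 yphi).
congr EFin; apply/(bis_norm_eq0 bis); first exact: (bis_0 bis).
exact: aeW.
Qed.

Lemma L0_0 : L0 ((fun=> 0) : K -> R[i]).
Proof. exact: (bis_L0 bis (bis_0 bis)). Qed.

Lemma modular_scale f (t : R) : 0 <= t <= 1 -> L0 f -> (modular phi f < +oo)%E ->
  (modular phi (fun x => (t%:C * f x)%R) <= t%:E * modular phi f)%E.
Proof.
move=> t01 Lf mf; have := modular_convex t01 Lf L0_0 mf.
rewrite modular0 mule0 adde0 => /(_ (ltry _)).
by congr (_ <= _)%E; congr modular; apply/funext => x; rewrite mulr0 addr0.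
Qed.

Lemma modular_ge0 f : (0 <= modular phi f)%E.
Proof.
rewrite /modular; case: asboolP => // -[Of _]; rewrite lee_fin.
exact: (bis_norm_ge0 bis).
Qed.

(** By convexity, dividing by a number larger than the modular brings it below
    1. *)
Lemma modular_rescale f (la : R) : 0 < la -> L0 f ->
  (modular phi (fun x => (f x / la%:C)%R) < +oo)%E ->
  exists2 l : R, 0 < l & (modular phi (fun x => (f x / l%:C)%R) <= 1)%E.
Proof.
move=> la0 Lf mf.
have fm : modular phi (fun x => (f x / la%:C)%R) \is a fin_num.
  by rewrite ge0_fin_numE// modular_ge0.
pose M := fine (modular phi (fun x => (f x / la%:C)%R)).
have M0 : 0 <= M by rewrite fine_ge0// modular_ge0.
have M1 : 0 < M + 1 by rewrite ltr_wpDl.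
exists (la * (M + 1)); first by rewrite mulr_gt0.
have t01 : 0 <= (M + 1)^-1 <= 1.
  by rewrite invr_ge0 (ltW M1)/= invf_le1// lerDr.
have := modular_scale t01 (L0_divr la Lf) mf.
have -> : (fun x => ((M + 1)^-1)%:C * (f x / la%:C)) =
    (fun x => f x / (la * (M + 1))%:C).
  by apply/funext => x; rewrite rmorphM fmorphV invfM; ring.
move=> h; apply: le_trans h _; rewrite -(fineK fm) -EFinM lee_fin mulrC.
by rewrite ler_pdivrMr// mul1r lerDl.
Qed.

Local Notation CLs := (CL_space mu Omega nrm phi).
Local Notation CLn := (CL_norm mu Omega nrm phi).

Lemma CL_has_inf f : CLs f ->
  has_inf [set la : R | 0 < la /\ (modular phi (fun x => (f x / la%:C)%R) <= 1)%E].
Proof.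
move=> [Lf [la la0 mf]]; split; last by exists 0 => x [/ltW].
by have [l l0 ml] := modular_rescale la0 Lf mf; exists l.
Qed.

Lemma CL_norm_lt f (d : R) : CLs f -> CLn f < d -> exists la,
  [/\ 0 < la, la < d & (modular phi (fun x => (f x / la%:C)%R) <= 1)%E].
Proof.
move=> /CL_has_inf[ne _] /(inf_lt ne)[la [la0 ml] lad].
by exists la.
Qed.

Lemma CL_norm_le f (la : R) : 0 < la ->
  (modular phi (fun x => (f x / la%:C)%R) <= 1)%E -> CLn f <= la.
Proof. by move=> la0 ml; apply: ge_inf; [exists 0 => x [/ltW]|split]. Qed.

Lemma CL_space_modular f (la : R) : L0 f -> 0 < la ->
  (modular phi (fun x => (f x / la%:C)%R) <= 1)%E -> CLs f.
Proof.
move=> Lf la0 ml; split => //; exists la => //; apply: le_lt_trans ml _; exact: ltry.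
Qed.

Lemma modular_add f g (l1 l2 : R) : L0 f -> L0 g -> 0 < l1 -> 0 < l2 ->
  (modular phi (fun x => (f x / l1%:C)%R) <= 1)%E ->
  (modular phi (fun x => (g x / l2%:C)%R) <= 1)%E ->
  (modular phi (fun x => ((f \+ g) x / (l1 + l2)%:C)%R) <= 1)%E.
Proof.
move=> Lf Lg l10 l20 m1 m2; have l0 : 0 < l1 + l2 by rewrite addr_gt0.
pose t := l1 / (l1 + l2).
have t01 : 0 <= t <= 1.
  by rewrite /t divr_ge0 ?(ltW l10) ?(ltW l0)//= ler_pdivrMr// mul1r lerDl ltW.
have lt1 (z : \bar R) : (z <= 1 -> z < +oo)%E by move=> h; apply: le_lt_trans h (ltry _).
have := modular_convex t01 (L0_divr l1 Lf) (L0_divr l2 Lg) (lt1 _ m1) (lt1 _ m2).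
have cn0 (r : R) : 0 < r -> r%:C != 0 :> R[i].
  by move=> r0; rewrite gt_eqF// ltcR.
have -> : (fun x => t%:C * (f x / l1%:C) + (1 - t)%:C * (g x / l2%:C)) =
    (fun x => (f \+ g) x / (l1 + l2)%:C).
  apply/funext => x /=; rewrite /t rmorphB rmorphM fmorphV rmorphD rmorph1.
  field; rewrite !cn0//= -rmorphD cn0//.
move=> h; apply: le_trans h _; have /andP[t0 t1] := t01.
apply: (@le_trans _ _ (t%:E * 1 + (1 - t)%:E * 1)%E).
  by apply: leeD; apply: lee_wpmul2l => //; rewrite lee_fin// subr_ge0.
by rewrite !mule1 -EFinD lee_fin addrC subrK.
Qed.

Lemma CL_D f g : CLs f -> CLs g -> CLs (f \+ g).
Proof.
move=> Cf Cg; have [Lf _] := Cf; have [Lg _] := Cg.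
have [[l1 [l10 m1]] _] := CL_has_inf Cf; have [[l2 [l20 m2]] _] := CL_has_inf Cg.
apply: (@CL_space_modular _ (l1 + l2)); first exact: L0_D.
  by rewrite addr_gt0.
exact: modular_add.
Qed.

Lemma CL_normD f g : CLs f -> CLs g -> CLn (f \+ g) <= CLn f + CLn g.
Proof.
move=> Cf Cg; have [Lf _] := Cf; have [Lg _] := Cg.
apply/ler_addgt0Pr => e e0; have e20 : 0 < e / 2 by rewrite divr_gt0.
have [l1 [l10 lf m1]] := CL_norm_lt Cf (ltr_pwDr e20 (lexx (CLn f))).
have [l2 [l20 lg m2]] := CL_norm_lt Cg (ltr_pwDr e20 (lexx (CLn g))).
have l0 : 0 < l1 + l2 by rewrite addr_gt0.
apply: le_trans (CL_norm_le l0 (modular_add Lf Lg l10 l20 m1 m2)) _; lra.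
Qed.

Lemma eq_modular_cabs f g : (forall x, cabs (f x) = cabs (g x)) ->
  modular phi f = modular phi g.
Proof.
move=> e; have -> : modular phi f = (if `[< Omega (fineC (phif f)) /\
  ae_represents mu (fineC (phif f)) (phif f) >] then (nrm (fineC (phif f)))%:E else +oo%E) by [].
by have -> : phif f = phif g by apply/funext => x; rewrite /phif e.
Qed.

Lemma CL_N f : CLs f -> CLs (fun x => - f x).
Proof.
move=> [Lf [la la0 ml]]; split.
  have := L0_Z (-1) Lf; congr L0; apply/funext => x.
  by rewrite rmorphN rmorph1 mulN1r.
exists la => //; rewrite (@eq_modular_cabs _ (fun x => f x / la%:C))// => x.
by rewrite mulNr cabsN.
Qed.

Lemma CL_B f g : CLs f -> CLs g -> CLs (f \- g).
Proof. by move=> Cf Cg; exact: CL_D Cf (CL_N Cg). Qed.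

(** A Markov inequality: T 1_N <= phi (|f|) almost everywhere, and the norm is
    monotone. *)
Lemma modular_cheby f (c T : R) (N : set (borel K)) :
  measurable N -> (mu N < +oo)%E -> 0 <= c -> 0 <= T -> (T%:E <= phi c)%E ->
  {ae mu, forall x, N x -> c <= cabs (f x)} ->
  (modular phi f <= 1)%E -> T * nrm (ind N) <= 1.
Proof.
move=> mN fN c0 T0 Tc hN m1.
have [Of ff mE] : [/\ Omega (fineC (phif f)), {ae mu, forall x, phif f x \is a fin_num} &
      modular phi f = (nrm (fineC (phif f)))%:E].
  by apply: modular_lty; apply: le_lt_trans m1 (ltry _).
rewrite mE lee_fin in m1; apply: le_trans m1.
have ON : Omega (ind N) by exact: II.
have -> : T * nrm (ind N) = nrm (fun x => T%:C * ind N x).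
  by rewrite (bis_normZ bis)// cabs_real ger0_norm.
have [_ ] : Omega (fun x => T%:C * ind N x) /\ nrm (fun x => T%:C * ind N x) <= nrm (fineC (phif f)).
  apply: (bis_ideal bis) => //; first by apply: L0_Z; exact: L0_indic.
  apply: ae_imp2 ff hN => x fx hx; rewrite cabs_fineC cabsM cabs_real ger0_norm// indicE.
  have [Nx|nNx] := pselect (N x); last first.
    by rewrite memNset// cabs0 mulr0 fine_ge0// phif_ge0.
  rewrite mem_set// [cabs 1]ComplexField.Normc.normc1 mulr1 -lee_fin fineK//.
  by apply: le_trans Tc _; apply: (young_le yphi); rewrite c0 hx.
by [].
Qed.

(** On the set where |f| >= a, the function phi (|f| / la) is at least phi (a /
    d), which is arbitrarily large for small d. This bounds the norm of the
    indicator of this set, and then its measure by [condIII]. *)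
Lemma CL_small_measure (a eta : R) (E : set (borel K)) : 0 < a -> 0 < eta ->
  measurable E -> (mu E < +oo)%E -> exists2 d : R, 0 < d &
  forall f, CLs f -> CLn f < d -> (mu (E `&` [set x | (a <= cabs (f x))%R]) < eta%:E)%E.
Proof.
move=> a0 eta0 mE fE; have [C C0 hC] := III mE fE.
have [x x0 Tx] := young_lim yphi (2 * C / eta).
have T0 : 0 < 2 * C / eta by rewrite divr_gt0// mulr_gt0.
exists (a / x); first by rewrite divr_gt0.
move=> f Cf nf; have [Lf _] := Cf.
have [la [la0 lad ml]] := CL_norm_lt Cf nf.
set N := E `&` _.
have mN : measurable (N : set (borel K)).
  apply: measurableI => //; rewrite -[X in measurable X]setTI.
  by apply: measurable_fun_le => //; exact: measurable_cabs.
have fN : (mu N < +oo)%E.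
  by apply: le_lt_trans fE; apply: le_measure; rewrite ?inE// => y [].
have hN : {ae mu, forall y, N y -> x <= cabs (f y / la%:C)}.
  apply: aeW => y [_ /= ay]; rewrite cabs_div// ler_pdivlMr//.
  by apply: le_trans ay; rewrite mulrC -ler_pdivlMr// ltW.
have h1 := modular_cheby mN fN (ltW x0) (ltW T0) Tx hN ml.
have ON : Omega (ind N) by exact: II.
have h2 := hC _ ON.
have h3 : (mu N <= (C * nrm (ind N))%:E)%E.
  apply: le_trans h2; rewrite -[leLHS]mul1e -integral_cst//=.
  rewrite integral_mkcond [leRHS]integral_mkcond; apply: le_lower_integral => y.
    by rewrite patchE; case: ifPn.
  rewrite !patchE; case: ifPn => [|_].
    rewrite inE => Ny; have [Ey _] := Ny; rewrite mem_set// lee_fin indicE mem_set//.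
    by rewrite ComplexField.Normc.normc1.
  by case: ifPn => // _; rewrite lee_fin cabs_ge0.
apply: le_lt_trans h3 _; rewrite lte_fin.
move: h1; rewrite mulrAC ler_pdivrMr// mul1r => h1; lra.
Qed.

Lemma modular_bump f (u t : R) (E : set (borel K)) :
  measurable E -> (mu E < +oo)%E -> L0 f -> 0 <= u -> (phi u <= t%:E)%E ->
  (forall x, E x -> cabs (f x) <= u) -> (forall x, ~ E x -> f x = 0) ->
  (modular phi f <= (t * nrm (ind E))%:E)%E.
Proof.
move=> mE fE Lf u0 put fu f0.
have t0 : 0 <= t by rewrite -lee_fin; apply: le_trans put; exact: young_ge0.
have OE : Omega (ind E) by exact: II.
have ple x : (phif f x <= (t * (x \in E)%:R)%:E)%E.
  have [Ex|nEx] := pselect (E x).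
    rewrite mem_set// mulr1; apply: le_trans put; apply: (young_le yphi).
    by rewrite cabs_ge0 fu.
  by rewrite memNset// mulr0 /phif f0// cabs0 (young0 yphi).
have fp x : phif f x \is a fin_num.
  by rewrite ge0_fin_numE ?phif_ge0//; apply: le_lt_trans (ple x) (ltry _).
have [Oh nh] : Omega (fineC (phif f)) /\ nrm (fineC (phif f)) <= nrm (fun x => t%:C * ind E x).
  apply: (bis_ideal bis); [exact: (bis_Z bis)|exact: L0_phif|].
  apply: aeW => x; rewrite cabs_fineC cabsM cabs_real ger0_norm// indicE.
  have := ple x; rewrite -{1}(fineK (fp x)) lee_fin.
  have -> : cabs ((x \in E)%:R : R[i]) = (x \in E)%:R.
    by case: (x \in E); rewrite ?cabs0 ?ComplexField.Normc.normc1.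
  by [].
rewrite modularE//; last exact: aeW.
by rewrite lee_fin; apply: le_trans nh _; rewrite (bis_normZ bis)// cabs_real ger0_norm.
Qed.

End OnePhi.

Section Indicators.
Implicit Types A B : set (borel K).

Lemma cabs_ind A x : cabs (ind A x) = (x \in A)%:R.
Proof. by rewrite indicE; case: (x \in A); rewrite ?cabs0 ?ComplexField.Normc.normc1. Qed.

Lemma nrm_ind_gt0 A : measurable A -> (mu A < +oo)%E -> (0 < mu A)%E -> 0 < nrm (ind A).
Proof.
move=> mA fA A0; have OA : Omega (ind A) by exact: II.
rewrite lt_neqAle (bis_norm_ge0 bis)// andbT eq_sym; apply/eqP => /(bis_norm_eq0 bis OA).
move=> [N [mN N0 hN]]; have : (mu A <= mu N)%E.
  apply: le_measure; rewrite ?inE// => x Ax; apply: hN => /=.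
  by rewrite indicE mem_set// => /eqP; rewrite oner_eq0.
by rewrite N0 leNgt A0.
Qed.

Lemma nrm_ind_le A B : measurable A -> measurable B -> (mu B < +oo)%E ->
  A `<=` B -> nrm (ind A) <= nrm (ind B).
Proof.
move=> mA mB fB AB; have OB : Omega (ind B) by exact: II.
have [] : Omega (ind A) /\ nrm (ind A) <= nrm (ind B).
  apply: (bis_ideal bis) => //; first exact: L0_indic.
  apply: aeW => x; rewrite !cabs_ind.
  have [Ax|nAx] := pselect (A x); last by rewrite [x \in A]memNset.
  by rewrite !mem_set//; exact: AB.
by [].
Qed.

Lemma nrm_ind_eq A B : measurable A -> measurable B -> (mu A < +oo)%E ->
  mu A = mu B -> nrm (ind A) = nrm (ind B).
Proof.
move=> mA mB fA AB; apply: IV => [|||x|s s0]; try exact: II.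
- by apply: II => //; rewrite -AB.
- by move=> x; rewrite indicE ler0n.
- by rewrite indicE ler0n.
have e (C : set (borel K)) : [set x | s%:C < ind C x] = if s < 1 then C else set0.
  have eR (y : borel K) : ind C y = ((y \in C)%:R : R)%:C.
    by rewrite indicE; case: (y \in C).
  apply/seteqP; split=> x /=; rewrite eR ltcR.
    have [Cx|nCx] := pselect (C x); first by rewrite mem_set// => ->.
    by rewrite memNset// ltNge s0.
  by case: ifPn => // s1 Cx; rewrite mem_set.
by rewrite !e; case: ifP.
Qed.

Lemma nrm_indU A B : measurable A -> measurable B -> (mu A < +oo)%E -> (mu B < +oo)%E ->
  nrm (ind (A `|` B)) <= nrm (ind A) + nrm (ind B).
Proof.
move=> mA mB fA fB.
have OA : Omega (ind A) by exact: II.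
have OB : Omega (ind B) by exact: II.
apply: le_trans (bis_normD bis OA OB).
have [] : Omega (ind (A `|` B)) /\ nrm (ind (A `|` B)) <= nrm (ind A \+ ind B).
  apply: (bis_ideal bis); [exact: (bis_D bis)|by apply: L0_indic; exact: measurableU|].
  apply: aeW => x; rewrite cabs_ind /= !indicE in_setU -natrD.
  rewrite -[X in cabs X](rmorph_nat (real_complex R)) cabs_real normr_nat ler_nat.
  by case: (x \in A); case: (x \in B).
by [].
Qed.

End Indicators.
End Modular.

Section Perturbation.
Variables (R : realType) (K : ptopologicalType).
Variable mu : {measure set (borel K) -> \bar R}.
Variables (Omega : set (K -> R[i])) (nrm : (K -> R[i]) -> R).
Hypothesis bis : banach_ideal_space mu Omega nrm.
Hypothesis II : condII mu Omega.
Local Notation ind A := (\1_A : K -> R[i]).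

(** w is a or -a on E, with the sign of the real part of f0. *)
Lemma exists_bump (f0 : K -> R[i]) (E : set (borel K)) (a : R) :
  L0 f0 -> measurable E -> 0 <= a -> exists w : K -> R[i],
  [/\ L0 w, forall x, E x -> cabs (w x) <= a, forall x, ~ E x -> w x = 0 &
      forall x, E x -> a <= cabs (f0 x + w x)].
Proof.
move=> [mf _] mE a0.
pose P : set (borel K) := E `&` [set x | 0 <= complex.Re (f0 x)].
have mP : measurable P.
  apply: measurableI => //; rewrite -[X in measurable X]setTI.
  by apply: measurable_fun_le.
have mN : measurable (E `\` P) by exact: measurableD.
exists (fun x => (a * (\1_P x - \1_(E `\` P) x))%:C).
have wP x : P x -> a * (\1_P x - \1_(E `\` P) x) = a.
  by move=> Px; rewrite !indicE mem_set// memNset ?subr0 ?mulr1// => -[].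
have wN x : (E `\` P) x -> a * (\1_P x - \1_(E `\` P) x) = - a.
  by move=> Px; have [_ nPx] := Px; rewrite !indicE memNset// mem_set//= sub0r mulrN1.
split.
- apply: L0_real; apply: measurable_funM => //.
  by apply: measurable_funB; exact: measurable_indic.
- move=> x Ex; rewrite cabs_real; have [Px|nPx] := pselect (P x).
    by rewrite wP// ger0_norm.
  by rewrite wN// normrN ger0_norm.
- move=> x nEx; rewrite !indicE !memNset ?subrr ?mulr0//; first by move=> [].
  by move=> [].
- move=> x Ex; apply: le_trans (ge_Re_cabs _).
  have -> (z : R[i]) (y : R) : complex.Re (z + y%:C) = complex.Re z + y by case: z.
  have [Px|nPx] := pselect (P x).
    rewrite wP//; have [_ /= h] := Px.
    by rewrite ger0_norm ?addr_ge0// lerDr.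
  rewrite wN//; have h : complex.Re (f0 x) < 0.
    by rewrite ltNge; apply/negP => h; apply: nPx; split.
  by rewrite ltr0_norm; lra.
Qed.

(** f1 = f0 + w for a function w of modulus at most u * (r / 2), null outside
    E; the hypotheses say that w has modular at most 1 after division by r / 2.
    *)
Lemma perturb (phi : R -> \bar R) (f0 : K -> R[i]) (E : set (borel K)) (u t r : R) :
  young phi -> CL_space mu Omega nrm phi f0 -> measurable E -> (mu E < +oo)%E ->
  0 <= u -> (phi u <= t%:E)%E -> t * nrm (ind E) <= 1 -> 0 < r ->
  exists f1, [/\ CL_space mu Omega nrm phi f1,
    CL_norm mu Omega nrm phi (f0 \- f1) < r &
    forall x, E x -> u * (r / 2) <= cabs (f1 x)].
Proof.
move=> yphi Cf mE fE u0 put tE r0; have [Lf _] := Cf.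
have r20 : 0 < r / 2 by rewrite divr_gt0.
have a0 : 0 <= u * (r / 2) by rewrite mulr_ge0// ltW.
have [w [Lw wE w0 fw]] := exists_bump Lf mE a0.
have mw : (modular mu Omega nrm phi (fun x => w x / (r / 2)%:C)%R <= 1)%E.
  apply: (@le_trans _ _ (t * nrm (ind E))%:E); last by rewrite lee_fin.
  apply: (modular_bump bis II yphi mE fE (L0_divr _ Lw) u0 put) => x.
    by move=> Ex; rewrite cabs_div// ler_pdivrMr// wE.
  by move=> nEx; rewrite w0// mul0r.
have Cw : CL_space mu Omega nrm phi w by exact: CL_space_modular mw.
exists (f0 \+ w); split => //; first exact: (CL_D bis yphi).
apply: (@le_lt_trans _ _ (r / 2)); last by lra.
apply: CL_norm_le => //.
rewrite (@eq_modular_cabs _ _ _ _ _ _ _ (fun x => w x / (r / 2)%:C)%R)// => x /=.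
by rewrite opprD addrA subrr sub0r mulNr cabsN.
Qed.

Hypothesis IV : condIV mu Omega nrm.

Lemma fundamentalE (E : set (borel K)) (s : R) : measurable E -> mu E = s%:E ->
  fundamental mu nrm s = nrm (ind E).
Proof.
move=> mE Es; rewrite /fundamental.
set S := [set r | _].
have SE : S (nrm (ind E)) by exists E.
have [E' [mE' E's ->]] := xgetI 0 SE.
by apply: (nrm_ind_eq II IV) => //; rewrite E's ?Es ?ltry.
Qed.

End Perturbation.

(** * Haar measure of a locally compact group *)

Section Group.
Variables (R : realType) (K : ptopologicalType).
Hypothesis hK : hausdorff_space K.
Variables (op : K -> K -> K) (e : K) (inv : K -> K).
Hypotheses (opA : associative op) (op1x : left_id e op) (opx1 : right_id e op).
Hypotheses (opVx : left_inverse e inv op) (opxV : right_inverse e inv op).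
Hypothesis cop : continuous (fun q : K * K => op q.1 q.2).
Hypothesis cinv : continuous inv.
Variable mu : {measure set (borel K) -> \bar R}.
Hypothesis rm : radon (mu : set K -> \bar R).
(** The form of left invariance provided by [haar_le] *)
Hypothesis hle : forall x (A : set (borel K)) (C : set K),
  measurable A -> compact C -> (forall y, A y -> C (op x y)) -> (mu A <= mu C)%E.

Lemma opKV x y : op x (op (inv x) y) = y.
Proof. by rewrite opA opxV op1x. Qed.

Lemma opVK x y : op (inv x) (op x y) = y.
Proof. by rewrite opA opVx op1x. Qed.

Lemma continuous_op (T : topologicalType) (f g : T -> K) :
  continuous f -> continuous g -> continuous (fun t => op (f t) (g t)).
Proof.
move=> cf cg t.
apply: (@continuous_comp _ _ _ (fun t => (f t, g t)) (fun q => op q.1 q.2)).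
  by apply: cvg_pair; [exact: cf|exact: cg].
exact: cop.
Qed.

Lemma continuous_opl x : continuous (op x).
Proof. by apply: continuous_op => //; [exact: cst_continuous|move=> t; exact: cvg_id]. Qed.

(** The set x A, as an inverse image so that open and Borel sets are clearly
    preserved; see [translateE]. *)
Definition translate (x : K) (A : set K) : set K := [set y | A (op (inv x) y)].

Lemma translateE x A : translate x A = op x @` A.
Proof.
apply/seteqP; split=> [y Ay|_ [y Ay <-]]; last by rewrite /translate/= opVK.
by exists (op (inv x) y) => //; rewrite opKV.
Qed.

Lemma translateK x A : translate (inv x) (translate x A) = A.
Proof. by apply/seteqP; split=> y; rewrite /translate/= opKV. Qed.

Lemma open_translate x A : open A -> open (translate x A).
Proof. by move=> oA; exact: ((continuousP _).1 (@continuous_opl (inv x)) _ oA). Qed.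

Lemma compact_translate x A : compact A -> compact (translate x A).
Proof.
move=> cA; rewrite translateE; apply: continuous_compact => //.
exact: continuous_subspaceT (@continuous_opl x).
Qed.

Lemma measurable_translate x (A : set (borel K)) : measurable A ->
  measurable (translate x A : set (borel K)).
Proof.
have : measurable_fun [set: borel K] (op (inv x) : borel K -> borel K).
  apply: (measurability _ (erefl (@measurable _ (borel K)))).
  move=> _ [U oU <-]; rewrite setTI; apply: measurable_open.
  exact: ((continuousP _).1 (@continuous_opl (inv x)) _ oU).
by move=> /(_ measurableT A) h /h; rewrite setTI.
Qed.

Lemma mu_le (A B : set (borel K)) : measurable A -> measurable B ->
  A `<=` B -> (mu A <= mu B)%E.
Proof. by move=> ? ? ?; apply: le_measure; rewrite ?inE. Qed.

Lemma mu_compact_fin (C : set K) : compact C -> mu C \is a fin_num.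
Proof. by move=> cC; rewrite ge0_fin_numE//; have [+ _ _] := rm; exact. Qed.

(** Invariance passes from compact sets to open sets by inner regularity and to
    Borel sets by outer regularity. *)
Lemma mu_translate x (A : set (borel K)) : measurable A -> mu (translate x A) = mu A.
Proof.
have [_ r2 r3] := rm.
have hC y (C : set K) : compact C -> (mu C <= mu (translate y C))%E.
  move=> cC; apply: (@hle y); [exact: measurable_compact|exact: compact_translate|].
  by move=> z Cz; rewrite /translate/= opVK.
have hO y (U : set K) : open U -> (mu U <= mu (translate y U))%E.
  move=> oU; rewrite r3//; apply: ge_ereal_sup => _ [C [cC CU] <-].
  apply: le_trans (hC y _ cC) _; apply: mu_le.
  - by apply: measurable_translate; exact: measurable_compact.
  - by apply: measurable_translate; exact: measurable_open.
  - by move=> z; exact: CU.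
have hO' y (U : set K) : open U -> mu (translate y U) = mu U.
  move=> oU; apply/eqP; rewrite eq_le hO// andbT.
  by apply: le_trans (hO (inv y) _ (open_translate _ oU)) _; rewrite translateK.
have hB y (B : set (borel K)) : measurable B -> (mu (translate y B) <= mu B)%E.
  move=> mB; rewrite [leRHS]r2//; apply: le_ereal_inf_tmp => _ [U [oU BU] <-].
  rewrite -(hO' y U oU); apply: mu_le.
  - exact: measurable_translate.
  - by apply: measurable_translate; exact: measurable_open.
  - by move=> z; exact: BU.
move=> mA; apply/eqP; rewrite eq_le hB//=.
by rewrite -[leLHS](congr1 mu (translateK x A)); apply: hB; exact: measurable_translate.
Qed.

Definition mulset (A B : set K) : set K := 
  (fun q : K * K => op q.1 q.2) @` (A `*` B).

Lemma compact_mulset A B : compact A -> compact B -> compact (mulset A B).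
Proof.
move=> cA cB; apply: (@continuous_compact _ _ (fun q : K * K => op q.1 q.2)).
  exact: continuous_subspaceT.
exact: compact_setX.
Qed.

Lemma compact_inv A : compact A -> compact (inv @` A).
Proof. by move=> cA; apply: continuous_compact => //; exact: continuous_subspaceT. Qed.

(** If every translate of P met T, then K = T P^-1 would be compact. *)
Lemma disjoint_translate (T P : set K) : ~ compact [set: K] -> compact T ->
  compact P -> exists x, translate x P `&` T = set0.
Proof.
move=> nK cT cP; apply: contrapT => /forallNP h; apply: nK.
have -> : [set: K] = mulset T (inv @` P).
  apply/seteqP; split=> // x _; have /eqP/set0P[y [Py Ty]] := h x.
  exists (y, inv (op (inv x) y)); first by split => //=; exists (op (inv x) y).
  by rewrite /= -{1}(opKV x y) -opA opxV opx1.
by apply: compact_mulset => //; exact: compact_inv.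
Qed.

(** U may have infinite measure, so the inner regularity is applied to the
    trace of U on an open neighbourhood of D of finite measure. *)
Lemma inner_compact_open (D U : set K) (s : \bar R) : compact D -> open U ->
  (s < mu (D `&` U))%E -> exists T, [/\ compact T, T `<=` D `&` U & (s < mu T)%E].
Proof.
move=> cD oU sDU; have mD := measurable_compact hK cD.
have fD := mu_compact_fin cD; have mU := measurable_open oU.
have mDU : measurable (D `&` U : set (borel K)) by exact: measurableI.
have fDU : mu (D `&` U) \is a fin_num.
  rewrite ge0_fin_numE//; apply: le_lt_trans (_ : mu D < +oo)%E.
    by apply: mu_le => // x [].
  by rewrite -ge0_fin_numE.
have [S0|S0] := ltP s 0%E.
  by exists set0; split => //; [exact: compact0|rewrite measure0].
have fs : s \is a fin_num.
  by rewrite ge0_fin_numE//; apply: lt_trans sDU _; rewrite -ge0_fin_numE.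
pose d := fine (mu (D `&` U)) - fine s.
have d0 : 0 < d 
  by rewrite subr_gt0 -lte_fin !fineK.
have [W [oW DW mW]] := radon_outer rm mD fD ltr01.
(* W is an open neighbourhood of D of finite measure *)
have oWU : open (W `&` U) by exact: openI.
have mW' := measurable_open oW.
have fWU : mu (W `&` U) \is a fin_num.
  rewrite ge0_fin_numE//; apply: le_lt_trans (_ : mu W < +oo)%E.
    by apply: mu_le; [exact: measurable_open|exact: mW'|move=> x []].
  by apply: lt_trans mW _; rewrite -(fineK fD) -EFinD ltry.
have [C [cC CWU mC]] := radon_inner rm oWU fWU d0.
have mC' := measurable_compact hK cC.
exists (D `&` C); split.
- by apply: compact_closedI => //; exact: compact_closed.
- by move=> x [Dx /CWU[_ Ux]].
have mWU : measurable (W `&` U : set (borel K)) by exact: measurable_open.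
have mDC : measurable (D `&` C : set (borel K)) by exact: measurableI.
have fC := mu_compact_fin cC.
have mR : measurable ((W `&` U) `\` C : set (borel K)) by exact: measurableD.
have hR : (mu ((W `&` U) `\` C) < d%:E)%E.
  move: mC; rewrite -{1}(setDUK CWU) measureU//; last first.
    by apply/seteqP; split=> // x [Cx [_ /(_ Cx)]].
  by rewrite lteD2lE.
have h1 : (mu (D `&` U) <= mu (D `&` C) + mu ((W `&` U) `\` C))%E.
  apply: (@le_trans _ _ (mu ((D `&` C) `|` ((W `&` U) `\` C)))); last exact: measureU2.
  apply: mu_le => //; first exact: measurableU.
  move=> x [Dx Ux]; have [Cx|nCx] := pselect (C x); first by left.
  by right; split => //; split => //; exact: DW.
have fDC : mu (D `&` C) \is a fin_num.
  by apply: mu_compact_fin; apply: compact_closedI => //; exact: compact_closed.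
have fR : mu ((W `&` U) `\` C) \is a fin_num.
  by rewrite ge0_fin_numE//; apply: lt_trans hR _; rewrite ltry.
move: h1 hR; rewrite -(fineK fDU) -(fineK fDC) -(fineK fR) -(fineK fs) -EFinD !lee_fin !lte_fin /d.
by lra.
Qed.

Lemma tube (T : set K) (W : set K) x : compact T -> open W ->
  (forall y, T y -> W (op (inv y) x)) ->
  \forall x' \near x, forall y, T y -> W (op (inv y) x').
Proof.
move=> /compact_near_coveringP cT oW hT.
have := cT K (nbhs x) (fun x' y => W (op (inv y) x')) _.
apply => y Ty.
have c : continuous (fun q : K * K => op (inv q.1) q.2).
  apply: continuous_op; last by move=> q; exact: cvg_snd.
  move=> q; apply: (@continuous_comp _ _ _ fst inv); first exact: cvg_fst.
  exact: cinv.
by have := c (y, x) W (open_nbhs_nbhs (conj oW (hT y Ty))).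
Qed.

Section Fubini.
Variables (U V W : set K) (tau : R).
Hypotheses (cU : compact U) (cV : compact V) (oW : open W) (tau0 : 0 < tau).

(** The section at x of the set of the pairs (y, x) with y in U and y^-1 x in
    W. *)
Definition slice x : set K := U `&` [set y | W (op (inv y) x)].
Definition bigslice : set K := [set x | (tau%:E < mu (slice x))%E].

Lemma open_sliceW x : open [set y | W (op (inv y) x)].
Proof.
have c : continuous (fun y => op (inv y) x).
  by apply: continuous_op => //; exact: cst_continuous.
exact: ((continuousP _).1 c _ oW).
Qed.

(** A compact subset of the slice at x remains in the slices at nearby points,
    by the tube lemma; so the measure of slices is lower semicontinuous. *)
Lemma bigslice_near x : bigslice x -> exists T, [/\ compact T, T `<=` U,
  (tau%:E < mu T)%E & \forall x' \near x, forall y, T y -> W (op (inv y) x')].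
Proof.
move=> /(inner_compact_open cU (open_sliceW x))[T [cT TU mT]].
exists T; split => //; first by move=> y /TU[].
by apply: tube => // y /TU[].
Qed.

Lemma open_bigslice : open bigslice.
Proof.
rewrite openE => x /bigslice_near[T [cT TU mT hT]].
apply: filterS hT => x' h; apply: lt_le_trans mT _.
apply: mu_le; first exact: measurable_compact.
  by apply: measurableI; [exact: measurable_compact|apply: measurable_open; exact: open_sliceW].
by move=> y Ty; split; [exact: TU|exact: h].
Qed.

(** Near each x of C there is a rectangle T_x * Z_x inside the set of the pairs
    (y, x') with y^-1 x' in W, with mu T_x > tau. Finitely many Z_x cover C,
    and after making them disjoint the two iterated integrals of the union of
    these rectangles are finite sums. One is at least tau mu C, the other is at
    most the integral over U of mu (y W) = mu W. *)
Lemma fubini_compact (C : set K) : compact C -> C `<=` bigslice ->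
  (tau%:E * mu C <= mu U * mu W)%E.
Proof.
move=> cC CB; have mU := measurable_compact hK cU.
have /choice[TZ hTZ] : forall x, exists TZ : set K * set K, C x ->
    [/\ compact TZ.1, TZ.1 `<=` U, (tau%:E < mu TZ.1)%E, open TZ.2 /\ TZ.2 x &
       forall x' y, TZ.2 x' -> TZ.1 y -> W (op (inv y) x')].
  move=> x; have [Cx|nCx] := pselect (C x); last by exists (set0, set0).
  have [T [cT TU mT hT]] := bigslice_near (CB _ Cx).
  have : nbhs x [set x' | forall y, T y -> W (op (inv y) x')] by exact: hT.
  rewrite nbhsE => -[Z [oZ Zx] ZT].
  by exists (T, Z) => _; split => // x' y /ZT; apply.
have [x Cx|s [sC Cs]] := compact_seq_cover (f := fun x => (TZ x).2) cC.
  by have [_ _ _ ? _] := hTZ _ Cx.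
have mWx y : measurable ([set x | W (op (inv y) x)] : set (borel K)).
  exact: (@measurable_translate y W (measurable_open oW)).
have key : forall (s : seq K), (forall i, i \in s -> C i) ->
  forall C' : set (borel K), measurable C' -> C' `<=` C ->
  C' `<=` \big[setU/set0]_(i <- s) (TZ i).2 ->
  exists g : borel K -> \bar R, [/\ measurable_fun setT g, (forall y, 0 <= g y)%E,
    (forall y, g y <= mu (C' `&` [set x | W (op (inv y) x)]))%E &
    (tau%:E * mu C' <= \int[mu]_(y in U) g y)%E].
  elim=> [|i t IH] hs C' mC' C'C.
    rewrite big_nil subset0 => ->; exists (fun=> 0%E); split => //.
    by rewrite measure0 mule0 integral0.
  rewrite big_cons => C's.
  have [cT TU mT [oZ Zi] hZ] := hTZ _ (hs i (mem_head _ _)).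
  set T := (TZ i).1 in cT TU mT hZ; set Z := (TZ i).2 in oZ Zi hZ C's.
  have mZ := measurable_open oZ; have mT' := measurable_compact hK cT.
  have mCD : measurable (C' `\` Z : set (borel K)) by exact: measurableD.
  have mCI : measurable (C' `&` Z : set (borel K)) by exact: measurableI.
  have [|||g [mg g0 gle gint]] := IH _ (C' `\` Z) mCD.
  - by move=> j jt; apply: hs; rewrite inE jt orbT.
  - by move=> x [/C'C].
  - by move=> x [/C's[]].
  exists (fun y => (mu (C' `&` Z) * (\1_T y)%:E) + g y)%E; split.
  - apply: emeasurable_funD => //; apply: measurable_funeM.
    by apply/measurable_EFinP; exact: measurable_indic.
  - by move=> y; rewrite adde_ge0// mule_ge0// lee_fin.
  - move=> y.
    have -> : C' `&` [set x | W (op (inv y) x)] =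
        (C' `&` Z `&` [set x | W (op (inv y) x)]) `|`
        ((C' `\` Z) `&` [set x | W (op (inv y) x)]).
      by rewrite -setIUl setUIDK.
    rewrite measureU//; last 3 first.
    + by apply: measurableI => //; exact: mWx.
    + by apply: measurableI => //; exact: mWx.
    + by apply/seteqP; split=> // x [[[_ Zx] _] [[_ /(_ Zx)]]].
    apply: leeD => //; rewrite indicE.
    have [Ty|nTy] := pselect (T y); last by rewrite memNset// mule0.
    rewrite mem_set// mule1; apply: mu_le => //.
      by apply: measurableI => //; exact: mWx.
    by move=> x [C'x Zx]; split => //; exact: hZ.
  - have fC : (mu C' = mu (C' `&` Z) + mu (C' `\` Z))%E.
      rewrite -measureU ?setUIDK//.
      by apply/seteqP; split=> // x [[_ Zx] [_ /(_ Zx)]].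
    rewrite fC ge0_muleDr// ge0_integralD//; last 2 first.
    + apply: measurable_funTS; apply: measurable_funeM; apply/measurable_EFinP.
      exact: measurable_indic.
    + exact: measurable_funTS.
    apply: leeD => //; rewrite ge0_integralZl//; last first.
      by apply: measurable_funTS; apply/measurable_EFinP; exact: measurable_indic.
    rewrite integral_indic// muleC; apply: lee_wpmul2l => //.
    by rewrite (setIidl TU); exact: ltW.
have mC := measurable_compact hK cC.
have [g [mg g0 gle gint]] := key s sC C mC (fun x => id) Cs.
apply: le_trans gint _.
rewrite muleC -integral_cst//=; apply: ge0_le_integral => //.
- exact: measurable_funTS.
- move=> y _; apply: le_trans (gle y) _.
  rewrite -(@mu_translate y W); last exact: measurable_open.
  by apply: mu_le; [apply: measurableI => //; exact: mWx|exact: mWx|move=> x []].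
Qed.

Lemma fubini_open : (tau%:E * mu (V `&` bigslice) <= mu U * mu W)%E.
Proof.
rewrite leNgt -lte_pdivrMl//; apply/negP.
move=> /(inner_compact_open cV open_bigslice)[T [cT TV]].
rewrite lte_pdivrMl// ltNge => /negP; apply.
by apply: fubini_compact => // x /TV[].
Qed.

End Fubini.
Lemma mu_point x : mu [set x] = mu [set e].
Proof.
rewrite -(@mu_translate x [set e]); last exact: measurable_point.
congr (mu _); apply/seteqP; split=> [y ->|y]; first by rewrite /translate/= opVx.
by rewrite /translate/= => h; rewrite -(opKV x y) h opx1.
Qed.

(** All points have the same mass r, so the measures of Borel sets below a
    finite value are multiples of r and points can be added one by one. *)
Lemma exists_subset_atomic (r : R) (A B : set (borel K)) :
  mu [set e] = r%:E -> 0 < r -> measurable A -> measurable B ->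
  mu B \is a fin_num -> (mu A <= mu B)%E ->
  exists B' : set (borel K), [/\ measurable B', B' `<=` B & mu B' = mu A].
Proof.
move=> mer r0 mA mB fB AB.
have atoms (C : set (borel K)) k : measurable C -> ((k%:R * r)%:E <= mu C)%E ->
    exists C' : set (borel K), [/\ measurable C', C' `<=` C & mu C' = (k%:R * r)%:E].
  move=> mC; elim: k => [|k IH] kC.
    by exists set0; split => //; rewrite measure0 mul0r.
  have [|C' [mC' C'C C'k]] := IH.
    by apply: le_trans kC; rewrite lee_fin; apply: ler_wpM2r; [exact: ltW|rewrite ler_nat].
  have mD : measurable (C `\` C' : set (borel K)) by exact: measurableD.
  have [x [Cx nC'x]] : C `\` C' !=set0.
    apply/set0P/negP => /eqP CC'.
    have : (mu C <= mu C')%E.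
      apply: mu_le => // y Cy; apply: contrapT => nC'y.
      by have : (C `\` C') y by []; rewrite CC'.
    rewrite C'k => /(le_trans kC); rewrite lee_fin ler_pM2r// ler_nat.
    by rewrite ltnn.
  have mx : measurable ([set x] : set (borel K)) by exact: measurable_point.
  exists (C' `|` [set x]); split.
  - exact: measurableU.
  - by move=> y [/C'C//|->].
  - rewrite measureU//; last by apply/seteqP; split=> // y [C'y yx]; apply: nC'x; rewrite -yx.
    rewrite [X in (_ + X)%E]mu_point mer -natr1 mulrDl mul1r EFinD; congr (_ + _)%E.
    exact: C'k.
have fA : mu A \is a fin_num.
  by rewrite ge0_fin_numE//; apply: le_lt_trans AB _; rewrite -ge0_fin_numE.
(* mu A is a multiple of r: A consists of k points and a remainder lighter than
   a point *)
pose k := Num.truncn (fine (mu A) / r).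
have A0 : 0 <= fine (mu A) / r by rewrite divr_ge0 ?fine_ge0// ltW.
have /andP[k1 k2] := truncn_itv A0.
rewrite ler_pdivlMr// in k1; rewrite ltr_pdivrMr// in k2.
have kA : ((k%:R * r)%:E <= mu A)%E by rewrite -(fineK fA) lee_fin.
have [A' [mA' A'A A'k]] := atoms A k mA kA.
have AA' : A = A'.
  apply/seteqP; split=> // x Ax; apply: contrapT => nA'x.
  have mx : measurable ([set x] : set (borel K)) by exact: measurable_point.
  have : (mu (A' `|` [set x]) <= mu A)%E.
    by apply: mu_le => //; [exact: measurableU|move=> y [/A'A//|->]].
  rewrite measureU//; last by apply/seteqP; split=> // y [A'y yx]; apply: nA'x; rewrite -yx.
  rewrite [X in (X + _)%E]A'k [X in (_ + X)%E]mu_point mer -(fineK fA) -EFinD lee_fin.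
  by move: k2; rewrite -natr1 mulrDl mul1r => /lt_le_trans h /h; rewrite ltxx.
have [B' [mB' B'B B'k]] := atoms B k mB (le_trans kA AB).
by exists B'; rewrite B'k AA' A'k.
Qed.

(** The theorem of Sierpinski: B is covered by finitely many translates of a
    neighbourhood of e of small measure, and adding the pieces one by one comes
    close to s from below; this is iterated with finer pieces. *)
Lemma exists_subset_diffuse (s : R) (B : set (borel K)) (D : set K) :
  mu [set e] = 0%E -> measurable B -> compact D -> B `<=` D ->
  0 <= s -> (s%:E <= mu B)%E ->
  exists B' : set (borel K), [/\ measurable B', B' `<=` B & mu B' = s%:E].
Proof.
move=> mue mB cD BD s0 sB; have me := measurable_point hK e.
have mD := measurable_compact hK cD.
have fin (A : set (borel K)) : measurable A -> A `<=` B -> mu A \is a fin_num.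
  move=> mA AB; rewrite ge0_fin_numE//; apply: le_lt_trans (_ : mu D < +oo)%E.
    by apply: mu_le => // x /AB/BD.
  by rewrite -ge0_fin_numE// mu_compact_fin.
have step (A0 : set (borel K)) (ep : R) : 0 < ep -> measurable A0 -> A0 `<=` B ->
    (mu A0 <= s%:E)%E -> exists A1 : set (borel K),
    [/\ measurable A1, A0 `<=` A1, A1 `<=` B, (mu A1 <= s%:E)%E &
        (s%:E <= mu A1 + ep%:E)%E].
  move=> ep0 mA0 A0B A0s.
  have [W [oW eW]] : exists W : set K, [/\ open W, [set e] `<=` W &
      (mu W < mu [set e] + ep%:E)%E].
    by apply: radon_outer => //; rewrite mue.
  rewrite mue add0e => mW; have mW' := measurable_open oW.
  have [x Dx|t [_ Dt]] := compact_seq_cover (f := fun x => translate x W) cD.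
    by split; [exact: open_translate|rewrite /translate/= opVx; exact: eW].
  have ml i : measurable (translate i W : set (borel K)) by exact: measurable_translate.
  have : exists A1 : set (borel K),
    [/\ measurable A1, A0 `<=` A1, A1 `<=` B, (mu A1 <= s%:E)%E &
        (s%:E <= mu A1 + ep%:E)%E \/ B `&` \big[setU/set0]_(i <- t) translate i W `<=` A1].
    elim: t {Dt} => [|i t [A1 [mA1 A01 A1B A1s]]].
      by exists A0; split => //; right; rewrite big_nil setI0.
    move=> [done|cov]; first by exists A1; split => //; left.
    have mBl : measurable (B `&` translate i W : set (borel K)) by exact: measurableI.
    have mU : measurable (A1 `|` (B `&` translate i W) : set (borel K)) by exact: measurableU.
    have [h|h] := leP (mu (A1 `|` (B `&` translate i W))) s%:E.
      exists (A1 `|` (B `&` translate i W)); split => //.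
      - by move=> x /A01; left.
      - by move=> x [/A1B//|[]].
      - by right; rewrite big_cons => x [Bx [ix|tx]]; [right|left; apply: cov].
    exists A1; split => //; left; apply: le_trans (ltW h) _.
    apply: le_trans (measureU2 _ mA1 mBl) _; rewrite leeD2l//.
    apply: le_trans (ltW mW); rewrite -(@mu_translate i W)//.
    by apply: mu_le => // x [].
  move=> [A1 [mA1 A01 A1B A1s [h|h]]]; exists A1; split => //.
  apply: le_trans sB _; apply: (@le_trans _ _ (mu A1)).
    by apply: mu_le => // x Bx; apply: h; split => //; apply: Dt; exact: BD.
  by rewrite leeDl// lee_fin ltW.
have /choice[f hf] : forall q : nat * set (borel K), exists A1 : set (borel K),
    measurable q.2 -> q.2 `<=` B -> (mu q.2 <= s%:E)%E ->
    [/\ measurable A1, q.2 `<=` A1, A1 `<=` B, (mu A1 <= s%:E)%E &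
        (s%:E <= mu A1 + (q.1.+1%:R^-1)%:E)%E].
  move=> [n A0] /=.
  have [h|h] := pselect [/\ measurable A0, A0 `<=` B & (mu A0 <= s%:E)%E].
    have [mA0 A0B A0s] := h.
    have [|A1 hA1] := step A0 n.+1%:R^-1 _ mA0 A0B A0s; first by rewrite invr_gt0.
    by exists A1.
  by exists set0 => ? ? ?; exfalso; apply: h.
(* increasing sets of measure at most s and at least s - 1 / n *)
pose F := fix F n := if n is k.+1 then f (k, F k) else set0 : set (borel K).
have hF n : [/\ measurable (F n), F n `<=` B & (mu (F n) <= s%:E)%E].
  elim: n => [|n [m1 m2 m3]].
    by split; [exact: measurable0|exact: sub0set|rewrite /= measure0 lee_fin].
  by have [] := hf (n, F n) m1 m2 m3.
have hS n : F n `<=` F n.+1 /\ (s%:E <= mu (F n.+1) + (n.+1%:R^-1)%:E)%E.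
  have [m1 m2 m3] := hF n.
  by have [] := hf (n, F n) m1 m2 m3.
have mF n : measurable (F n) by have [] := hF n.
have mUF : measurable (\bigcup_n F n : set (borel K)) by exact: bigcupT_measurable.
have UFB : \bigcup_n F n `<=` B by move=> x [n _]; have [_ + _] := hF n; exact.
exists (\bigcup_n F n); split => //.
apply/eqP; rewrite eq_le; apply/andP; split.
  have nd : {homo F : n m / (n <= m)%N >-> (n <= m)%O}.
    by apply/nondecreasing_seqP => n; rewrite subsetEset; have [] := hS n.
  have h := @nondecreasing_cvg_mu _ _ _ mu _ mF mUF nd.
  rewrite -(cvg_lim _ h)//; apply: lime_le.
    by apply/cvg_ex; exists (mu (\bigcup_n F n)).
  by apply: nearW => n; have [] := hF n.
apply/lee_addgt0Pr => ep ep0.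
pose n := Num.truncn ep^-1.
have nep : n.+1%:R^-1 < ep.
  by rewrite invf_plt ?posrE//; exact: truncnS_gt.
apply: le_trans (hS n).2 _; apply: leeD; last by rewrite lee_fin ltW.
by apply: mu_le => // x Fx; exists n.+1.
Qed.

(** Translations make all points equally heavy, so mu has either only atoms of
    one mass or none. *)
Lemma exists_subset_measure (A B : set (borel K)) (D : set K) :
  measurable A -> measurable B -> compact D -> B `<=` D -> (mu A <= mu B)%E ->
  exists B' : set (borel K), [/\ measurable B', B' `<=` B & mu B' = mu A].
Proof.
move=> mA mB cD BD AB; have mD := measurable_compact hK cD.
have fB : mu B \is a fin_num.
  rewrite ge0_fin_numE//; apply: le_lt_trans (_ : mu D < +oo)%E.
    exact: mu_le.
  by rewrite -ge0_fin_numE// mu_compact_fin.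
have fe : mu [set e] \is a fin_num by apply: mu_compact_fin; exact: compact_set1.
have [/eqP e0|e0] := boolP (mu [set e] == 0%E).
  have fA : mu A \is a fin_num.
    by rewrite ge0_fin_numE//; apply: le_lt_trans AB _; rewrite -ge0_fin_numE.
  have [||B' [? ? h]] := @exists_subset_diffuse (fine (mu A)) B D e0 mB cD BD.
  - exact: fine_ge0.
  - by rewrite fineK.
  - by exists B'; split => //; rewrite h fineK.
apply: (@exists_subset_atomic (fine (mu [set e]))) => //.
- by rewrite fineK.
- by rewrite fine_gt0// lt0e e0/= measure_ge0 -ge0_fin_numE.
Qed.

(** * Balls without bounded convolutions *)

Hypothesis K_noncompact : ~ compact [set: K].
Hypothesis folner : forall U : set K, compact U -> forall eps : R, 0 < eps ->
  exists V : set K, [/\ compact V, (0 < mu V)%E &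
    (mu (mulset U V) < (1 + eps)%:E * mu V)%E].

Variables (Omega : set (K -> R[i])) (nrm : (K -> R[i]) -> R).
Hypothesis bis : banach_ideal_space mu Omega nrm.
Hypothesis II : condII mu Omega.
Hypothesis III : condIII mu Omega nrm.
Hypothesis IV : condIV mu Omega nrm.
Hypothesis VI : condVI mu nrm.
Variables phi psi : R -> \bar R.
Hypotheses (yphi : young phi) (ypsi : young psi).
Hypothesis phi_lim : (young_inv phi x / x) @[x --> 0^'+] --> +oo.

Local Notation ind A := (\1_A : K -> R[i]).
Let fin (C : set K) (cC : compact C) := mu_compact_fin cC.
Let cpt_lty (C : set K) : compact C -> (mu C < +oo)%E.
Proof. by move=> cC; rewrite -ge0_fin_numE// fin. Qed.
Let mcpt (C : set K) (cC : compact C) := measurable_compact hK cC.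

(** By noncompactness one more disjoint translate of P can always be added. It
    has the measure of P, hence an indicator of the same norm by [condIV]. *)
Lemma union_translates (P : set K) (N : nat) : compact P -> exists U : set K,
  [/\ compact U, mu U = (N%:R * fine (mu P))%:E &
      nrm (ind U) <= N%:R * nrm (ind P)].
Proof.
move=> cP; elim: N => [|N [U [cU mU nU]]].
  exists set0; split; [exact: compact0|by rewrite measure0 mul0r|].
  rewrite mul0r (_ : ind set0 = fun=> 0); last by rewrite indic0.
  have [_ h] := bis_norm_eq0 bis (bis_0 bis).
  by rewrite h//; exact: aeW.
have [x xU] := disjoint_translate K_noncompact cU cP.
have cxP : compact (translate x P).
  exact: compact_translate.
have mxP : mu (translate x P) = mu P.
  by apply: mu_translate; exact: mcpt.
exists (U `|` translate x P); split; first exact: compactU.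
  rewrite measureU; [|exact: mcpt|exact: mcpt|by rewrite setIC].
  rewrite [X in (X + _)%E]mU [X in (_ + X)%E]mxP -[X in (_ + X)%E](fineK (fin cP)) -EFinD.
  by rewrite -natr1 mulrDl mul1r.
apply: le_trans (nrm_indU bis II _ _ _ _) _; try exact: mcpt; try exact: cpt_lty.
rewrite -natr1 mulrDl mul1r; apply: lerD => //.
rewrite (nrm_ind_eq II IV (mcpt cxP) (mcpt cP)) //; exact: cpt_lty.
Qed.

(** For a union U of N translates of P, mu U / ||1_U|| >= mu P / ||1_P||, while
    t = 1 / ||1_U|| tends to 0, so that phi^-1 (t) mu U is at least a constant
    times phi^-1 (t) / t. *)
Lemma big_compact (Lambda : R) : 0 < Lambda -> exists (U : set K) (u : R),
  [/\ compact U, 0 < u, (0 < mu U)%E, (phi u <= ((nrm (ind U))^-1)%:E)%E &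
      Lambda < u * fine (mu U) /\ 0 < nrm (ind U)].
Proof.
move=> L0'; have [P [cP P0 _]] := folner (@compact_set1 K e) ltr01.
pose mP := fine (mu P); have mP0 : 0 < mP by rewrite fine_gt0// P0 cpt_lty.
pose nP := nrm (ind P); have nP0 : 0 < nP.
  by apply: (nrm_ind_gt0 bis II) => //; [exact: mcpt|exact: cpt_lty].
pose M := Lambda * nP / mP; have M0 : 0 < M by rewrite divr_gt0// mulr_gt0.
have [d d0 hd] : exists2 d : R, 0 < d & forall x, 0 < x -> x < d -> M < young_inv phi x / x.
  have /cvgryPgt/(_ M) := phi_lim; rewrite near_withinE => -[d /= d0 hd].
  exists d => // x x0 xd; apply: hd => //=.
  by rewrite sub0r normrN gtr0_norm.
have [S hS] : exists S : R, forall s, attained mu s -> S < s -> d^-1 < fundamental mu nrm s.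
  have /cvgryPgt/(_ d^-1) := VI; rewrite near_withinE => -[S [_ hS]].
  by exists S => s As Ss; apply: hS.
pose N := (Num.truncn (`|S| / mP)).+1.
have [U [cU mU nU]] := union_translates N cP.
have N0 : 0 < N%:R :> R by rewrite ltr0n.
have SN : S < N%:R * mP.
  apply: le_lt_trans (ler_norm _) _; rewrite -ltr_pdivrMr//; exact: truncnS_gt.
have fU : d^-1 < nrm (ind U).
  by rewrite -(fundamentalE II IV (mcpt cU) mU); apply: hS => //; exists U => //; exact: mcpt.
have nU0 : 0 < nrm (ind U) by apply: lt_trans fU; rewrite invr_gt0.
set t := (nrm (ind U))^-1.
have t0 : 0 < t by rewrite invr_gt0.
have td : t < d by rewrite /t invf_plt ?posrE.
have := hd t t0 td; rewrite ltr_pdivlMr// => Mt.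
have S0 : [set x | 0 <= x /\ (phi x <= t%:E)%E] 0.
  by split => //; rewrite (young0 yphi) lee_fin ltW.
have [u [u0 pu] ut] := sup_gt (ex_intro _ 0 S0) Mt.
exists U, u; split => //.
- by apply: lt_trans ut; rewrite mulr_gt0.
- by rewrite mU lte_fin mulr_gt0.
split => //; rewrite mU /=.
have h1 : M * t * (N%:R * mP) < u * (N%:R * mP) by rewrite ltr_pM2r// mulr_gt0.
apply: le_lt_trans h1.
have -> : M * t * (N%:R * mP) = Lambda * (N%:R * nP) / nrm (ind U).
  by rewrite /M /t; field; rewrite !gt_eqF.
by rewrite ler_pdivlMr// ler_pM2l.
Qed.

(** The convolution |f| * |g| on the group. *)
Definition gconv (f g : K -> R[i]) (x : K) : \bar R :=
  (\int[mu]_y ((cabs (f y))%:E * (cabs (g (op (inv y) x)))%:E))%E.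

Lemma gconv_lower (f g : K -> R[i]) (a b : R) (x : K) (A : set (borel K)) :
  0 <= a -> 0 <= b -> measurable A ->
  (forall y, A y -> a <= cabs (f y)) -> (forall y, A y -> b <= cabs (g (op (inv y) x))) ->
  ((a * b)%:E * mu A <= gconv f g x)%E.
Proof.
move=> a0 b0 mA fA gA; apply: lower_integral_indic => //.
- by rewrite lee_fin mulr_ge0.
- by move=> y; rewrite mule_ge0// lee_fin cabs_ge0.
- by move=> y Ay; rewrite -EFinM lee_fin; apply: ler_pM => //; [exact: fA|exact: gA].
Qed.

(** [condIV] applies to A and to a subset of B of the measure of A. *)
Lemma nrm_ind_comparable (A B : set (borel K)) (D : set K) :
  measurable A -> measurable B -> compact D -> B `<=` D -> (mu A <= mu B)%E ->
  nrm (ind A) <= nrm (ind B).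
Proof.
move=> mA mB cD BD AB.
have fB : (mu B < +oo)%E.
  by apply: le_lt_trans (cpt_lty cD); apply: mu_le => //; exact: mcpt.
have [B' [mB' B'B e']] := exists_subset_measure mA mB cD BD AB.
rewrite -(nrm_ind_eq II IV mB' mA)//; last by rewrite [X in (X < _)%E]e'; apply: le_lt_trans fB.
exact: (nrm_ind_le bis II).
Qed.

Lemma cabs_near (z w : R[i]) (a : R) : a <= cabs z -> cabs (z - w) < a / 2 -> a / 2 <= cabs w.
Proof.
move=> az zw; have := cabsD (z - w) w; rewrite subrK; lra.
Qed.

Local Notation CLs := (CL_space mu Omega nrm).
Local Notation CLn := (CL_norm mu Omega nrm).

(** The perturbation (f1, g1) of (f0, g0) and the radius d such that no pair in
    the ball of radius d about (f1, g1) has a convolution of modular at most 1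
    after division by M. *)
Lemma escape (M r : R) (f0 g0 : K -> R[i]) : 0 < M -> 0 < r ->
  CLs phi f0 -> CLs psi g0 -> exists f1 g1,
  [/\ CLs phi f1, CLs psi g1, CLn phi (f0 \- f1) < r, CLn psi (g0 \- g1) < r &
   exists2 d : R, 0 < d & forall f g h, CLs phi f -> CLs psi g ->
     CLn phi (f1 \- f) < d -> CLn psi (g1 \- g) < d ->
     ae_represents mu h (gconv f g) ->
     ~ (modular mu Omega nrm psi (fun x => h x / M%:C)%R <= 1)%E].
Proof.
move=> M0 r0 Cf0 Cg0.
(* the constant is such that the bound c of the convolution satisfies c >= 4 M
   u0' *)
pose Lambda := 128 * M / r ^+ 2.
have L0' : 0 < Lambda by rewrite divr_gt0 ?mulr_gt0 ?exprn_gt0.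
have [U [u [cU u0 U0 pu [Lu nU0]]]] := big_compact L0'.
pose T := [set e] `|` inv @` U.
have cT : compact T by apply: compactU; [exact: compact_set1|exact: compact_inv].
(* with U^-1 in T the points y^-1 x stay in W, with e in T one has V `<=` W *)
have [V [cV V0 hV]] := folner cT (ltac:(by rewrite invr_gt0) : 0 < 4^-1 :> R).
pose W := mulset T V; have cW : compact W by exact: compact_mulset.
have VW : V `<=` W.
  by move=> x Vx; exists (e, x); [split => //; left|exact: op1x].
have UVW x y : U y -> V x -> W (op (inv y) x).
  by move=> Uy Vx; exists (inv y, x) => //; split => //; right; exists y.
have mV := mcpt cV; have mW := mcpt cW; have mU := mcpt cU.
have W0 : (0 < mu W)%E by apply: lt_le_trans V0 _; exact: mu_le.
pose nW := nrm (ind W); have nW0 : 0 < nW by apply: (nrm_ind_gt0 bis II) => //; exact: cpt_lty.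
have [u0' [u0'0 pu0 pu0']] := young_level ypsi (ltac:(by rewrite invr_gt0) : 0 < nW^-1).
have [|f1 [Cf1 nf1 f1U]] := perturb bis II yphi Cf0 mU (cpt_lty cU) (ltW u0) pu _ r0.
  by rewrite mulVf// gt_eqF.
have [|g1 [Cg1 ng1 g1W]] := perturb bis II ypsi Cg0 mW (cpt_lty cW) (ltW u0'0) pu0 _ r0.
  by rewrite mulVf// gt_eqF.
set a := u * (r / 2) in f1U; set b := u0' * (r / 2) in g1W.
have r20 : 0 < r / 2 by rewrite divr_gt0.
have a0 : 0 < a by rewrite mulr_gt0.
have b0 : 0 < b by rewrite mulr_gt0.
pose MU := fine (mu U); have MU0 : 0 < MU by rewrite fine_gt0// U0 cpt_lty.
pose MV := fine (mu V); have MV0 : 0 < MV by rewrite fine_gt0// V0 cpt_lty.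
have [d1 d10 hd1] := CL_small_measure bis II III yphi (ltac:(by rewrite divr_gt0) : 0 < a / 2)
  (ltac:(by rewrite divr_gt0) : 0 < MU / 4) mU (cpt_lty cU).
have [d2 d20 hd2] := CL_small_measure bis II III ypsi (ltac:(by rewrite divr_gt0) : 0 < b / 2)
  (ltac:(by rewrite divr_gt0) : 0 < MV / 16) mW (cpt_lty cW).
exists f1, g1; split => //; exists (Num.min d1 d2); first by rewrite lt_min d10.
move=> f g h Cf Cg; rewrite !lt_min => /andP[nf _] /andP[_ ng] hrep hmod.
have Cff := CL_B bis yphi Cf1 Cf; have Cgg := CL_B bis ypsi Cg1 Cg.
have {hd1} hN1 := hd1 _ Cff nf; have {hd2} hN2 := hd2 _ Cgg ng.
set N1 := U `&` _ in hN1; set N2 := W `&` _ in hN2.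
have mle (F : K -> R[i]) (c : R) : L0 F -> measurable ([set x | c <= cabs (F x)] : set (borel K)).
  move=> LF; rewrite -[X in measurable X]setTI.
  by apply: measurable_fun_le => //; exact: measurable_cabs.
have mN1 : measurable (N1 : set (borel K)) by apply: measurableI => //; apply: mle; exact: Cff.1.
have mN2 : measurable (N2 : set (borel K)) by apply: measurableI => //; apply: mle; exact: Cgg.1.
have fN2 : mu N2 \is a fin_num by rewrite ge0_fin_numE//; apply: lt_trans hN2 (ltry _).
(* the exceptional set is enlarged to an open set, as in the Fubini inequality
   *)
have [Z [oZ N2Z mZ]] : exists Z : set K, [/\ open Z, N2 `<=` Z & (mu Z < (MV / 16)%:E)%E].
  have ep : 0 < MV / 16 - fine (mu N2) by rewrite subr_gt0 -lte_fin fineK.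
  have [Z [oZ NZ]] := radon_outer rm mN2 fN2 ep.
  rewrite -{1}(fineK fN2) -EFinD addrC subrK => mZ; by exists Z.
pose tau := MU / 4; have tau0 : 0 < tau by rewrite divr_gt0.
pose Q := bigslice U Z tau.
have oQ : open Q by exact: open_bigslice.
have mQ := measurable_open oQ.
have mVQ : measurable (V `&` Q : set (borel K)) by exact: measurableI.
have fVQ : mu (V `&` Q) \is a fin_num.
  rewrite ge0_fin_numE//; apply: le_lt_trans (cpt_lty cV).
  by apply: mu_le => // x [].
have fZ : mu Z \is a fin_num by rewrite ge0_fin_numE//; apply: lt_trans mZ (ltry _).
(* for the points of V outside Q, most of U is sent by y |-> y^-1 x outside Z
   *)
have hQ : fine (mu (V `&` Q)) < MV / 4.
  have := fubini_open cU cV oZ tau0.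
  rewrite -/Q -(fineK fVQ) -(fineK fZ) -(fineK (fin cU)) -!EFinM lee_fin -/MU /tau => h1.
  have h2 : fine (mu Z) < MV / 16 by rewrite -lte_fin fineK.
  have h3 : fine (mu (V `&` Q)) / 4 <= fine (mu Z).
    by rewrite -(ler_pM2l MU0) mulrA mulrAC.
  lra.
pose V' : set (borel K) := V `\` Q.
have mV' : measurable V' by exact: measurableD.
have V'V : V' `<=` V by move=> x [].
have fV' : mu V' \is a fin_num.
  by rewrite ge0_fin_numE//; apply: le_lt_trans (cpt_lty cV); exact: mu_le.
have MV' : 3 / 4 * MV <= fine (mu V').
  have : mu V = (mu (V `&` Q) + mu V')%E.
    rewrite -measureU ?setUIDK//.
    by apply/seteqP; split=> // x [[_ Zx] [_ /(_ Zx)]].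
  move=> /(congr1 fine); rewrite fineD// -/MV => e1; lra.
(* W `\` V' has less measure than V', so 1_W is the sum of two indicators of
   norm at most that of 1_V' *)
have nWV' : nW <= 2 * nrm (ind V').
  have mD : measurable (W `\` V' : set (borel K)) by exact: measurableD.
  have fD : mu (W `\` V') \is a fin_num.
    by rewrite ge0_fin_numE//; apply: le_lt_trans (cpt_lty cW); apply: mu_le => // x [].
  have eW : fine (mu W) = fine (mu V') + fine (mu (W `\` V')).
    rewrite -fineD// -measureU//; last first.
      by apply/seteqP; split=> // x [V'x [_ /(_ V'x)]].
    by rewrite setDUK// => x /V'V/VW.
  have hW : fine (mu W) < 5 / 4 * MV.
    move: hV; rewrite -/W -(fineK (fin cW)) -[X in (_ < _ * X)%E](fineK (fin cV)).
    rewrite -EFinM lte_fin -/MV; lra.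
  have le : (mu (W `\` V') <= mu V')%E by rewrite -(fineK fD) -(fineK fV') lee_fin; lra.
  have := nrm_ind_comparable mD mV' cV V'V le.
  have := nrm_indU bis II mV' mD (ltac:(by rewrite -ge0_fin_numE) : (mu V' < +oo)%E)
    (ltac:(by rewrite -ge0_fin_numE) : (mu (W `\` V') < +oo)%E).
  rewrite setDUK; last by move=> x /V'V/VW.
  rewrite -/nW; lra.
pose c := a / 2 * (b / 2) * (MU / 2).
have c0 : 0 < c by rewrite !mulr_gt0// ?divr_gt0.
have hc x : V' x -> (c%:E <= gconv f g x)%E.
  move=> [Vx nQx]; pose S := slice U Z x.
  have mS : measurable (S : set (borel K)).
    apply: measurableI => //; apply: measurable_open.
    exact: open_sliceW.
  have hS : (mu S <= tau%:E)%E by rewrite leNgt; apply/negP.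
  have mNS : measurable (N1 `|` S : set (borel K)) by exact: measurableU.
  have NSU : N1 `|` S `<=` U by move=> y [[]|[]].
  (* on A both factors of the integrand are bounded below *)
  pose A : set (borel K) := U `\` (N1 `|` S).
  have mA : measurable A by exact: measurableD.
  have mAU : (mu A < +oo)%E by apply: le_lt_trans (cpt_lty cU); apply: mu_le => // y [].
  have fA : mu A \is a fin_num by rewrite ge0_fin_numE.
  have fNS : mu (N1 `|` S) \is a fin_num.
    by rewrite ge0_fin_numE//; apply: le_lt_trans (cpt_lty cU); exact: mu_le.
  have hNS : fine (mu (N1 `|` S)) <= MU / 2.
    rewrite -lee_fin fineK//; apply: le_trans (measureU2 _ mN1 mS) _.
    have -> : (MU / 2)%:E = ((MU / 4)%:E + tau%:E)%E by rewrite -EFinD /tau; congr EFin; lra.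
    by apply: leeD => //; exact: ltW.
  have MA : MU / 2 <= fine (mu A).
    have : MU = fine (mu (N1 `|` S)) + fine (mu A).
      rewrite -fineD// -measureU//; first by rewrite setDUK.
      by apply/seteqP; split=> // y [h1 [_ /(_ h1)]].
    lra.
  apply: (@le_trans _ _ ((a / 2 * (b / 2))%:E * mu A)%E).
    by rewrite -(fineK fA) -EFinM lee_fin ler_pM2l// mulr_gt0// divr_gt0.
  apply: gconv_lower => //; [by rewrite ltW// divr_gt0|by rewrite ltW// divr_gt0| |].
    move=> y [Uy nNS]; apply: (cabs_near (f1U _ Uy)).
    rewrite ltNge; apply/negP => h1; apply: nNS; left; split => //.
  move=> y [Uy nNS]; apply: (cabs_near (g1W _ (UVW _ _ Uy Vx))).
  rewrite ltNge; apply/negP => h1; apply: nNS; right; split => //=.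
  by apply: N2Z; split => //; exact: UVW.
have hh : {ae mu, forall x, V' x -> c / M <= cabs (h x / M%:C)}.
  apply: ae_imp hrep => x [fx ->] V'x; rewrite cabs_div// ler_pM2r ?invr_gt0//.
  rewrite cabs_real; apply: le_trans (ler_norm _).
  by rewrite -lee_fin fineK//; exact: hc.
have cM : 4 * u0' <= c / M.
  rewrite ler_pdivlMr// /c /a /b.
  have r2 : 0 < r ^+ 2 by rewrite exprn_gt0.
  have : 128 * M < u * MU * r ^+ 2 by rewrite -ltr_pdivrMr.
  have -> : u * (r / 2) / 2 * (u0' * (r / 2) / 2) * (MU / 2) =
    u0' * (u * MU * r ^+ 2) / 32 by field.
  move=> h1; rewrite ler_pdivlMr//.
  have -> : 4 * u0' * M * 32 = u0' * (128 * M) by ring.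
  by rewrite ler_pM2l// ltW.
(* psi (2 * u0') may be infinite, a real number T' between 1 / ||1_W|| and it
   suffices *)
have [T' T'1 T'2] : exists2 T' : R, nW^-1 < T' & (T'%:E <= psi (2 * u0')%R)%E.
  case: (psi (2 * u0')%R) pu0' => [z| |]//=.
    by rewrite lte_fin => hz; exists z.
  by move=> _; exists (nW^-1 + 1); [rewrite ltrDl|rewrite leey].
have hT : ((2 * T')%:E <= psi (c / M)%R)%E.
  apply: le_trans (_ : (psi (4 * u0')%R <= _)%E); last first.
    by apply: (young_le ypsi); rewrite cM mulr_ge0// ltW.
  have := young_expand ypsi (2 * u0') (ltac:(by rewrite ler1n) : 1 <= 2 :> R).
  rewrite mulrA -natrM; apply: le_trans.
  by rewrite EFinM; apply: lee_wpmul2l.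
have T'0 : 0 < T' by apply: lt_trans T'1; rewrite invr_gt0.
have := modular_cheby bis II ypsi mV' (ltac:(by rewrite -ge0_fin_numE) : (mu V' < +oo)%E)
  (ltW (divr_gt0 c0 M0)) (ltac:(by rewrite mulr_ge0// ltW) : 0 <= 2 * T') hT hh hmod.
have h1 : 1 < T' * nW by rewrite -ltr_pdivrMr// mul1r.
have h2 : T' * nW <= T' * (2 * nrm (ind V')) by rewrite ler_pM2l.
by move=> h3; have := lt_le_trans h1 h2; rewrite mulrA [T' * 2]mulrC ltNge h3.
Qed.

End Group.

(** * The category statement *)

(** The triangle inequality makes the balls open, so the centre q of a ball
    which avoids A is not in the closure of A. *)
Lemma nowhere_dense_dist (R : realType) (T : choiceType) (X : set T) (d : T -> T -> R)
    (A : set (dist_space X d)) :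
  (forall p r, X p -> 0 < r -> d p p < r) ->
  (forall p q s, X p -> X q -> X s -> d p s <= d p q + d q s) ->
  (forall p r, X p -> 0 < r -> exists q, [/\ X q, d p q < r &
     exists2 dl : R, 0 < dl & forall s : dist_space X d, d q (set_val s) < dl -> ~ A s]) ->
  nowhere_dense A.
Proof.
move=> dpp tri esc; apply/seteqP; split=> // p; rewrite /interior nbhsE /=.
move=> [B [oB Bp] BA].
have [r r0 rB] := (oB : dist_open B) p Bp.
have [q [Xq pq [dl dl0 hdl]]] := esc (set_val p) r (set_valP p) r0.
pose q' : dist_space X d := exist _ q (mem_set Xq).
have : closure A q' by apply: BA; apply: rB.
pose D : set (dist_space X d) := [set s : dist_space X d | d (set_val q') (set_val s) < dl].
have oD : open D.
  move=> s Ds; exists (dl - d q (set_val s)); first by rewrite subr_gt0.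
  move=> s' /= ss'; apply: le_lt_trans (tri _ _ _ Xq (set_valP s) (set_valP s')) _.
  by rewrite -ltrBrDl.
have dqq : D q' by exact: dpp.
move=> /(_ D (open_nbhs_nbhs (conj oD dqq)))[s [As Ds]].
exact: (hdl s Ds As).
Qed.

Theorem theorem2p12 (R : realType) (K : ptopologicalType)
  (H : hypergroup R K) (mu : {measure set (borel K) -> \bar R})
  (Omega : set (K -> R[i])) (nrm : (K -> R[i]) -> R)
  (phi psi : R -> \bar R)
  (K_noncompact : ~ compact [set: K])
  (mu_haar : left_haar H mu)
  (Omega_bis : banach_ideal_space mu Omega nrm)
  (Omega_I : condI mu Omega nrm)
  (Omega_II : condII mu Omega)
  (Omega_III : condIII mu Omega nrm)
  (Omega_IV : condIV mu Omega nrm)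
  (Omega_V : condV mu nrm)
  (Omega_VI : condVI mu nrm)
  (K_folner : forall U : set K, compact U -> forall eps : R, 0 < eps ->
    exists V : set K,
      [/\ compact V, (0 < mu V)%E, (mu V < +oo)%E,
          (mu (hmul H U V) < (1 + eps)%:E * mu V)%E
        & forall x, V x ->
            hconv_dirac H x (hg_inv H x) = diracC (hg_id H) /\
            hconv_dirac H (hg_inv H x) x = diracC (hg_id H)])
  (phi_young : young phi) (psi_young : young psi)
  (phi_b : (0 < young_at_b phi)%E) (psi_b : young_at_b psi = +oo%E)
  (phi_lim : (young_inv phi x / x) @[x --> 0^'+] --> +oo) :
  first_category
    [set p : CL_prod mu Omega nrm phi psi |
      exists2 h, CL_space mu Omega nrm psi h &
        ae_represents mu h
          (hconv_fun H mu (fun x => (cabs ((set_val p).1 x))%:E)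
                          (fun x => (cabs ((set_val p).2 x))%:E))].
Proof.
have hK := hg_hausdorff H.
have [op [opE opA [op1x opx1] [opVx opxV] cop]] := folner_group mu_haar K_folner.
have rm : radon (mu : set K -> \bar R) by have [] := mu_haar.
have hle x (A : set (borel K)) (C : set K) : measurable A -> compact C ->
    (forall y, A y -> C (op x y)) -> (mu A <= mu C)%E.
  move=> mA cC h; apply: (haar_le mu_haar (x := x)) => // y Ay.
  by exists (op x y); [exact: h|exact: opE].
have folner U : compact U -> forall eps : R, 0 < eps ->
    exists V : set K, [/\ compact V, (0 < mu V)%E &
      (mu (mulset op U V) < (1 + eps)%:E * mu V)%E].
  move=> cU eps eps0; have [V [cV V0 _ hV _]] := K_folner U cU eps eps0.
  exists V; split => //; move: hV; congr (mu _ < _)%E.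
  apply/seteqP; split=> z.
    move=> [x Ux [y Vy]]; rewrite opE (supp_dirac H) => ->.
    by exists (x, y).
  move=> [[x y] [/= Ux Vy] <-]; exists x => //; exists y => //.
  by rewrite opE (supp_dirac H).
have convE f g : L0 g -> hconv_fun H mu (fun x => (cabs (f x))%:E)
    (fun x => (cabs (g x))%:E) = gconv op (hg_inv H) mu f g.
  move=> Lg; apply/funext => x; apply: eq_integral => y _.
  rewrite (htrans_dirac (opE _ _))//.
  by apply/measurable_EFinP; exact: measurable_cabs.
pose F n : set (CL_prod mu Omega nrm phi psi) := [set p | exists h, [/\ L0 h,
  ae_represents mu h (hconv_fun H mu (fun x => (cabs ((set_val p).1 x))%:E)
                          (fun x => (cabs ((set_val p).2 x))%:E)) &
  (modular mu Omega nrm psi (fun x => h x / (n.+1%:R : R)%:C)%R <= 1)%E]].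
exists F; last first.
  apply/seteqP; split=> p.
    move=> [h Ch rep]; have [Lh _] := Ch.
    have [[la [la0 ml]] _] := CL_has_inf Omega_bis psi_young Ch.
    exists (Num.truncn la) => //; exists h; split => //.
    set n := Num.truncn la.
    have lan : la <= n.+1%:R by exact: ltW (truncnS_gt _).
    have t01 : 0 <= la / n.+1%:R <= 1.
      by rewrite divr_ge0 ?(ltW la0)//= ler_pdivrMr// mul1r.
    have lt : (modular mu Omega nrm psi (fun x => h x / la%:C)%R < +oo)%E.
      exact: le_lt_trans ml (ltry _).
    have := modular_scale Omega_bis psi_young t01 (L0_divr la Lh) lt.
    have -> : (fun x => (la / n.+1%:R)%:C * (h x / la%:C)) = (fun x => h x / (n.+1%:R : R)%:C).
      apply/funext => x; have l0 : la%:C != 0 :> R[i] by rewrite gt_eqF// ltcR.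
      rewrite rmorphM fmorphV [LHS]mulrCA; congr (_ * _).
      by rewrite mulrAC [X in X * _](mulfV l0) mul1r.
    move=> h1; apply: le_trans h1 _; rewrite -[leRHS]mule1.
    have /andP[t0 t1] := t01.
    by apply: lee_pmul => //; exact: modular_ge0.
  move=> [n _ [h [Lh rep mh]]]; exists h => //.
  by apply: CL_space_modular mh.
move=> n; apply: nowhere_dense_dist.
- move=> p r [Cp1 Cp2] r0.
  have small ph (yph : young ph) (a : K -> R[i]) : CL_norm mu Omega nrm ph (a \- a) < r.
    have r20 : 0 < r / 2 by rewrite divr_gt0.
    apply: (@le_lt_trans _ _ (r / 2)); last by lra.
    apply: CL_norm_le => //.
    have -> : (fun x => (a \- a) x / (r / 2)%:C) = (fun=> 0).
      by apply/funext => x /=; rewrite subrr mul0r.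
    by rewrite (modular0 Omega_bis yph).
  by rewrite gt_max !small.
- move=> p q s [Cp1 Cp2] [Cq1 Cq2] [Cs1 Cs2].
  have tri ph (yph : young ph) a b c : CL_space mu Omega nrm ph a ->
      CL_space mu Omega nrm ph b -> CL_space mu Omega nrm ph c ->
      CL_norm mu Omega nrm ph (a \- c) <=
      CL_norm mu Omega nrm ph (a \- b) + CL_norm mu Omega nrm ph (b \- c).
    move=> Ca Cb Cc.
    have -> : a \- c = (a \- b) \+ (b \- c).
      by apply/funext => x /=; rewrite addrA subrK.
    by apply: (CL_normD Omega_bis yph); exact: (CL_B Omega_bis yph).
  rewrite ge_max; apply/andP; split.
    apply: le_trans (tri _ phi_young _ q.1 _ Cp1 Cq1 Cs1) _.
    by apply: lerD; rewrite le_max lexx.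
  apply: le_trans (tri _ psi_young _ q.2 _ Cp2 Cq2 Cs2) _.
  by apply: lerD; rewrite le_max lexx orbT.
- move=> [f0 g0] r [/= Cf0 Cg0] r0.
have n0 : 0 < n.+1%:R :> R by rewrite ltr0n.
have [f1 [g1 [Cf1 Cg1 nf1 ng1 [d d0 hd]]]] := escape hK opA op1x opx1 opVx opxV cop
  (@hg_inv_continuous _ _ H) rm hle K_noncompact folner Omega_bis Omega_II Omega_III
  Omega_IV Omega_VI phi_young psi_young phi_lim n0 r0 Cf0 Cg0.
exists (f1, g1); split => //=; first by rewrite gt_max nf1.
exists d => // s; rewrite gt_max => /andP[sf sg] [h [Lh rep mh]].
have [/= Cs1 Cs2] := set_valP s.
by apply: (hd _ _ h Cs1 Cs2 sf sg _ mh); rewrite -convE//; exact: Cs2.1.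
Qed.
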